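(* Let $\mathcal{D}$ be a unitary fusion category realized as a category of finite-index endomorphisms of a type III factor $M$, and let $\mathcal{C}$ be a full fusion subcategory of $\mathcal{D}$. For each $\mathcal{E}^\alpha_\sigma\in\mathrm{Irr}(\mathcal{C}'\cap\mathcal{D})$, let $e(\mathcal{E}^\alpha_\sigma)_{(\lambda,i),(\mu,j)}\in\mathrm{Tube}(\mathcal{C},\mathcal{D})$ be the elements defined in the context, and let $z(\mathcal{E}^\alpha_\sigma)=\sum_{\lambda,i}e(\mathcal{E}^\alpha_\sigma)_{(\lambda,i),(\lambda,i)}$. Then the following hold. (1) For each $\mathcal{E}^\alpha_\sigma\in\mathrm{Irr}(\mathcal{C}'\cap\mathcal{D})$, the system $\{e(\mathcal{E}^\alpha_\sigma)_{(\lambda,i),(\mu,j)}\}_{(\lambda,i),(\mu,j)}$ is a system of matrix units of a simple component of $\mathrm{Tube}(\mathcal{C},\mathcal{D})$. (2) The operators $\{z(\mathcal{E}^\alpha_\sigma)\}_{\mathcal{E}^\alpha_\sigma\in\mathrm{Irr}(\mathcal{C}'\cap\mathcal{D})}$ are mutually orthogonal minimal central projections of $\mathrm{Tube}(\mathcal{C},\mathcal{D})$ with $\sum_{\mathcal{E}^\alpha_\sigma\in\mathrm{Irr}(\mathcal{C}'\cap\mathcal{D})}z(\mathcal{E}^\alpha_\sigma)=1$.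
   Context: Conventions. Objects of $\mathcal{D}$ are endomorphisms of $M$ of finite index; the tensor product is composition, and $\mathrm{Hom}(\rho,\sigma)=\{t\in M: t\rho(x)=\sigma(x)t \text{ for all } x\in M\}$. $d(\lambda)$ is the dimension of $\lambda$ (the square root of the minimal index of $\lambda(M)\subset M$). $\mathrm{Irr}(\mathcal{D})$ is a fixed set of representatives of the equivalence classes of simple objects of $\mathcal{D}$, and $\mathrm{Irr}(\mathcal{C})\subset\mathrm{Irr}(\mathcal{D})$ is the subset of those in $\mathcal{C}$; it contains the identity $\mathrm{id}$. $\dim\mathcal{C}=\sum_{\lambda\in\mathrm{Irr}(\mathcal{C})}d(\lambda)^2$. For $\mu\in\mathrm{Irr}(\mathcal{C})$, $\bar\mu\in\mathrm{Irr}(\mathcal{C})$ is the representative of the conjugate, and $R_\mu\in\mathrm{Hom}(\mathrm{id},\bar\mu\mu)$, $\bar R_\mu\in\mathrm{Hom}(\mathrm{id},\mu\bar\mu)$ are isometries with $\bar R_\mu^*\mu(R_\mu)=d(\mu)^{-1}=R_\mu^*\bar\mu(\bar R_\mu)$. Half-braidings. For an object $\sigma$ of $\mathcal{D}$, a half-braiding of $\sigma$ with respect to $\mathcal{C}$ is a family of unitaries $\mathcal{E}_\sigma=\{\mathcal{E}_\sigma(\beta)\}_{\beta\in\mathrm{Irr}(\mathcal{C})}$ with $\mathcal{E}_\sigma(\beta)\in\mathrm{Hom}(\sigma\beta,\beta\sigma)$ such that for all $\beta_1,\beta_2,\beta_3\in\mathrm{Irr}(\mathcal{C})$ and $X\in\mathrm{Hom}(\beta_3,\beta_1\beta_2)$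 one has $X\mathcal{E}_\sigma(\beta_3)=\beta_1(\mathcal{E}_\sigma(\beta_2))\mathcal{E}_\sigma(\beta_1)\sigma(X)$. The relative Drinfeld commutant $\mathcal{C}'\cap\mathcal{D}$ is the fusion category whose objects are pairs $(\sigma,\mathcal{E}_\sigma)$ of an object of $\mathcal{D}$ with a half-braiding with respect to $\mathcal{C}$; a morphism from $(\sigma,\mathcal{E}_\sigma)$ to $(\sigma',\mathcal{E}_{\sigma'})$ is $X\in\mathrm{Hom}(\sigma,\sigma')$ with $\mathcal{E}_{\sigma'}(\beta)X=\beta(X)\mathcal{E}_\sigma(\beta)$ for all $\beta\in\mathrm{Irr}(\mathcal{C})$; the tensor product of $(\sigma,\mathcal{E}_\sigma)$ and $(\sigma',\mathcal{E}_{\sigma'})$ is $\sigma\sigma'$ with half-braiding $\{\mathcal{E}_\sigma(\beta)\sigma(\mathcal{E}_{\sigma'}(\beta))\}_\beta$. Different half-braidings of the same $\sigma$ are distinguished by an index $\alpha$, as in $\mathcal{E}^\alpha_\sigma$. $\mathrm{Irr}(\mathcal{C}'\cap\mathcal{D})$ is a set of representatives $\mathcal{E}^\alpha_\sigma$ of the equivalence classes of simple objects of $\mathcal{C}'\cap\mathcal{D}$ (equivalence is by unitary morphisms). Relative tube algebra. As a vector space $\mathrm{Tube}(\mathcal{C},\mathcal{D})=\bigoplus_{\lambda,\nu\in\mathrm{Irr}(\mathcal{D}),\,\mu\in\mathrm{Irr}(\mathcal{C})}\mathrm{Hom}(\lambda\mu,\mu\nu)$; write $(\lambda\mu|X|\mu\nu)$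 for $X\in\mathrm{Hom}(\lambda\mu,\mu\nu)$ viewed in this summand. The product is $$(\lambda\mu|X|\mu\nu)(\lambda'\mu'|Y|\mu'\nu')=\delta_{\nu,\lambda'}\sum_{\kappa\in\mathrm{Irr}(\mathcal{C})}\sum_i(\lambda\kappa|\,T_{\kappa,i}^*\,\mu(Y)\,X\,\lambda(T_{\kappa,i})\,|\kappa\nu'),$$ where $\{T_{\kappa,i}\}_i$ is an orthonormal basis of $\mathrm{Hom}(\kappa,\mu\mu')$, and the $*$-structure is $$(\lambda\mu|X|\mu\nu)^*=d(\mu)\,(\nu\bar\mu|\,\bar\mu(\lambda(\bar R_\mu^* )X^* )R_\mu\,|\bar\mu\lambda).$$ With these operations $\mathrm{Tube}(\mathcal{C},\mathcal{D})$ is a finite-dimensional $C^*$-algebra. The elements $e$. Let $\mathcal{E}^\alpha_\sigma\in\mathrm{Irr}(\mathcal{C}'\cap\mathcal{D})$ and $[\sigma]=\bigoplus_{\lambda\in\mathrm{Irr}(\mathcal{D})}n_\lambda[\lambda]$. Fix an orthonormal basis $\{W_\sigma(\lambda)_i\}_{i=1}^{n_\lambda}$ of $\mathrm{Hom}(\lambda,\sigma)$ for each $\lambda$. For $\beta\in\mathrm{Irr}(\mathcal{C})$, $\lambda,\mu\in\mathrm{Irr}(\mathcal{D})$, $1\le i\le n_\lambda$, $1\le j\le n_\mu$, put $\mathcal{E}^\alpha_\sigma(\beta)_{(\lambda,i),(\mu,j)}=\beta(W_\sigma(\mu)_j^* )\,\mathcal{E}^\alpha_\sigma(\beta)\,W_\sigma(\lambda)_i\in\mathrm{Hom}(\lambda\beta,\beta\mu)$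 and $$e(\mathcal{E}^\alpha_\sigma)_{(\lambda,i),(\mu,j)}=\frac{d(\sigma)}{(\dim\mathcal{C})\,d(\lambda)^{1/2}d(\mu)^{1/2}}\sum_{\beta\in\mathrm{Irr}(\mathcal{C})}d(\beta)\,(\lambda\beta|\mathcal{E}^\alpha_\sigma(\beta)_{(\lambda,i),(\mu,j)}|\beta\mu)\in\mathrm{Tube}(\mathcal{C},\mathcal{D}).$$ *)

(* Defs.v *)
From HB Require Import structures.
From mathcomp Require Import all_boot all_order all_algebra.
From mathcomp Require Import complex.
From mathcomp Require Import all_classical all_reals all_analysis.

Set Implicit Arguments.
Unset Strict Implicit.
Unset Printing Implicit Defensive.

Import numFieldNormedType.Exports.
Import Order.TTheory GRing.Theory Num.Theory.

Local Open Scope classical_set_scope.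
Local Open Scope ring_scope.
Local Open Scope complex_scope.

(** * Von Neumann algebras *)

(* The dot product is linear in its first argument and conjugate-linear in
   its second one. *)
Record hilbertSpace (R : realType) := HilbertSpace {
  hilb_sort :> completeNormedModType R[i];
  hilb_dot : {dot hilb_sort for Num.conj};
  hilb_normE : forall u : hilb_sort, `|u| ^+ 2 = hilb_dot u u }.

Definition bounded_op (R : realType) (H : hilbertSpace R) (T : H -> H) : Prop :=
  linear T /\ continuous T.

Definition commutant (R : realType) (H : hilbertSpace R) (A : set (H -> H)) :
    set (H -> H) :=
  [set T | bounded_op T /\ forall S, A S -> T \o S = S \o T].

(* An abstract algebra together with a faithful unital star-representation
   whose image is equal to its bicommutant.  The last field also forces every
   [vna_rep x] to be a bounded operator, and [vna_star x] is represented by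
   the adjoint, so [vna_star] is an antilinear involution. *)
Record vonNeumannAlgebra (R : realType) := VonNeumannAlgebra {
  vna_sort :> algType R[i];
  vna_star : vna_sort -> vna_sort;
  vna_space : hilbertSpace R;
  vna_rep : vna_sort -> vna_space -> vna_space;
  vna_rep_linear : forall (a : R[i]) x y u,
    vna_rep (a *: x + y) u = a *: vna_rep x u + vna_rep y u;
  vna_repM : forall x y u, vna_rep (x * y) u = vna_rep x (vna_rep y u);
  vna_rep1 : forall u, vna_rep 1 u = u;
  vna_rep_inj : injective vna_rep;
  vna_rep_adj : forall x u v,
    hilb_dot vna_space (vna_rep x u) v =
    hilb_dot vna_space u (vna_rep (vna_star x) v);
  vna_bicommutant : commutant (commutant (range vna_rep)) = range vna_rep }.

Notation "x ^†" := (vna_star x) (at level 1, format "x ^†").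

Definition projection (R : realType) (M : vonNeumannAlgebra R) (p : M) : Prop :=
  p^† = p /\ p * p = p.

Definition isometry_elt (R : realType) (M : vonNeumannAlgebra R) (v : M) : Prop :=
  v^† * v = 1.

Definition unitary_elt (R : realType) (M : vonNeumannAlgebra R) (u : M) : Prop :=
  u^† * u = 1 /\ u * u^† = 1.

Definition is_factor (R : realType) (M : vonNeumannAlgebra R) : Prop :=
  forall x : M, (forall y, x * y = y * x) -> exists c : R[i], x = c%:A.

(* [v * v^†] is a subprojection of [p] iff it is fixed by [p]. *)
Definition finite_projection (R : realType) (M : vonNeumannAlgebra R) (p : M) :
    Prop :=
  projection p /\
  forall v : M, v^† * v = p -> p * (v * v^†) = v * v^† -> v * v^† = p.

Definition type_III (R : realType) (M : vonNeumannAlgebra R) : Prop :=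
  forall p : M, finite_projection p -> p = 0.

Definition pos_elt (R : realType) (M : vonNeumannAlgebra R) (x : M) : Prop :=
  exists y : M, x = y^† * y.

(* [S] is upward directed and converges weakly from below to [x], that is, [x]
   is the supremum of the increasing net [S]. *)
Definition increasing_to (R : realType) (M : vonNeumannAlgebra R) (S : set M)
    (x : M) : Prop :=
  [/\ S !=set0,
      forall a b, S a -> S b ->
        exists c, [/\ S c, pos_elt (c - a) & pos_elt (c - b)],
      forall a, S a -> pos_elt (x - a) &
      forall (u : vna_space M) (eps : R), 0 < eps ->
        exists2 a, S a &
          complex.Re (hilb_dot (vna_space M) (vna_rep (x - a) u) u) < eps].

Definition normal_map (R : realType) (M : vonNeumannAlgebra R) (f : M -> M) :
    Prop :=
  forall (S : set M) (x : M), increasing_to S x -> increasing_to (f @` S) (f x).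

(** * Minimal index and dimension *)

(* Faithful normal conditional expectation of [M] onto [N]. *)
Definition cond_expectation (R : realType) (M : vonNeumannAlgebra R) (N : set M)
    (E : M -> M) : Prop :=
  [/\ linear E /\ (forall x, N (E x)),
      E 1 = 1,
      forall a x b, N a -> N b -> E (a * x * b) = a * E x * b,
      forall x, pos_elt (E (x^† * x)) &
      (forall x, E (x^† * x) = 0 -> x = 0) /\ normal_map E].

(* Pimsner-Popa inequality  x <= t E(x)  for all positive x.  For expectations
   between infinite factors the best such t is the index of E; the minimal index
   is the smallest index over all expectations onto the subfactor. *)
Definition pimsner_popa (R : realType) (M : vonNeumannAlgebra R) (E : M -> M)
    (t : R) : Prop :=
  0 <= t /\ forall x : M, pos_elt (t%:C *: E (x^† * x) - x^† * x).

Definition expectation_index (R : realType) (M : vonNeumannAlgebra R)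
    (E : M -> M) : R :=
  inf [set t | pimsner_popa E t].

Definition finite_index_expectation (R : realType) (M : vonNeumannAlgebra R)
    (N : set M) : set (M -> M) :=
  [set E | cond_expectation N E /\ exists t, pimsner_popa E t].

Definition finite_index (R : realType) (M : vonNeumannAlgebra R) (N : set M) :
    Prop :=
  exists E, finite_index_expectation N E.

Definition minimal_index (R : realType) (M : vonNeumannAlgebra R) (N : set M) : R :=
  inf [set expectation_index E | E in finite_index_expectation N].

Definition dimension (R : realType) (M : vonNeumannAlgebra R) (rho : M -> M) : R :=
  Num.sqrt (minimal_index (range rho)).

(** * Categories of endomorphisms *)

Definition hom_space (R : realType) (M : vonNeumannAlgebra R) (rho sigma : M -> M) :
    set M :=
  [set t | forall x, t * rho x = sigma x * t].

Definition finite_index_endomorphism (R : realType) (M : vonNeumannAlgebra R)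
    (rho : {lrmorphism M -> M}) : Prop :=
  [/\ forall x, rho x^† = (rho x)^†, normal_map rho & finite_index (range rho)].

Definition simple_obj (R : realType) (M : vonNeumannAlgebra R) (rho : M -> M) :
    Prop :=
  forall t, hom_space rho rho t -> exists c : R[i], t = c%:A.

Definition equivalent (R : realType) (M : vonNeumannAlgebra R)
    (rho sigma : M -> M) : Prop :=
  exists2 u, hom_space rho sigma u & unitary_elt u.

(* A unitary fusion category realized by endomorphisms of [M], given by its set
   of objects (morphism spaces are the full [hom_space]s).  Endomorphisms are
   unital, so there is no zero object: only nonzero projections split. *)
Record unitary_fusion (R : realType) (M : vonNeumannAlgebra R)
    (D : set {lrmorphism M -> M}) : Prop := UnitaryFusion {
  fus_endo : forall rho, D rho -> finite_index_endomorphism rho;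
  fus_id : D idfun;
  fus_comp : forall rho sigma, D rho -> D sigma -> D (rho \o sigma);
  fus_subobject : forall rho p, D rho -> hom_space rho rho p ->
    projection p -> p != 0 ->
    exists sigma w,
      [/\ D sigma, hom_space sigma rho w, isometry_elt w & w * w^† = p];
  fus_sum : forall rho sigma, D rho -> D sigma ->
    exists tau v w, [/\ D tau, hom_space rho tau v /\ isometry_elt v,
      hom_space sigma tau w /\ isometry_elt w & v * v^† + w * w^† = 1];
  fus_conj : forall rho, D rho ->
    exists rhob r rb, [/\ D rhob, hom_space idfun (rhob \o rho) r,
      hom_space idfun (rho \o rhob) rb,
      rb^† * rho r = 1 & r^† * rhob rb = 1];
  fus_semisimple : forall rho, D rho ->
    exists (n : nat) (f : 'I_n -> {lrmorphism M -> M}) (w : 'I_n -> M),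
      (forall i, [/\ D (f i), simple_obj (f i), hom_space (f i) rho (w i)
                   & isometry_elt (w i)]) /\
      \sum_i w i * (w i)^† = 1;
  fus_finite : exists (n : nat) (f : 'I_n -> {lrmorphism M -> M}),
    forall rho, D rho -> simple_obj rho -> exists i, equivalent rho (f i) }.

Definition irr_representatives (R : realType) (M : vonNeumannAlgebra R)
    (D : set {lrmorphism M -> M}) (I : Type) (irr : I -> {lrmorphism M -> M}) :
    Prop :=
  [/\ forall i, D (irr i) /\ simple_obj (irr i),
      forall i j, equivalent (irr i) (irr j) -> i = j &
      forall rho, D rho -> simple_obj rho -> exists i, equivalent rho (irr i)].

(* The index type of those representatives that lie in [C]. *)
Definition sub_irr (R : realType) (M : vonNeumannAlgebra R)
    (C : set {lrmorphism M -> M}) (I : finType) (irr : I -> {lrmorphism M -> M}) :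
    finType :=
  {i : I | `[< C (irr i) >]}.

(* Orthonormal basis for the inner product  t^† * s = <s, t> 1 . *)
Definition orthonormal_basis (R : realType) (M : vonNeumannAlgebra R) (V : set M)
    (n : nat) (T : 'I_n -> M) : Prop :=
  [/\ forall i, V (T i),
      forall i j, (T i)^† * T j = (i == j)%:R &
      forall t, V t -> exists c : 'I_n -> R[i], t = \sum_i c i *: T i].

Definition normalized_conjugate (R : realType) (M : vonNeumannAlgebra R)
    (mu mub : M -> M) (r rb : M) : Prop :=
  [/\ hom_space idfun (mub \o mu) r, hom_space idfun (mu \o mub) rb,
      isometry_elt r /\ isometry_elt rb,
      rb^† * mu r = ((dimension mu)^-1)%:C%:A &
      r^† * mub rb = ((dimension mu)^-1)%:C%:A].

(** * The relative Drinfeld commutant *)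

Record hb_obj (R : realType) (M : vonNeumannAlgebra R) (J : Type) := HbObj {
  hb_endo : {lrmorphism M -> M};
  hb_br : J -> M }.

Definition half_braiding (R : realType) (M : vonNeumannAlgebra R) (J : Type)
    (irrC : J -> {lrmorphism M -> M}) (sigma : {lrmorphism M -> M}) (e : J -> M) :
    Prop :=
  (forall b, unitary_elt (e b) /\
             hom_space (sigma \o irrC b) (irrC b \o sigma) (e b)) /\
  forall b1 b2 b3 x, hom_space (irrC b3) (irrC b1 \o irrC b2) x ->
    x * e b3 = irrC b1 (e b2) * e b1 * sigma x.

Definition drinfeld_commutant (R : realType) (M : vonNeumannAlgebra R) (J : Type)
    (D : set {lrmorphism M -> M}) (irrC : J -> {lrmorphism M -> M}) :
    set (hb_obj M J) :=
  [set Z | D (hb_endo Z) /\ half_braiding irrC (hb_endo Z) (hb_br Z)].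

Definition hb_hom (R : realType) (M : vonNeumannAlgebra R) (J : Type)
    (irrC : J -> {lrmorphism M -> M}) (Z Z' : hb_obj M J) : set M :=
  [set x | hom_space (hb_endo Z) (hb_endo Z') x /\
           forall b, hb_br Z' b * x = irrC b x * hb_br Z b].

Definition hb_simple (R : realType) (M : vonNeumannAlgebra R) (J : Type)
    (irrC : J -> {lrmorphism M -> M}) (Z : hb_obj M J) : Prop :=
  forall x, hb_hom irrC Z Z x -> exists c : R[i], x = c%:A.

Definition hb_equivalent (R : realType) (M : vonNeumannAlgebra R) (J : Type)
    (irrC : J -> {lrmorphism M -> M}) (Z Z' : hb_obj M J) : Prop :=
  exists2 u, hb_hom irrC Z Z' u & unitary_elt u.

Definition hb_representatives (R : realType) (M : vonNeumannAlgebra R) (J : Type)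
    (D : set {lrmorphism M -> M}) (irrC : J -> {lrmorphism M -> M}) (K : Type)
    (Z : K -> hb_obj M J) : Prop :=
  [/\ forall k, drinfeld_commutant D irrC (Z k) /\ hb_simple irrC (Z k),
      forall k k', hb_equivalent irrC (Z k) (Z k') -> k = k' &
      forall Y, drinfeld_commutant D irrC Y -> hb_simple irrC Y ->
        exists k, hb_equivalent irrC Y (Z k)].

(** * The relative tube algebra *)

Definition global_dim (R : realType) (M : vonNeumannAlgebra R) (J : finType)
    (irrC : J -> {lrmorphism M -> M}) : R :=
  \sum_b dimension (irrC b) ^+ 2.

(* The tube algebra is the subspace [tube] of the space of all families
   indexed by triples (lambda, mu, nu); the operations below are defined on all
   families but are only meaningful on [tube]. *)
Definition tube_family (R : realType) (M : vonNeumannAlgebra R) (I J : finType) :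
    lmodType R[i] :=
  {ffun I * J * I -> M}.

Definition tube (R : realType) (M : vonNeumannAlgebra R) (I J : finType)
    (irr : I -> {lrmorphism M -> M}) (irrC : J -> {lrmorphism M -> M}) :
    set (tube_family M I J) :=
  [set X : {ffun I * J * I -> M} | forall l m n,
     hom_space (irr l \o irrC m) (irrC m \o irr n) (X (l, m, n))].

(* The element (l m | x | m n) of the tube algebra. *)
Definition tube_elt (R : realType) (M : vonNeumannAlgebra R) (I J : finType)
    (l : I) (m : J) (n : I) (x : M) : tube_family M I J :=
  [ffun t : I * J * I => if t == (l, m, n) then x else 0] : {ffun I * J * I -> M}.

(* [tube_mul] and [tube_star] are the bilinear and conjugate-linear extensions
   of the operations on elements (l m | x | m n). *)
Definition tube_mul (R : realType) (M : vonNeumannAlgebra R) (I J : finType)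
    (irr : I -> {lrmorphism M -> M}) (irrC : J -> {lrmorphism M -> M})
    (N : J -> J -> J -> nat) (T : forall k m m', 'I_(N k m m') -> M)
    (X Y : tube_family M I J) : tube_family M I J :=
  let X' : {ffun I * J * I -> M} := X in
  let Y' : {ffun I * J * I -> M} := Y in
  \sum_l \sum_m \sum_n \sum_m' \sum_n' \sum_k
    tube_elt l k n'
      (\sum_i (T k m m' i)^† * irrC m (Y' (n, m', n')) * X' (l, m, n)
                * irr l (T k m m' i)).

Definition tube_star (R : realType) (M : vonNeumannAlgebra R) (I J : finType)
    (irr : I -> {lrmorphism M -> M}) (irrC : J -> {lrmorphism M -> M})
    (bar : J -> J) (r rb : J -> M) (X : tube_family M I J) : tube_family M I J :=
  let X' : {ffun I * J * I -> M} := X in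
  \sum_l \sum_m \sum_n
    tube_elt n (bar m) l
      ((dimension (irrC m))%:C *:
         (irrC (bar m) (irr l (rb m)^† * (X' (l, m, n))^†) * r m)).

(* The element e(Z)_{(l,i),(m,j)}, where a = (l,i) and b = (m,j). *)
Definition tube_e (R : realType) (M : vonNeumannAlgebra R) (I J : finType)
    (irr : I -> {lrmorphism M -> M}) (irrC : J -> {lrmorphism M -> M})
    (Z : hb_obj M J) (n : I -> nat) (W : forall l, 'I_(n l) -> M)
    (a b : {l : I & 'I_(n l)}) : tube_family M I J :=
  (dimension (hb_endo Z) /
     (global_dim irrC * Num.sqrt (dimension (irr (tag a)))
                      * Num.sqrt (dimension (irr (tag b)))))%:C *:
  \sum_c (dimension (irrC c))%:C *:
    tube_elt (tag a) c (tag b)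
      (irrC c (W _ (tagged b))^† * hb_br Z c * W _ (tagged a)).

Definition tube_z (R : realType) (M : vonNeumannAlgebra R) (I J : finType)
    (irr : I -> {lrmorphism M -> M}) (irrC : J -> {lrmorphism M -> M})
    (Z : hb_obj M J) (n : I -> nat) (W : forall l, 'I_(n l) -> M) :
    tube_family M I J :=
  \sum_a tube_e irr irrC Z W a a.

(** * Star-algebras carried by a subspace [A] of a vector space [V] *)

Definition is_subspace (K : pzRingType) (V : lmodType K) (B : set V) : Prop :=
  B 0 /\ forall (a : K) x y, B x -> B y -> B (a *: x + y).

Definition two_sided_ideal (K : pzRingType) (V : lmodType K)
    (mul : V -> V -> V) (A B : set V) : Prop :=
  [/\ B `<=` A, is_subspace B &
      forall a b, A a -> B b -> B (mul a b) /\ B (mul b a)].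

Definition simple_algebra (K : pzRingType) (V : lmodType K)
    (mul : V -> V -> V) (B : set V) : Prop :=
  (exists a b, [/\ B a, B b & mul a b <> 0]) /\
  forall L, two_sided_ideal mul B L -> L = [set 0] \/ L = B.

(* A two-sided ideal that is a direct summand and simple as an algebra. *)
Definition simple_component (K : pzRingType) (V : lmodType K)
    (mul : V -> V -> V) (A B : set V) : Prop :=
  [/\ two_sided_ideal mul A B, simple_algebra mul B &
      exists B', [/\ two_sided_ideal mul A B', B `&` B' = [set 0] &
        forall x, A x -> exists b b', [/\ B b, B' b' & x = b + b']]].

Definition matrix_units (K : pzRingType) (V : lmodType K)
    (mul : V -> V -> V) (star : V -> V) (B : set V) (P : finType)
    (e : P -> P -> V) : Prop :=
  [/\ forall a b, B (e a b) /\ e a b <> 0,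
      forall a b c d, mul (e a b) (e c d) = if b == c then e a d else 0,
      forall a b, star (e a b) = e b a &
      forall x, B x -> exists c : P -> P -> K, x = \sum_a \sum_b c a b *: e a b].

Definition central_projection (K : pzRingType) (V : lmodType K)
    (mul : V -> V -> V) (star : V -> V) (A : set V) (z : V) : Prop :=
  [/\ A z, star z = z, mul z z = z & forall x, A x -> mul z x = mul x z].

Definition minimal_central_projection (K : pzRingType) (V : lmodType K)
    (mul : V -> V -> V) (star : V -> V) (A : set V) (z : V) : Prop :=
  [/\ central_projection mul star A z, z <> 0 &
      forall p, central_projection mul star A p -> mul p z = p -> p = 0 \/ p = z].

Definition algebra_one (K : pzRingType) (V : lmodType K)
    (mul : V -> V -> V) (A : set V) (u : V) : Prop :=
  A u /\ forall x, A x -> mul u x = x /\ mul x u = x.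

(* Main.v *)
(** Multiplying e(Z)_{a,b} by e(Z')_{a',b'} and using the naturality of the
    half-braidings turns the sum over intertwiners into the averaging map
    Q |-> sum_b d(b) sigma'(Rb_b^* ) E'(b)^* b(Q) E(b) sigma(Rb_b), applied to
    Q = W'(a') W(b)^*.  It takes values in the morphisms of half-braidings, so by
    Schur's lemma it is 0 for inequivalent Z, Z' and a scalar for Z = Z'; taking
    traces identifies the scalar, and the matrix unit relations follow.

    The elements e span the tube algebra: for nu in Irr(D) the direct sum of the
    b nu bar(b) carries a half-braiding, whose compressions contain, up to a
    scalar, any given (lambda g|X|g nu).  The relative commutant being semisimple,
    this object decomposes into simple ones, and each summand contributes a linear
    combination of the e.

    The dimension is defined here through the minimal index, so its values have
    to be computed: for rho = sum_p f_p, the Pimsner-Popa constant of any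
    expectation onto rho(M) is at least (sum_p d(f_p))^2, and the standard left
    inverse attains this bound. *)
Require Import Defs.
From HB Require Import structures.
From mathcomp Require Import all_boot all_order all_algebra.
From mathcomp Require Import complex.
From mathcomp Require Import all_classical all_reals all_analysis.
From mathcomp Require Import ring lra.

Set Implicit Arguments.
Unset Strict Implicit.
Unset Printing Implicit Defensive.

Import numFieldNormedType.Exports.
Import Order.TTheory GRing.Theory Num.Theory.

Local Open Scope classical_set_scope.
Local Open Scope ring_scope.
Local Open Scope complex_scope.

(** * Scalars, adjoints and intertwiners *)

(** The minimal index is an infimum over expectations and gives no direct hold on intertwiners.
    Dimensions are therefore first carried as data: a simple object comes with a solution of the
    conjugate equations whose two norms agree, and [d] is their common value. Frobenius reciprocity
    with the exact constants [d f / d lam] then follows from an inequality applied to an intertwiner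
    and to its rotation. Bending an orthonormal basis of Hom(k, g b) gives orthogonal vectors of
    square norm [d k / d b], so the weights [d b] turn sums over intertwiners into resolutions of
    the identity. This makes the average natural and explains the weights [d(beta)] in [e]. The
    Schur scalar of the average, [dim C * d(lambda) / d(sigma)], dictates the prefactor of [e]. Two
    devices replace matrices over M and spectral theory: isometries with orthogonal ranges store a
    column in one element, and projections in the commutant are polynomials in an endomorphism,
    which has a minimal polynomial since Hom spaces are finite-dimensional. Associativity of the
    tube algebra is read off from the matrix unit relations. *)

(* A constant rather than the notation [a%:A], so that rewriting can move
   scalars through products and endomorphisms. *)
Definition scl (R : realType) (M : vonNeumannAlgebra R) (a : R[i]) : M := a%:A.
Arguments scl {R M} a.

Section Scalars.
Variables (R : realType) (M : vonNeumannAlgebra R).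
Implicit Types (x y : M) (a b : R[i]).

Lemma sclZ a x : a *: x = scl a * x.
Proof. by rewrite /scl mulr_algl. Qed.

Lemma sclE a : a%:A = scl a :> M. Proof. by []. Qed.

Fact scl_zmod_morphism : zmod_morphism (@scl R M).
Proof. by move=> a b; rewrite /scl scalerBl. Qed.

Fact scl_monoid_morphism : monoid_morphism (@scl R M).
Proof.
by split=> [|a b]; rewrite /scl ?scale1r // -scalerAl mul1r scalerA.
Qed.

End Scalars.

HB.instance Definition _ (R : realType) (M : vonNeumannAlgebra R) :=
  GRing.isZmodMorphism.Build _ _ (@scl R M) (@scl_zmod_morphism R M).
HB.instance Definition _ (R : realType) (M : vonNeumannAlgebra R) :=
  GRing.isMonoidMorphism.Build _ _ (@scl R M) (@scl_monoid_morphism R M).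

Section StarAlgebra.
Variables (R : realType) (M : vonNeumannAlgebra R).
Implicit Types (x y z : M) (a b : R[i]).

Local Notation dot := (hilb_dot (vna_space M)).

Lemma vna_repD x y u : vna_rep (x + y) u = vna_rep x u + vna_rep y u.
Proof. by have := vna_rep_linear 1 x y u; rewrite !scale1r. Qed.

Lemma vna_rep0 u : vna_rep (0 : M) u = 0.
Proof. by apply: (addrI (vna_rep (0 : M) u)); rewrite -vna_repD !addr0. Qed.

Lemma vna_repZ a x u : vna_rep (a *: x) u = a *: vna_rep x u.
Proof. by have := vna_rep_linear a x 0 u; rewrite vna_rep0 !addr0. Qed.

Lemma vna_rep_sum I (s : seq I) (F : I -> M) u :
  vna_rep (\sum_(i <- s) F i) u = \sum_(i <- s) vna_rep (F i) u.
Proof.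
by elim/big_rec2: _ => [|i y x _ <-]; rewrite ?vna_rep0 ?vna_repD.
Qed.

Lemma vna_repB x y u : vna_rep (x - y) u = vna_rep x u - vna_rep y u.
Proof. by rewrite -scaleN1r vna_repD vna_repZ scaleN1r. Qed.

Lemma dot_eq_left (v w : vna_space M) : (forall u, dot v u = dot w u) -> v = w.
Proof.
move=> h; apply/eqP; rewrite -subr_eq0 -(dnorm_eq0 dot).
by rewrite linearBl /= h subrr.
Qed.

Lemma dotC (v w : vna_space M) : dot v w = Num.conj (dot w v).
Proof. by rewrite hermC expr0 mul1r. Qed.

Lemma dot_eq_right (v w : vna_space M) : (forall u, dot u v = dot u w) -> v = w.
Proof.
by move=> h; apply: dot_eq_left => u; rewrite dotC h -dotC.
Qed.

Lemma vna_ext x y : (forall u, vna_rep x u = vna_rep y u) -> x = y.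
Proof. by move=> h; apply: vna_rep_inj; apply/funext. Qed.

Lemma star_ext x y :
  (forall u v : vna_space M, dot u (vna_rep x v) = dot u (vna_rep y v)) -> x = y.
Proof. by move=> h; apply: vna_ext => v; apply: dot_eq_right => u. Qed.

Lemma dot_adj x (u v : vna_space M) :
  dot (vna_rep x u) v = dot u (vna_rep x^† v).
Proof. exact: vna_rep_adj. Qed.

Lemma starM x y : (x * y)^† = y^† * x^†.
Proof.
by apply: star_ext => u v; rewrite -dot_adj !vna_repM !dot_adj.
Qed.

Lemma starD x y : (x + y)^† = x^† + y^†.
Proof.
apply: star_ext => u v.
by rewrite -dot_adj !vna_repD linearDl linearDr /= !dot_adj.
Qed.

Lemma starZ a x : (a *: x)^† = Num.conj a *: x^†.
Proof.
apply: star_ext => u v.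
by rewrite -dot_adj !vna_repZ linearZl_LR linearZr_LR /= dot_adj conjCK.
Qed.

Lemma starK x : x^†^† = x.
Proof.
apply: star_ext => u v.
by rewrite -dot_adj dotC -dot_adj -dotC.
Qed.

Lemma star1 : (1 : M)^† = 1.
Proof. by apply: star_ext => u v; rewrite -dot_adj !vna_rep1. Qed.

Lemma star0 : (0 : M)^† = 0.
Proof. by apply: (addrI (0 : M)^†); rewrite -starD !addr0. Qed.

Lemma starN x : (- x)^† = - x^†.
Proof. by apply: (addrI x^†); rewrite -starD !subrr star0. Qed.

Lemma starB x y : (x - y)^† = x^† - y^†.
Proof. by rewrite starD starN. Qed.

Lemma star_sum I (s : seq I) P (F : I -> M) :
  (\sum_(i <- s | P i) F i)^† = \sum_(i <- s | P i) (F i)^†.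
Proof. exact: (big_morph _ starD star0). Qed.

Lemma star_inj : injective (@vna_star R M).
Proof. exact: can_inj starK. Qed.

Lemma conjC_real (c : R) : Num.conj (c%:C : R[i]) = c%:C.
Proof. exact: conjc_real. Qed.

Lemma star_scl a : (scl a : M)^† = scl (Num.conj a).
Proof. by rewrite /scl starZ star1. Qed.

Lemma star_sclr (c : R) : (scl c%:C : M)^† = scl c%:C.
Proof. by rewrite star_scl conjC_real. Qed.

Lemma scl_inj : injective (@scl R M).
Proof. exact: fmorph_inj. Qed.

Lemma sclC a x : scl a * x = x * scl a.
Proof. by rewrite /scl mulr_algl mulr_algr. Qed.

Lemma sclCA a x y : x * (scl a * y) = scl a * (x * y).
Proof. by rewrite mulrA -sclC mulrA. Qed.

Lemma sclAC a x y : x * scl a * y = scl a * x * y.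
Proof. by rewrite -sclC. Qed.

Lemma sclMM a b x y : scl a * x * (scl b * y) = scl (a * b) * (x * y).
Proof. by rewrite -mulrA sclCA mulrA rmorphM. Qed.

Lemma sclK a x : a != 0 -> scl a^-1 * (scl a * x) = x.
Proof. by move=> a0; rewrite mulrA -rmorphM mulVf // rmorph1 mul1r. Qed.

Lemma scl_eq0 a x : scl a * x = 0 -> a != 0 -> x = 0.
Proof. by move=> e a0; rewrite -[x](sclK _ a0) e mulr0. Qed.

Lemma scl_cancel a x y : scl a * x = scl a * y -> a != 0 -> x = y.
Proof.
move=> e a0; apply/eqP; rewrite -subr_eq0; apply/eqP; apply: (scl_eq0 _ a0).
by rewrite mulrBr e subrr.
Qed.

Lemma dot_star_ge0 x u : 0 <= dot (vna_rep (x^† * x) u) u.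
Proof.
by rewrite vna_repM dot_adj starK; exact: (dnorm_ge0 dot).
Qed.

Lemma sum_star_eq0 (I : finType) (F : I -> M) :
  \sum_i (F i)^† * F i = 0 -> forall i, F i = 0.
Proof.
move=> h i; apply: vna_ext => u; rewrite vna_rep0; apply/eqP.
have h1 : \sum_j dot (vna_rep (F j) u) (vna_rep (F j) u) = 0.
  transitivity (dot (vna_rep (\sum_j (F j)^† * F j) u) u).
    rewrite vna_rep_sum; elim/big_rec2: _ => [|j w c _ ->].
      by rewrite linear0l.
    by rewrite linearDl /= vna_repM [in RHS]dot_adj starK.
  by rewrite h vna_rep0 linear0l.
rewrite -(dnorm_eq0 dot); apply/eqP.
by apply: (psumr_eq0P _ h1) => // j _; exact: (dnorm_ge0 dot).
Qed.

Lemma star_eq0 x : x^† * x = 0 -> x = 0.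
Proof.
move=> h; apply: (@sum_star_eq0 'I_1 (fun=> x) _ ord0).
by rewrite big_ord1.
Qed.

Lemma star_scl_ge0 x a : x^† * x = scl a -> 0 <= a.
Proof.
(* A nonzero vector exists because [1 != 0] and the representation is faithful. *)
move=> h; have [u hu] : exists u : vna_space M, u != 0.
  apply: contrapT => /forallNP h0; have := oner_neq0 M; case/eqP.
  apply: vna_ext => u; rewrite vna_rep1 vna_rep0.
  by apply/eqP/negP => hu; apply: (h0 u); apply/negP.
have := dot_star_ge0 x u.
rewrite h vna_repZ vna_rep1 linearZl_LR /= pmulr_lge0 //.
by rewrite dnorm_gt0.
Qed.

Lemma star_scl_real x a : x^† * x = scl a -> exists2 c : R, 0 <= c & a = c%:C.
Proof.
move=> /star_scl_ge0 a0; exists (complex.Re a).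
  by move: a0; rewrite lecE => /andP[].
by rewrite RRe_real // ger0_real.
Qed.

Lemma endo_scl (rho : {lrmorphism M -> M}) a : rho (scl a) = scl a.
Proof. by rewrite /scl linearZ_LR rmorph1. Qed.

End StarAlgebra.

Section ProductContext.
Variables (A : pzRingType) (h : {rmorphism A -> A}) (a b c d : A).

(** Products are kept flattened to the left. These variants rewrite two adjacent factors behind a
    prefix [y] ([ctx]), under an endomorphism [h] ([whisk], or suffix [1]), or when the pair
    collapses to one factor (suffix [c]). *)
Lemma whisk : a * b = c * d -> h a * h b = h c * h d.
Proof. by move=> e; rewrite -!rmorphM e. Qed.

Lemma whiskc : a * b = c -> h a * h b = h c.
Proof. by move=> e; rewrite -!rmorphM e. Qed.

Lemma ctx : a * b = c * d -> forall y, y * a * b = y * c * d.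
Proof. by move=> e y; rewrite -!mulrA e. Qed.

Lemma ctx1 : a * b = c * d -> forall y, y * h a * h b = y * h c * h d.
Proof. by move=> e y; rewrite -!mulrA -!rmorphM e. Qed.

Lemma ctxc : a * b = c -> forall y, y * a * b = y * c.
Proof. by move=> e y; rewrite -mulrA e. Qed.

Lemma ctxc1 : a * b = c -> forall y, y * h a * h b = y * h c.
Proof. by move=> e y; rewrite -mulrA -rmorphM e. Qed.

End ProductContext.

Definition star_endo (R : realType) (M : vonNeumannAlgebra R) (rho : M -> M) :=
  forall x, rho x^† = (rho x)^†.

Lemma star_endo_comp (R : realType) (M : vonNeumannAlgebra R) (f g : M -> M) :
  star_endo f -> star_endo g -> star_endo (f \o g).
Proof. by move=> hf hg x /=; rewrite hg hf. Qed.

Section Intertwiners.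
Variables (R : realType) (M : vonNeumannAlgebra R).
Implicit Types (t u x y : M) (a b : R[i]) (f g : {lrmorphism M -> M}).

Lemma hom_star (f g : M -> M) t : star_endo f -> star_endo g ->
  hom_space f g t -> hom_space g f t^†.
Proof.
move=> hf hg ht x; apply: star_inj.
by rewrite !starM starK -hf -hg ht.
Qed.

Lemma homM (f g h : M -> M) t u :
  hom_space g h t -> hom_space f g u -> hom_space f h (t * u).
Proof. by move=> ht hu x; rewrite -mulrA hu mulrA ht mulrA. Qed.

Lemma homZ f g a t : hom_space f g t -> hom_space f g (scl a * t).
Proof. by move=> ht x; rewrite -mulrA ht sclCA. Qed.

Lemma homD f g t u :
  hom_space f g t -> hom_space f g u -> hom_space f g (t + u).
Proof. by move=> ht hu x; rewrite mulrDl ht hu mulrDr. Qed.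

Lemma hom0 (f g : M -> M) : hom_space f g 0.
Proof. by move=> x; rewrite mul0r mulr0. Qed.

Lemma hom1 (f : M -> M) : hom_space f f 1.
Proof. by move=> x; rewrite mul1r mulr1. Qed.

(** Computing [t t^† t] in two ways forces [a = b]; this scalar is positive, and dividing [t] by its
    square root gives the unitary. *)
Lemma scaled_unitary t a b : t^† * t = scl a -> t * t^† = scl b -> t <> 0 ->
  exists u c, u = scl c * t /\ unitary_elt u.
Proof.
move=> ha hb t0.
have [c c0 eac] := star_scl_real ha; subst a.
have c_neq0 : c != 0.
  by apply/eqP => c00; apply: t0; apply: star_eq0; rewrite ha c00 rmorph0.
have eb : b = c%:C.
  apply/eqP; rewrite -subr_eq0; apply: contra_notT t0 => bc.
  apply: scl_eq0 bc; rewrite rmorphB mulrBl /= -hb -mulrA ha -sclC.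
  exact: subrr.
have c1 : ((Num.sqrt c)^-1 * (Num.sqrt c)^-1) * c = 1.
  by rewrite -invfM -expr2 sqr_sqrtr // mulVf.
exists (scl (Num.sqrt c)^-1%:C * t), (Num.sqrt c)^-1%:C; split=> //.
rewrite /unitary_elt starM star_sclr -sclC !sclMM ha hb eb.
by rewrite -!rmorphM /= c1 !rmorph1.
Qed.

Lemma schur f g t : star_endo f -> star_endo g -> simple_obj f ->
  simple_obj g -> hom_space f g t -> t <> 0 -> equivalent f g.
Proof.
move=> hf hg sf sg ht t0.
have ht' := hom_star hf hg ht.
have [a ha] := sf _ (homM ht' ht).
have [b hb] := sg _ (homM ht ht').
rewrite sclE in ha; rewrite sclE in hb.
have [u [c [eu uu]]] := scaled_unitary ha hb t0.
by exists u => //; rewrite eu; exact: homZ.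
Qed.

(** The defect [G] is sesquilinear and vanishes on the diagonal: [v + w] gives [G v w = - G w v],
    and [v + i w] gives [G v w = G w v]. Identities below thus need checking on [w w^†] only. *)
Lemma polarization f g (P : M -> M) (c : R[i]) :
  (forall x y, P (x + y) = P x + P y) ->
  (forall a x, P (scl a * x) = scl a * P x) ->
  (forall w, hom_space f g w -> P (w * w^†) = scl c * (w^† * w)) ->
  forall v w, hom_space f g v -> hom_space f g w ->
  P (v * w^†) = scl c * (w^† * v).
Proof.
move=> PD PZ h v w hv hw.
pose G x y := P (x * y^†) - scl c * (y^† * x).
have Gl x x' y : G (x + x') y = G x y + G x' y.
  by rewrite /G mulrDl PD !mulrDr opprD addrACA.
have Gr x y y' : G x (y + y') = G x y + G x y'.
  by rewrite /G starD mulrDl !mulrDr PD opprD addrACA.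
have GZl a x y : G (scl a * x) y = scl a * G x y.
  by rewrite /G -mulrA PZ !(sclCA a) mulrBr.
have GZr a x y : G x (scl a * y) = scl (Num.conj a) * G x y.
  by rewrite /G starM star_scl -sclC -mulrA !(sclCA (Num.conj a)) PZ mulrBr.
have G0 w' : hom_space f g w' -> G w' w' = 0.
  by move=> hw'; rewrite /G h // subrr.
have e1 : G v w = - G w v.
  have := G0 _ (homD hv hw); rewrite Gl !Gr !G0 // add0r addr0.
  by move/eqP; rewrite addr_eq0 => /eqP.
have e2 : scl (- 'i) * G v w + scl 'i * G w v = 0.
  have := G0 _ (homD hv (homZ 'i hw)).
  rewrite Gl !Gr !(GZl, GZr) !G0 // !mulr0 add0r addr0.
  by have -> : Num.conj 'i = - 'i :> R[i] by apply/eqP; rewrite eq_complex /= oppr0 !eqxx.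
have e3 : G w v = 0.
  apply: (@scl_eq0 _ _ ('i + 'i)).
    by move: e2; rewrite e1 mulrN rmorphN mulNr opprK rmorphD mulrDl.
  by rewrite eq_complex /= addr0 -mulr2n mulrn_eq0 oner_eq0 andbF.
by move: e1; rewrite e3 oppr0 => /eqP; rewrite subr_eq0 => /eqP.
Qed.

End Intertwiners.

(** * Conjugates and Frobenius reciprocity *)

Section Conjugates.
Variables (R : realType) (M : vonNeumannAlgebra R).
Implicit Types (rho : {lrmorphism M -> M}) (d : R).

(** The isometries of the statement are these vectors divided by [sqrt d]. For simple [rho],
    equality of the two norms is what forces [d] to be the dimension. *)
Record conj_sol (rho rhob : {lrmorphism M -> M}) (r rb : M) (d : R) : Prop :=
  ConjSol {
    conj_hom : forall x, r * x = rhob (rho x) * r;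
    conj_homb : forall x, rb * x = rho (rhob x) * rb;
    conj_zig : rb^† * rho r = 1;
    conj_zag : r^† * rhob rb = 1;
    conj_norm : r^† * r = scl d%:C;
    conj_normb : rb^† * rb = scl d%:C }.

Lemma conj_sol_sym rho rhob r rb d :
  conj_sol rho rhob r rb d -> conj_sol rhob rho rb r d.
Proof. by case=> *; split. Qed.

Lemma conj_sol_gt0 rho rhob r rb d : conj_sol rho rhob r rb d -> 0 < d.
Proof.
case=> _ _ zig _ nr _; rewrite lt_def -ler0c (star_scl_ge0 nr) andbT.
apply/eqP => d0; have r0 : r = 0 by apply: star_eq0; rewrite nr d0 rmorph0.
by have /eqP := oner_neq0 M; rewrite -zig r0 rmorph0 mulr0.
Qed.

Section OneSolution.
Variables (rho rhob : {lrmorphism M -> M}) (r rb : M) (d : R).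
Hypotheses (cs : conj_sol rho rhob r rb d).
Hypotheses (h1 : star_endo rho) (h2 : star_endo rhob).

Lemma conj_zigS : rho r^† * rb = 1.
Proof. by apply: star_inj; rewrite starM h1 starK star1 (conj_zig cs). Qed.

Lemma conj_zagS : rhob rb^† * r = 1.
Proof. by apply: star_inj; rewrite starM h2 starK star1 (conj_zag cs). Qed.

Lemma conj_homS x : r^† * rhob (rho x) = x * r^†.
Proof.
by apply: star_inj; rewrite !starM starK -h2 -h1 -(conj_hom cs).
Qed.

Lemma conj_hombS x : rb^† * rho (rhob x) = x * rb^†.
Proof.
by apply: star_inj; rewrite !starM starK -h1 -h2 -(conj_homb cs).
Qed.

(** Bending an endomorphism [x] of [rhob] gives one of [rho], hence a scalar [c]; bending back
    yields [x r = c r], and the conjugate equation recovers [x] from [x r]. *)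
Lemma conj_simple : simple_obj rho -> simple_obj rhob.
Proof.
move=> srho x hx.
have [c hc] : exists c : R[i], rb^† * rho x * rho r = scl c.
  apply: srho => y; rewrite (ctx1 rho (conj_hom cs y)) (ctx1 rho (hx _)).
  by rewrite conj_hombS !mulrA.
exists c; have xr : x * r = scl c * r.
  rewrite -(endo_scl rhob) -hc !rmorphM.
  by rewrite -(ctx (conj_hom cs r)) -(ctx (conj_hom cs x)) conj_zagS mul1r.
by rewrite -[x]mulr1 -conj_zagS mulrA hx -mulrA xr sclCA conj_zagS mulr1.
Qed.

End OneSolution.

Section FrobeniusBound.
Variables (lam lamb : {lrmorphism M -> M}) (rl Rl : M) (dl : R).
Variables (bet betb : {lrmorphism M -> M}) (rb Rb : M) (db : R).
Variables (f fb : {lrmorphism M -> M}) (rf Rf : M) (df : R).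
Hypotheses (csl : conj_sol lam lamb rl Rl dl)
           (csb : conj_sol bet betb rb Rb db)
           (csf : conj_sol f fb rf Rf df).
Hypotheses (hl : star_endo lam) (hlb : star_endo lamb) (hb : star_endo bet)
           (hbb : star_endo betb) (hf : star_endo f) (hfb : star_endo fb).
Hypotheses (sl : simple_obj lam) (sb : simple_obj bet) (sf : simple_obj f).
Variable w : M.
Hypothesis hw : forall x, w * f x = lam (bet x) * w.

Let hwS x : w^† * lam (bet x) = f x * w^†.
Proof. by apply: star_inj; rewrite !starM starK -hl -hb -hf hw. Qed.

(* Close [ww^†] by [lam] on the left and by [bet] on the right: both orders give
   the same scalar. *)
Lemma frobenius_exchange : exists s s' : R[i],
  [/\ lam Rb^† * w * w^† * lam Rb = scl s,
      rl^† * lamb w * lamb w^† * rl = scl s' & s * dl%:C = s' * db%:C].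
Proof.
have [s hs] : exists s : R[i], lam Rb^† * w * w^† * lam Rb = scl s.
  apply: sl => x; rewrite (ctx1 lam (conj_homb csb x)) (ctx (hwS _)).
  by rewrite (ctx (hw _)) -rmorphM (conj_hombS csb) // rmorphM !mulrA.
have [s' hs'] : exists s' : R[i], rl^† * lamb w * lamb w^† * rl = scl s'.
  apply: sb => x; rewrite (ctx (conj_hom csl _)) (ctx1 lamb (hwS _)).
  by rewrite (ctx1 lamb (hw _)) (conj_homS csl) // !mulrA.
exists s, s'; split=> //; apply: (@scl_inj _ M).
transitivity (rl^† * lamb (lam Rb^† * w * w^† * lam Rb) * rl).
  by rewrite hs endo_scl sclAC -mulrA (conj_norm csl) -rmorphM.
rewrite !rmorphM !mulrA (conj_homS csl) // -(ctx (conj_hom csl Rb)).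
rewrite -!(mulrA Rb^†).
by rewrite hs' sclCA (conj_normb csb) -rmorphM.
Qed.

(* [k' : fb -> betb lamb] is the conjugate of [w], and [k] is built from the
   conjugate of [w^†]; they satisfy [k k' = 1] and have equal norms. *)
Lemma frobenius_bound (s : R) : w^† * w = 1 ->
  lam Rb^† * w * w^† * lam Rb = scl s%:C -> df <= s * dl.
Proof.
move=> ww hs.
have [s0 [s' [hs0 hs' ess']]] := frobenius_exchange.
move: hs0; rewrite hs => /scl_inj es0; subst s0.
have sfb := conj_simple csf hf hfb sf.
pose k := rb^† * betb rl^† * betb (lamb w) * betb (lamb Rf).
pose k' := rf^† * fb w^† * fb (lam Rb) * fb Rl.
have hk' y : k' * fb y = betb (lamb y) * k'.
  rewrite /k' (ctx1 fb (conj_homb csl y)).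
  rewrite (ctx1 fb (whisk lam (conj_homb csb _))) (ctx1 fb (hwS _)).
  by rewrite (conj_homS csf) // !mulrA.
have hk y : k * betb (lamb y) = fb y * k.
  rewrite /k (ctx1 betb (whisk lamb (conj_homb csf y))).
  rewrite (ctx1 betb (whisk lamb (hw _))) (ctx1 betb (conj_homS csl _ _ _)) //.
  by rewrite (conj_homS csb) // !mulrA.
have e1 : rb^† * betb rl^† * k' = rf^† * fb w^†.
  rewrite /k' !mulrA -(conj_homS csf) // !rmorphM !mulrA -!(ctx1 fb (hwS _)).
  rewrite -(ctx1 fb (whisk lam (conj_homb csb _))).
  rewrite (ctxc1 fb (whiskc lam (conj_zigS csb hb))) !rmorph1 mulr1.
  by rewrite (ctxc1 fb (conj_zigS csl hl)) rmorph1 mulr1.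
have kk' : k * k' = 1.
  rewrite /k -!(ctx (hk' _)) e1 (ctxc1 fb ww) rmorph1 mulr1.
  exact: (conj_zag csf).
have hbl : star_endo (betb \o lamb) by exact: star_endo_comp.
have hkS y : k^† * fb y = betb (lamb y) * k^† := hom_star hbl hfb hk y.
have hk'S y : k'^† * betb (lamb y) = fb y * k'^† := hom_star hfb hbl hk' y.
have [a ha] : exists a : R[i], k * k^† = scl a.
  by apply: sfb => y; rewrite -mulrA hkS mulrA hk mulrA.
have [a' ha'] : exists a : R[i], k'^† * k' = scl a.
  by apply: sfb => y; rewrite -mulrA hk' mulrA hk'S mulrA.
(* Closing [k k^†] with [rf] straightens the bends and leaves the left closure [s'] of [w w^†];
   closing [k'^† k'] with [Rf] leaves the right closure [s]. The exchange identity makes the two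
   norms equal. *)
have ea : a * df%:C = s%:C * dl%:C.
  apply: (@scl_inj _ M); rewrite ess'.
  have e2 : k^† * rf = betb (lamb w^†) * betb rl * rb.
    rewrite /k !starM -!hbb -!hlb !starK !mulrA (ctx (conj_hom csb _)).
    rewrite (ctx1 betb (conj_hom csl _)) (ctx1 betb (whisk lamb (hwS _))).
    by rewrite (whiskc betb (whiskc lamb (conj_zig csf))) !rmorph1 mul1r.
  transitivity ((k^† * rf)^† * (k^† * rf)).
    by rewrite starM starK -mulrA (mulrA k) ha sclCA (conj_norm csf) -rmorphM.
  rewrite e2 !starM -!hbb -!hlb starK !mulrA.
  have -> : rb^† * betb rl^† * betb (lamb w) * betb (lamb w^†) * betb rl * rb
    = rb^† * betb (rl^† * lamb w * lamb w^† * rl) * rb by rewrite !rmorphM !mulrA.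
  by rewrite hs' endo_scl -sclC -mulrA (conj_norm csb) -rmorphM.
have ea' : a' * df%:C = s%:C * dl%:C.
  apply: (@scl_inj _ M).
  have e2 : f k' * Rf = w^† * lam Rb * Rl.
    rewrite /k' !rmorphM -!(ctx (conj_homb csf _)).
    by rewrite (conj_zigS csf) // mul1r.
  transitivity ((f k' * Rf)^† * (f k' * Rf)).
    rewrite starM -hf -mulrA (mulrA (f _)) -rmorphM /= ha' endo_scl.
    by rewrite sclCA (conj_normb csf) -rmorphM.
  rewrite e2 !starM starK -hl !mulrA -3!(mulrA Rl^†).
  by rewrite hs -sclC -mulrA (conj_normb csl) -rmorphM.
clearbody k k'.
have df0 := conj_sol_gt0 csf; have dl0 := conj_sol_gt0 csl.
have df0' : df%:C != 0 :> R[i] by rewrite fmorph_eq0 gt_eqF.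
have eaa : a = (s * dl / df)%:C.
  by apply: (mulIf df0'); rewrite ea -!rmorphM /= divfK ?gt_eqF.
have ea'a : a' = (s * dl / df)%:C.
  by apply: (mulIf df0'); rewrite ea' -!rmorphM /= divfK ?gt_eqF.
set t := s * dl / df in eaa ea'a; subst a a'.
have t0 : 0 <= t.
  by rewrite -ler0c; apply: (@star_scl_ge0 _ M k^†); rewrite starK.
suff : 1 <= t by rewrite ler_pdivlMr // mul1r.
(* Cauchy-Schwarz for [k^†] and [k'], both of square norm [t] *)
have : 0 <= (t * t * t - t)%:C :> R[i].
  apply: (@star_scl_ge0 _ M (k^† - scl t%:C * k')).
  rewrite starB starM star_sclr -sclC starK mulrBl !mulrBr sclMM sclCA -(mulrA (scl _)).
  have -> : k'^† * k^† = 1 by rewrite -starM kk' star1.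
  by rewrite ha ha' kk' mulr1 subrr sub0r opprB !rmorphB !rmorphM.
rewrite ler0c => h; rewrite leNgt; apply/negP => t1.
have t00 : t != 0.
  apply/eqP => e0; have : k = 0.
    by rewrite -[k]starK (@star_eq0 _ _ k^†) ?star0 // starK ha e0 rmorph0.
  by move=> k0; have /eqP := oner_neq0 M; rewrite -kk' k0 mul0r.
have : 0 < t by rewrite lt_def t00.
by nra.
Qed.

End FrobeniusBound.
End Conjugates.

(** The dimension is a field here, so that Frobenius reciprocity can be proved before
    [dimension_rigid] links it to the minimal index. *)
Record rigid_simple (R : realType) (M : vonNeumannAlgebra R) := RigidSimple {
  rs_fun :> {lrmorphism M -> M};
  rs_bar : {lrmorphism M -> M};
  rs_r : M;
  rs_rb : M;
  rs_dim : R;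
  rs_star : star_endo rs_fun;
  rs_bar_star : star_endo rs_bar;
  rs_sol : conj_sol rs_fun rs_bar rs_r rs_rb rs_dim;
  rs_simple : simple_obj rs_fun }.

Section Frobenius.
Variables (R : realType) (M : vonNeumannAlgebra R).
Local Notation rigid := (rigid_simple M).
Local Notation Rb := (@rs_rb R M).
Local Notation R_ := (@rs_r R M).
Local Notation d := (@rs_dim R M).
Local Notation bar := (@rs_bar R M).
Implicit Types (f lam bet gam kap : rigid) (v w t x y : M) (a c : R[i]).

Definition rs_sym f : rigid :=
  RigidSimple (rs_bar_star f) (rs_star f) (conj_sol_sym (rs_sol f))
    (conj_simple (rs_sol f) (rs_star f) (rs_bar_star f) (@rs_simple _ _ f)).

Lemma rs_dim_gt0 f : 0 < d f. Proof. exact: conj_sol_gt0 (rs_sol f). Qed.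

Lemma rs_dimC_neq0 f : (d f)%:C != 0 :> R[i].
Proof. by rewrite fmorph_eq0 gt_eqF ?rs_dim_gt0. Qed.

Lemma rs_hom f x : R_ f * x = bar f (f x) * R_ f.
Proof. exact: (conj_hom (rs_sol f)). Qed.
Lemma rs_homb f x : Rb f * x = f (bar f x) * Rb f.
Proof. exact: (conj_homb (rs_sol f)). Qed.
Lemma rs_homS f x : (R_ f)^† * bar f (f x) = x * (R_ f)^†.
Proof. exact: (conj_homS (rs_sol f) (rs_star f) (rs_bar_star f)). Qed.
Lemma rs_hombS f x : (Rb f)^† * f (bar f x) = x * (Rb f)^†.
Proof. exact: (conj_hombS (rs_sol f) (rs_star f) (rs_bar_star f)). Qed.
Lemma rs_zig f : (Rb f)^† * f (R_ f) = 1.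
Proof. exact: (conj_zig (rs_sol f)). Qed.
Lemma rs_zag f : (R_ f)^† * bar f (Rb f) = 1.
Proof. exact: (conj_zag (rs_sol f)). Qed.
Lemma rs_zigS f : f (R_ f)^† * Rb f = 1.
Proof. exact: (conj_zigS (rs_sol f) (rs_star f)). Qed.
Lemma rs_zagS f : bar f (Rb f)^† * R_ f = 1.
Proof. exact: (conj_zagS (rs_sol f) (rs_bar_star f)). Qed.
Lemma rs_norm f : (R_ f)^† * R_ f = scl (d f)%:C.
Proof. exact: (conj_norm (rs_sol f)). Qed.
Lemma rs_normb f : (Rb f)^† * Rb f = scl (d f)%:C.
Proof. exact: (conj_normb (rs_sol f)). Qed.

Section Rotation.
Variables (f lam bet : rigid).

Lemma frobeniusS w : hom_space f (lam \o bet) w ->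
  forall x, w^† * lam (bet x) = f x * w^†.
Proof.
by apply: hom_star; [exact: rs_star|apply: star_endo_comp; exact: rs_star].
Qed.

End Rotation.

Lemma frobenius_ge f lam bet w (s : R) : hom_space f (lam \o bet) w ->
  w^† * w = 1 -> lam (Rb bet)^† * w * w^† * lam (Rb bet) = scl s%:C ->
  d f <= s * d lam.
Proof.
move=> hw ww e.
by apply: (frobenius_bound (rs_sol lam) (rs_sol bet) (rs_sol f) _ _ _ _ _ _ _ _ _
  hw ww e); do ?[exact: rs_star|exact: rs_bar_star|exact: rs_simple].
Qed.

(* Rotating [w] twice gives [w] back, so that the inequality above, applied to
   [w] and to its rotation, is an equality. *)
Lemma frobenius_unit f lam bet w : hom_space f (lam \o bet) w -> w^† * w = 1 ->
  lam (Rb bet)^† * w * w^† * lam (Rb bet) = scl (d f / d lam)%:C.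
Proof.
move=> hw ww; pose u := w^† * lam (Rb bet).
have hwS := frobeniusS hw.
have hu : hom_space lam (f \o bar bet) u.
  move=> x; rewrite /u (ctx1 lam (rs_homb bet x)) hwS !mulrA //.
have [s hs] : exists a : R[i], u^† * u = scl a.
  apply: (rs_simple (r := lam)) => x; rewrite -mulrA hu !mulrA.
  by rewrite (hom_star _ _ hu) //; [exact: rs_star|
     apply: star_endo_comp; [exact: rs_star|exact: rs_bar_star]].
have [s0 s0ge es] := star_scl_real hs; subst s.
have e1 : lam (Rb bet)^† * w * w^† * lam (Rb bet) = scl s0%:C.
  by rewrite -hs /u starM starK -rs_star !mulrA.
have b1 := frobenius_ge hw ww e1.
have s0gt : 0 < s0.
  rewrite -(pmulr_lgt0 _ (rs_dim_gt0 lam)).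
  exact: lt_le_trans (rs_dim_gt0 f) b1.
pose q := (Num.sqrt s0)^-1.
have qq : q%:C * q%:C = (s0^-1)%:C :> R[i].
  by rewrite -rmorphM /= /q -invfM -expr2 sqr_sqrtr.
have hu' : hom_space lam (f \o rs_sym bet) (scl q%:C * u).
  by move=> x; rewrite -mulrA hu -sclCA.
have uu' : (scl q%:C * u)^† * (scl q%:C * u) = 1.
  rewrite starM star_sclr -sclC sclMM hs qq -!rmorphM /= mulVf ?gt_eqF //.
  by rewrite !rmorph1.
have e2 : f (Rb (rs_sym bet))^† * (scl q%:C * u) * (scl q%:C * u)^† *
    f (Rb (rs_sym bet)) = scl (s0^-1)%:C.
  have e3 : u^† * f (R_ bet) = w.
    rewrite /u starM starK -rs_star -mulrA hw /= mulrA -rmorphM.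
    by rewrite rs_zig rmorph1 mul1r.
  rewrite /= starM star_sclr -sclC (sclCA _ (f _)) sclMM qq -(mulrA (scl _)).
  have e4 : f (R_ bet)^† * u = w^† by rewrite -e3 starM starK -rs_star.
  by rewrite -(mulrA _ u^†) e3 e4 ww mulr1.
have b2 := frobenius_ge hu' uu' e2.
rewrite e1; congr (scl _%:C).
have : s0 * d lam <= d f.
  by move: b2; rewrite mulrC ler_pdivlMr // mulrC.
move=> b3; have /le_anti -> : d f <= s0 * d lam <= d f by rewrite b1 b3.
by rewrite mulfK // gt_eqF ?rs_dim_gt0.
Qed.

Lemma frobenius_sq f lam bet w : hom_space f (lam \o bet) w ->
  lam (Rb bet)^† * (w * w^†) * lam (Rb bet)
    = scl (d f / d lam)%:C * (w^† * w).
Proof.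
move=> hw; have hwS := frobeniusS hw.
have [c hc] : exists a : R[i], w^† * w = scl a.
  by apply: (rs_simple (r := f)) => x; rewrite -mulrA hw mulrA /= hwS mulrA.
have [s0 s0ge es] := star_scl_real hc; subst c.
have [s00|s0n] := eqVneq s0 0.
  have -> : w = 0 by apply: star_eq0; rewrite hc s00 rmorph0.
  by rewrite mul0r !mulr0 mul0r.
pose q := (Num.sqrt s0)^-1.
have qq : q%:C * q%:C = (s0^-1)%:C :> R[i].
  by rewrite -rmorphM /= /q -invfM -expr2 sqr_sqrtr.
have hu : hom_space f (lam \o bet) (scl q%:C * w) by exact: homZ.
have uu : (scl q%:C * w)^† * (scl q%:C * w) = 1.
  by rewrite starM star_sclr -sclC sclMM hc qq -!rmorphM /= mulVf // !rmorph1.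
have := frobenius_unit hu uu.
rewrite starM star_sclr -sclC (sclCA _ (lam _)) sclMM qq -(mulrA (scl _)).
move=> /(congr1 (fun x => scl s0%:C * x)); rewrite hc -[in RHS]sclC mulrA -rmorphM -rmorphM /= divff // !rmorph1 mul1r.
by rewrite !mulrA => ->.
Qed.

Lemma frobeniusR f lam bet v w :
  hom_space f (lam \o bet) v -> hom_space f (lam \o bet) w ->
  lam (Rb bet)^† * v * w^† * lam (Rb bet)
    = scl (d f / d lam)%:C * (w^† * v).
Proof.
pose P x := lam (Rb bet)^† * x * lam (Rb bet).
move=> hv hw; rewrite -(mulrA _ v).
apply: (@polarization _ _ f (lam \o bet) P) hv hw.
- by move=> x y; rewrite /P mulrDr mulrDl.
- by move=> a x; rewrite /P sclCA -(mulrA (scl a)).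
- exact: frobenius_sq.
Qed.

(** The exchange identity ties the left closure to the right one, whose value is already known, so
    no second rotation argument is required. *)
Lemma frobenius_sqL f lam bet w : hom_space f (lam \o bet) w ->
  (R_ lam)^† * bar lam (w * w^†) * R_ lam = scl (d f / d bet)%:C * (w^† * w).
Proof.
move=> hw; have hwS := frobeniusS hw.
have [c hc] : exists a : R[i], w^† * w = scl a.
  by apply: (rs_simple (r := f)) => x; rewrite -mulrA hw mulrA /= hwS mulrA.
have [s [s' []]] := frobenius_exchange (rs_sol lam) (rs_sol bet) (@rs_star _ _ lam)
  (@rs_bar_star _ _ lam) (@rs_star _ _ bet) (@rs_bar_star _ _ bet) (@rs_star _ _ f)
  (@rs_simple _ _ lam) (@rs_simple _ _ bet) hw.
rewrite (frobeniusR hw hw) hc -rmorphM => /scl_inj es; rewrite rmorphM mulrA => -> e.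
rewrite -rmorphM; congr scl; apply: (mulIf (rs_dimC_neq0 bet)); rewrite -e -es.
rewrite mulrAC [RHS]mulrAC -!rmorphM /= !divfK // gt_eqF // rs_dim_gt0 //.
Qed.

Lemma frobeniusL f lam bet v w :
  hom_space f (lam \o bet) v -> hom_space f (lam \o bet) w ->
  (R_ lam)^† * bar lam v * bar lam w^† * R_ lam
    = scl (d f / d bet)%:C * (w^† * v).
Proof.
pose P x := (R_ lam)^† * bar lam x * R_ lam.
move=> hv hw; rewrite -(mulrA _ (bar lam v)) -rmorphM.
apply: (@polarization _ _ f (lam \o bet) P) hv hw.
- by move=> x y; rewrite /P rmorphD mulrDr mulrDl.
- by move=> a x; rewrite /P rmorphM /= endo_scl sclCA -(mulrA (scl a)).
- exact: frobenius_sqL.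
Qed.

(** * Bending bases of intertwiners *)

Section HalfTurn.
Variables (kap gam bet : rigid).

(** Conjugate-linear: both [kap] and [bet] change sides, so Hom(kap, gam bet) is carried onto
    Hom(bar kap gam, bar bet). *)
Definition half_turn t := (R_ kap)^† * bar kap t^† * bar kap (gam (Rb bet)).

Lemma half_turn_hom t : hom_space kap (gam \o bet) t ->
  hom_space (bar kap \o gam) (bar bet) (half_turn t).
Proof.
move=> ht x /=; have htS := frobeniusS ht; rewrite /half_turn.
rewrite (ctx1 (bar kap) (whisk gam (rs_homb bet x))) (ctx1 (bar kap) (htS _)).
by rewrite rs_homS !mulrA.
Qed.

(** Both products are scalars. Closing the left one with [R_ bet] and [t^† t'] with [R_ kap] gives
    the same element, whence the ratio of dimensions. *)
Lemma half_turn_mulS t t' : hom_space kap (gam \o bet) t ->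
  hom_space kap (gam \o bet) t' ->
  half_turn t * (half_turn t')^† = scl (d kap / d bet)%:C * (t^† * t').
Proof.
move=> ht ht'; have htS := frobeniusS ht; have ht'S := frobeniusS ht'.
have hh x : (half_turn t')^† * bar bet x = bar kap (gam x) * (half_turn t')^†.
  apply: (hom_star _ _ (half_turn_hom ht')); last exact: rs_bar_star.
  by apply: star_endo_comp; [exact: rs_bar_star|exact: rs_star].
have [s hs] : exists a : R[i], half_turn t * (half_turn t')^† = scl a.
  apply: (rs_simple (r := rs_sym bet)) => x /=.
  by rewrite -mulrA hh mulrA (half_turn_hom ht) mulrA.
have [c hc] : exists a : R[i], t^† * t' = scl a.
  by apply: (rs_simple (r := kap)) => x; rewrite -mulrA ht' mulrA /= htS mulrA.
have e w : hom_space kap (gam \o bet) w ->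
    (half_turn w)^† * R_ bet = bar kap w * R_ kap.
  move=> hw; rewrite /half_turn !starM -!rs_bar_star -!rs_star !starK !mulrA.
  rewrite (ctx (rs_hom kap _)) (ctx1 (bar kap) (hw _)) /=.
  by rewrite (whiskc (bar kap) (whiskc gam (rs_zig bet))) !rmorph1 mul1r.
have e1 : (R_ bet)^† * (half_turn t * (half_turn t')^†) * R_ bet
    = (R_ kap)^† * bar kap (t^† * t') * R_ kap.
  rewrite -(mulrA (R_ bet)^†) -(mulrA (half_turn t)) e // (mulrA (R_ bet)^†).
  rewrite -[half_turn t]starK -starM e // starM.
  by rewrite -rs_bar_star rmorphM !mulrA.
move: e1; rewrite hs hc endo_scl !sclAC -!(mulrA (scl _)) !rs_norm -!rmorphM => /scl_inj e1.
congr scl; apply: (mulIf (rs_dimC_neq0 bet)); rewrite e1.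
by rewrite mulrAC -!rmorphM /= divfK ?gt_eqF ?rs_dim_gt0 // mulrC.
Qed.

Lemma half_turn_surj x : hom_space (bar kap \o gam) (bar bet) x ->
  exists2 t, hom_space kap (gam \o bet) t & half_turn t = x.
Proof.
move=> hx; pose t := (Rb kap)^† * kap x^† * kap (R_ bet).
have hxS y : x^† * bar bet y = bar kap (gam y) * x^†.
  apply: (hom_star _ _ hx); last exact: rs_bar_star.
  by apply: star_endo_comp; [exact: rs_bar_star|exact: rs_star].
exists t.
  move=> y; rewrite /t (ctx1 kap (rs_hom bet y)) (ctx1 kap (hxS _)) /=.
  by rewrite rs_hombS !mulrA.
rewrite /t /half_turn !starM -!rs_star !starK !rmorphM !mulrA.
rewrite rs_homS (ctx (rs_homS kap _)) (ctxc (rs_zag kap)) mulr1 (ctx (hx _)).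
by rewrite rs_zag mul1r.
Qed.

End HalfTurn.

Section LeftTurn.
Variables (kap gam bet : rigid).

(** Linear, and only [gam] changes sides; this is the bend that suits the product of the tube
    algebra. *)
Definition left_turn t := (R_ gam)^† * bar gam t.

Lemma left_turn_hom t : hom_space kap (gam \o bet) t ->
  hom_space (bar gam \o kap) bet (left_turn t).
Proof.
move=> ht x /=; rewrite /left_turn (ctx1 (bar gam) (ht _)) /= rs_homS.
by rewrite !mulrA.
Qed.

Lemma left_turn_mulS t t' : hom_space kap (gam \o bet) t ->
  hom_space kap (gam \o bet) t' ->
  left_turn t * (left_turn t')^† = scl (d kap / d bet)%:C * (t'^† * t).
Proof.
move=> ht ht'; rewrite /left_turn starM starK -rs_bar_star !mulrA.
by rewrite (frobeniusL ht ht') mulrA.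
Qed.

Lemma left_turn_surj x : hom_space (bar gam \o kap) bet x ->
  exists2 t, hom_space kap (gam \o bet) t & left_turn t = x.
Proof.
move=> hx; exists (gam x * Rb gam).
  by move=> y; rewrite -mulrA rs_homb !mulrA (whisk gam (hx _)).
by rewrite /left_turn rmorphM mulrA rs_homS -mulrA rs_zag mulr1.
Qed.

End LeftTurn.
End Frobenius.

(** * Dimension of a decomposition into simple objects *)

Section Positivity.
Variables (R : realType) (M : vonNeumannAlgebra R).
Implicit Types (x y v : M) (D : set {lrmorphism M -> M}).

Local Notation dot := (hilb_dot (vna_space M)).

(* The isometries [v], [w] realizing [id + id] generate a Cuntz algebra, which
   contains the infinitely many orthogonal isometries [v ^+ a * w]. *)
Lemma orthogonal_isometries D (hD : unitary_fusion D) (I : finType) :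
  exists V : I -> M, forall i j, (V i)^† * V j = (i == j)%:R.
Proof.
have [tau [v [w [_ [_ vv] [_ ww] vw]]]] := fus_sum hD (fus_id hD) (fus_id hD).
have wv : w^† * v = 0.
  have h : v^† * w * w^† = 0.
    move: (congr1 (fun x => v^† * x) vw); rewrite /isometry_elt in vv ww.
    rewrite mulrDr !mulrA vv mul1r mulr1.
    by rewrite -[RHS]addr0 => /addrI.
  apply: star_inj; rewrite starM starK star0 -[LHS]mulr1 -ww mulrA.
  by rewrite h mul0r.
have vw0 : v^† * w = 0 by rewrite -[v^† * w]starK starM starK wv star0.
have hn (a b : nat) : (v ^+ a * w)^† * (v ^+ b * w) = (a == b)%:R.
  elim: a b => [|a IH] [|b].
  - by rewrite !expr0 !mul1r ww.
  - by rewrite expr0 mul1r exprS !mulrA wv !mul0r.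
  - by rewrite expr0 mul1r starM exprS starM -!mulrA vw0 !mulr0.
  - by rewrite eqSS -IH !exprS -!mulrA starM -mulrA (mulrA v^†) vv mul1r.
by exists (fun i => v ^+ enum_rank i * w) => i j; rewrite hn val_eqE (inj_eq enum_rank_inj).
Qed.

(** The element [\sum_i V i * x i] encodes the column of the [x i], and its square is the inner
    product of columns; this stands in for matrices over M. *)
Lemma column_mul (I : finType) (V x y : I -> M) :
  (forall i j, (V i)^† * V j = (i == j)%:R) ->
  (\sum_i V i * x i)^† * (\sum_i V i * y i) = \sum_i (x i)^† * y i.
Proof.
move=> hV; rewrite star_sum mulr_suml; apply: eq_bigr => i _.
rewrite mulr_sumr (bigD1 i) //= big1 ?addr0 => [|j ji].
  by rewrite starM -mulrA (mulrA _ (V i)) hV eqxx mul1r.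
by rewrite starM -mulrA (mulrA _ (V j)) hV eq_sym (negPf ji) mul0r mulr0.
Qed.

(** [pos_elt] asks for a single square, so a sum of squares has to be collected into one column. *)
Lemma pos_sum D (hD : unitary_fusion D) (I : finType) (x : I -> M) :
  (forall i, pos_elt (x i)) -> pos_elt (\sum_i x i).
Proof.
move=> hx; have [y hy] := choice hx.
have [V hV] := orthogonal_isometries hD I.
exists (\sum_i V i * y i); rewrite column_mul //.
by apply: eq_bigr => i _; rewrite -hy.
Qed.

Lemma pos_elt_star x : pos_elt (x^† * x). Proof. by exists x. Qed.

Lemma pos_endo (rho : {lrmorphism M -> M}) x : star_endo rho ->
  pos_elt x -> pos_elt (rho x).
Proof. by move=> h [y ->]; exists (rho y); rewrite rmorphM /= h. Qed.

Lemma pos_conj t x : pos_elt x -> pos_elt (t^† * x * t).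
Proof. by case=> y ->; exists (y * t); rewrite starM !mulrA. Qed.

Lemma pos_dot_ge0 x u : pos_elt x -> 0 <= complex.Re (dot (vna_rep x u) u).
Proof.
by case=> y ->; have := dot_star_ge0 y u; rewrite lecE => /andP[].
Qed.

End Positivity.

(** * Stability of normal positive maps *)

Section NormalMaps.
Variables (R : realType) (M : vonNeumannAlgebra R).
Implicit Types (g h : M -> M) (x y t : M).
Local Notation dot := (hilb_dot (vna_space M)).

Record normal_positive g : Prop := NormalPositive {
  np_sub : forall x y, g (x - y) = g x - g y;
  np_pos : forall x, pos_elt x -> pos_elt (g x);
  np_normal : normal_map g }.

Lemma np_comp g h :
  normal_positive g -> normal_positive h -> normal_positive (g \o h).
Proof.
case=> g1 g2 g3 [h1 h2 h3]; split=> /=.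
- by move=> x y; rewrite h1 g1.
- by move=> x /h2 /g2.
- by move=> S x /h3 /g3; rewrite image_comp.
Qed.

Lemma np_endo (rho : {lrmorphism M -> M}) :
  star_endo rho -> normal_map rho -> normal_positive rho.
Proof.
by move=> h1 h2; split=> // [x y|x]; [exact: rmorphB|exact: pos_endo].
Qed.

Lemma np_conj t : normal_positive (fun x => t^† * x * t).
Proof.
have sub x y : t^† * (x - y) * t = t^† * x * t - t^† * y * t.
  by rewrite mulrBr mulrBl.
split=> // [|S x [S0 Sdir Sub Sapp]]; first exact: pos_conj.
split.
- by case: S0 => a Sa; exists (t^† * a * t); exists a.
- move=> _ _ [a Sa <-] [b Sb <-]; have [c [Sc ca cb]] := Sdir _ _ Sa Sb.
  by exists (t^† * c * t); split; [by exists c| |]; rewrite -?sub; exact: pos_conj.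
- by move=> _ [a Sa <-]; rewrite -sub; apply/pos_conj/Sub.
- move=> u eps eps0; have [a Sa ha] := Sapp (vna_rep t u) eps eps0.
  exists (t^† * a * t); first by exists a.
  by rewrite -sub !vna_repM dot_adj starK.
Qed.

(** Each summand comes within its share of [eps] at its own element of [S]. Directedness supplies a
    common upper bound, and monotonicity of [q] preserves all the estimates there. *)
Lemma np_sum (D : set {lrmorphism M -> M}) (hD : unitary_fusion D)
    (I : finType) (g : I -> M -> M) :
  (forall i, normal_positive (g i)) -> normal_positive (fun x => \sum_i g i x).
Proof.
move=> hg; have sub x y : \sum_i g i (x - y) = \sum_i g i x - \sum_i g i y.
  by rewrite -sumrB; apply: eq_bigr => i _; exact: (np_sub (hg i)).
have pos x : pos_elt x -> pos_elt (\sum_i g i x).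
  by move=> hx; apply: (pos_sum hD) => i; exact: (np_pos (hg i)).
split=> // S x Sx; have [S0 Sdir Sub Sapp] := Sx.
split.
- by case: S0 => a Sa; exists (\sum_i g i a); exists a.
- move=> _ _ [a Sa <-] [b Sb <-]; have [c [Sc ca cb]] := Sdir _ _ Sa Sb.
  by exists (\sum_i g i c); split; [by exists c| |]; rewrite -?sub; exact: pos.
- by move=> _ [a Sa <-]; rewrite -sub; apply/pos/Sub.
move=> u eps eps0.
pose q i y : R := complex.Re (dot (vna_rep (g i y) u) u).
have qmono i a b : pos_elt (b - a) -> q i (x - b) <= q i (x - a).
  move=> hab; rewrite -subr_ge0.
  have -> : q i (x - a) - q i (x - b) = q i (b - a).
    rewrite /q -raddfB /= -linearBl /= -vna_repB -(np_sub (hg i)).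
    by rewrite opprB addrC addrA subrK.
  exact/pos_dot_ge0/(np_pos (hg i)).
(* The denominator [#|I|.+1] is nonzero even for empty [I], and it makes the final inequality
   strict. *)
have [a Sa ha] : exists2 a, S a & forall i, q i (x - a) < eps / (#|I|.+1)%:R.
  suff : forall s : seq I, exists2 a, S a &
      forall i, i \in s -> q i (x - a) < eps / (#|I|.+1)%:R.
    by case/(_ (enum I)) => a Sa ha; exists a => // i; apply: ha; rewrite mem_enum.
  elim=> [|i s [a Sa IH]]; first by case: S0 => a Sa; exists a.
  have [_ _ _] := np_normal (hg i) Sx.
  case/(_ u (eps / (#|I|.+1)%:R)); first by rewrite divr_gt0 // ltr0n.
  move=> _ [b Sb <-] hb; have [c [Sc ca cb]] := Sdir _ _ Sa Sb.
  exists c => // j; rewrite inE => /orP[/eqP ->|js].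
    by apply: le_lt_trans (qmono i _ _ cb) _; rewrite /q (np_sub (hg i)).
  exact: le_lt_trans (qmono j _ _ ca) (IH j js).
exists (\sum_i g i a); first by exists a.
rewrite -sub vna_rep_sum.
have -> : complex.Re (dot (\sum_i vna_rep (g i (x - a)) u) u)
    = \sum_i q i (x - a).
  elim/big_rec2: _ => [|i y1 y2 _ <-]; first by rewrite linear0l.
  by rewrite linearDl raddfD.
apply: (@le_lt_trans _ _ (\sum_(i : I) eps / (#|I|.+1)%:R)).
  by apply: ler_sum => i _; exact: ltW.
rewrite sumr_const -[X in X < _]mulr_natr mulrAC ltr_pdivrMr ?ltr0n //.
by rewrite ltr_pM2l // ltr_nat.
Qed.

End NormalMaps.

Section Dimension.
Variables (R : realType) (M : vonNeumannAlgebra R) (hfactor : is_factor M).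
Variables (D : set {lrmorphism M -> M}) (hD : unitary_fusion D).
Local Notation rigid := (rigid_simple M).
Local Notation Rb := (@rs_rb R M).
Local Notation R_ := (@rs_r R M).
Local Notation d := (@rs_dim R M).
Local Notation bar := (@rs_bar R M).
Implicit Types (f : rigid) (x y t : M) (rho : {lrmorphism M -> M}).

Lemma fus_star rho : D rho -> star_endo rho.
Proof. by move=> /(fus_endo hD) []. Qed.

Lemma fus_normal rho : D rho -> normal_map rho.
Proof. by move=> /(fus_endo hD) []. Qed.

Lemma factor_scl x : (forall y, x * y = y * x) -> exists a, x = scl a.
Proof. exact: hfactor. Qed.

(** In a factor the norms of [r] and [rb] are scalars [a'] and [b']. Replacing them by [z r] and
    [z^-1 rb] keeps the conjugate equations, and the norms agree when [z] is the fourth root of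
    [b' / a']. *)
Lemma rigid_exists rho : D rho -> simple_obj rho ->
  exists f : rigid, rs_fun f = rho /\ D (bar f).
Proof.
move=> Drho srho; have [rhob [r [rb [Drhob hr hrb zig zag]]]] := fus_conj hD Drho.
have h1 := fus_star Drho; have h2 := fus_star Drhob.
have [a ha] : exists a, r^† * r = scl a.
  apply: factor_scl => y; rewrite -mulrA hr mulrA /=.
  by rewrite (hom_star _ (star_endo_comp h2 h1) hr) // mulrA.
have [b hb] : exists a, rb^† * rb = scl a.
  apply: factor_scl => y; rewrite -mulrA hrb mulrA /=.
  by rewrite (hom_star _ (star_endo_comp h1 h2) hrb) // mulrA.
have [a' a0 ea] := star_scl_real ha; have [b' b0 eb] := star_scl_real hb.
subst a b.
have a1 : 0 < a'.
  rewrite lt_def a0 andbT; apply/eqP => a00; have r0 : r = 0.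
    by apply: star_eq0; rewrite ha a00 rmorph0.
  by have /eqP := oner_neq0 M; rewrite -zig r0 rmorph0 mulr0.
have b1 : 0 < b'.
  rewrite lt_def b0 andbT; apply/eqP => a00; have r0 : rb = 0.
    by apply: star_eq0; rewrite hb a00 rmorph0.
  by have /eqP := oner_neq0 M; rewrite -zig r0 star0 mul0r.
pose z := Num.sqrt (Num.sqrt (b' / a')).
have z0 : z != 0 by rewrite gt_eqF // !sqrtr_gt0 divr_gt0.
have zz : z * z = Num.sqrt (b' / a') by rewrite -expr2 sqr_sqrtr // sqrtr_ge0.
have zzzz : (z * z) * (z * z) = b' / a'.
  by rewrite zz -expr2 sqr_sqrtr // divr_ge0.
have e1 : (z * z * a') = (z^-1 * z^-1) * b'.
  rewrite -invfM; apply: (mulfI (mulf_neq0 z0 z0)); rewrite mulrA zzzz.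
  have zz0 : z * z != 0 by rewrite mulf_neq0.
  rewrite divfK ?(gt_eqF a1) // mulrA divff // mul1r //.
have cs : conj_sol rho rhob (scl z%:C * r) (scl z^-1%:C * rb) (z * z * a').
  split.
  - by move=> x; rewrite -mulrA hr sclCA.
  - by move=> x; rewrite -mulrA hrb sclCA.
  - rewrite starM star_sclr -sclC rmorphM /= endo_scl sclMM zig.
    by rewrite mulr1 -!rmorphM /= mulVf // !rmorph1.
  - rewrite starM star_sclr -sclC rmorphM /= endo_scl sclMM zag.
    by rewrite mulr1 -!rmorphM /= mulfV // !rmorph1.
  - by rewrite starM star_sclr -sclC sclMM ha -!rmorphM.
  - by rewrite starM star_sclr -sclC sclMM hb -!rmorphM /= e1.
by exists (RigidSimple h1 h2 cs srho).
Qed.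

Lemma rs_inj f : injective f.
Proof.
move=> x y e; have h z : z * (R_ f)^† * R_ f = (R_ f)^† * bar f (f z) * R_ f.
  by rewrite rs_homS.
have := h x; rewrite e -h -!mulrA rs_norm -!sclC => e2.
by rewrite -[x](sclK _ (rs_dimC_neq0 f)) e2 sclK // rs_dimC_neq0.
Qed.

(** In the square of [Rb - f R_] both norms are [d] and the conjugate equations make each cross term
    1, so [2 d - 2] is nonnegative. *)
Lemma rs_dim_ge1 f : 1 <= d f.
Proof.
suff : 0 <= (d f + d f - 2)%:C :> R[i] by rewrite ler0c => h; lra.
apply: (@star_scl_ge0 _ M (Rb f - f (R_ f))).
rewrite starB -rs_star mulrBl !mulrBr rs_normb rs_zig rs_zigS -rmorphM /=.
rewrite rs_norm endo_scl -[1](rmorph1 (@scl R M)) -[1](rmorph1 (real_complex R)).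
rewrite -!rmorphB; congr scl; congr _%:C; lra.
Qed.

(** * The minimal index from a decomposition into simple objects *)

Section Decomposition.
Variables (rho : {lrmorphism M -> M}) (Drho : D rho).
Variables (P : finType) (f : P -> rigid) (w : P -> M).
Hypothesis Dfb : forall p, D (bar (f p)).
Hypotheses (hw : forall p, hom_space (f p) rho (w p))
  (wiso : forall p, (w p)^† * w p = 1) (wsum : \sum_p w p * (w p)^† = 1).

Let delta := \sum_p d (f p).

Let hwS p : hom_space rho (f p) (w p)^†.
Proof. by apply: hom_star (hw p); [exact: rs_star|exact: fus_star]. Qed.

(** Compressing [\sum_p w p (w p)^† = 1] by the isometry [w q] leaves a sum of squares over [i != q]
    that must vanish. *)
Lemma decomposition_orthogonal p q : p != q -> (w p)^† * w q = 0.
Proof.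
move=> pq; have h : \sum_(i | i != q) ((w i)^† * w q)^† * ((w i)^† * w q) = 0.
  apply: (addrI ((w q)^† * w q)).
  transitivity ((w q)^† * (\sum_i w i * (w i)^†) * w q).
    rewrite mulr_sumr mulr_suml [RHS](bigD1 q) //= !mulrA wiso mul1r wiso.
    congr (_ + _); apply: eq_bigr => i _.
    by rewrite starM starK !mulrA.
  by rewrite wsum mulr1 addr0.
pose F i := if i != q then (w i)^† * w q else 0.
have F0 : \sum_i (F i)^† * F i = 0.
  rewrite -[RHS]h [RHS]big_mkcond; apply: eq_bigr => i _; rewrite /F.
  by case: ifP; rewrite ?mulr0.
by have := sum_star_eq0 F0 p; rewrite /F pq.
Qed.

Lemma decomposition_inj : injective rho.
Proof.
have [p _] : exists p : P, True.
  apply: contrapT => h; have /eqP := oner_neq0 M; rewrite -wsum big1 // => p.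
  by case: h; exists p.
move=> x y e; apply: (@rs_inj (f p)); rewrite -[LHS]mul1r -[RHS]mul1r -(wiso p).
by rewrite -!mulrA !hw e.
Qed.

Let delta_gt0 : 0 < delta.
Proof.
rewrite /delta lt_def sumr_ge0 ?andbT => [|p _]; last exact/ltW/rs_dim_gt0.
rewrite psumr_neq0 => [|p _]; last exact/ltW/rs_dim_gt0.
apply: contrapT => /negP; rewrite -all_predC => /allP h.
have /eqP := oner_neq0 M; rewrite -wsum big1 // => p _.
by have := h p (mem_index_enum p); rewrite /= rs_dim_gt0.
Qed.

(* Restricting a left inverse of [rho] to a simple summand [f p] gives a
   multiple of the unique left inverse [x |-> r^† bar(x) r] of [f p]. *)
Lemma left_inverse_summand (phi : M -> M) p :
  (forall a x b, phi (rho a * x * rho b) = a * phi x * b) ->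
  exists c : R[i], forall x,
    phi (w p * x * (w p)^†) = scl c * ((R_ (f p))^† * bar (f p) x * R_ (f p)).
Proof.
move=> hphi; pose psi x := phi (w p * x * (w p)^†).
have psil a x : psi (f p a * x) = a * psi x.
  have := hphi a (w p * x * (w p)^†) 1; rewrite rmorph1 !mulr1 => <-.
  by rewrite /psi !mulrA hw.
have psir x b : psi (x * f p b) = psi x * b.
  have := hphi 1 (w p * x * (w p)^†) b; rewrite rmorph1 !mul1r => <-.
  by rewrite /psi -!mulrA hwS.
have hs y : psi (Rb (f p)) * y = bar (f p) (f p y) * psi (Rb (f p)).
  by rewrite -psir rs_homb psil.
have [c hc] : exists c : R[i], (Rb (f p))^† * f p (psi (Rb (f p))) = scl c.
  apply: (rs_simple (r := f p)) => x; rewrite -mulrA -rmorphM hs rmorphM mulrA.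
  by rewrite rs_hombS mulrA.
have es : psi (Rb (f p)) = scl c * R_ (f p).
  rewrite -(endo_scl (bar (f p))) -hc rmorphM -(ctx (rs_hom _ _)).
  by rewrite rs_zagS mul1r.
exists c => x; rewrite -[LHS]/(psi x).
have {1}-> : x = f p ((R_ (f p))^† * bar (f p) x) * Rb (f p).
  by rewrite rmorphM -mulrA -rs_homb mulrA rs_zigS mul1r.
by rewrite psil es sclCA.
Qed.

(* For the vector [v] below, [v^† v = delta] and [v^† E(vv^†) v = 1], so that the
   inequality at [vv^†], compressed by [v], reads [delta ^+ 2 <= c]. *)
Lemma pimsner_popa_bound E c : cond_expectation (range rho) E ->
  pimsner_popa E c -> delta ^+ 2 <= c.
Proof.
move=> [[Elin Eran] E1 Ebim _ _] [c0 hc].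
have Eran' x : exists y, E x = rho y by have [y _ <-] := Eran x; exists y.
(* [phi] is [E] followed by the inverse of [rho]: a left inverse of [rho]. *)
have [phi Ephi] := choice Eran'.
have ED x y : E (x + y) = E x + E y by have := Elin 1 x y; rewrite !scale1r.
have phiD x y : phi (x + y) = phi x + phi y.
  by apply: decomposition_inj; rewrite rmorphD /= -!Ephi ED.
have phi0 : phi 0 = 0 by apply: (addrI (phi 0)); rewrite -phiD !addr0.
have phi_sum (I : finType) (F : I -> M) :
    phi (\sum_i F i) = \sum_i phi (F i) by exact: (big_morph _ phiD phi0).
have phi1 : phi 1 = 1 by apply: decomposition_inj; rewrite -Ephi E1 rmorph1.
have phib a x b : phi (rho a * x * rho b) = a * phi x * b.
  apply: decomposition_inj; rewrite -Ephi Ebim; do ?by [exists a|exists b].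
  by rewrite !rmorphM /= Ephi.
have [g hg] := choice (fun p => left_inverse_summand p phib).
have [V hV] := orthogonal_isometries hD P.
pose v := \sum_p rho (V p) * (w p * Rb (f p)).
have rhoV p q : rho (V p)^† * rho (V q) = (p == q)%:R.
  by rewrite -rmorphM hV rmorph_nat.
have wRb p : (w p * Rb (f p))^† * (w p * Rb (f p)) = scl (d (f p))%:C.
  by rewrite starM -mulrA (mulrA _ (w p)) wiso mul1r rs_normb.
have vv : v^† * v = scl delta%:C.
  rewrite column_mul => [|p q]; last by rewrite -(fus_star Drho) rhoV.
  by rewrite !rmorph_sum /=; apply: eq_bigr => p _.
(* The weights [g p * d (f p)] of [phi] on the summands add up to [phi 1 = 1]. Only their sum enters
   below, so the bound is the same for every expectation. *)
have hsum : \sum_p g p * (d (f p))%:C = 1.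
  apply: (@scl_inj _ M); rewrite rmorph1 -phi1 -wsum phi_sum rmorph_sum.
  apply: eq_bigr => p _; have := hg p 1; rewrite mulr1 => ->.
  by rewrite rmorph1 mulr1 rs_norm -rmorphM.
have rhov p : rho (V p)^† * v = w p * Rb (f p).
  rewrite /v mulr_sumr (bigD1 p) //= mulrA rhoV eqxx mul1r big1 ?addr0 // => q qp.
  by rewrite mulrA rhoV eq_sym (negPf qp) mul0r.
have rhovS p : v^† * rho (V p) = (w p * Rb (f p))^†.
  by rewrite -rhov starM -(fus_star Drho) starK.
have vvS : v * v^† = \sum_p \sum_q
    rho (V p) * (w p * Rb (f p) * (w q * Rb (f q))^†) * rho (V q)^†.
  rewrite {1}/v mulr_suml; apply: eq_bigr => p _.
  rewrite /v star_sum mulr_sumr; apply: eq_bigr => q _.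
  by rewrite starM -(fus_star Drho) !mulrA.
clearbody v.
have hv : v^† * E (v * v^†) * v = 1.
  rewrite vvS Ephi phi_sum rmorph_sum mulr_sumr mulr_suml.
  rewrite -[RHS](rmorph1 (@scl R M)) -hsum rmorph_sum; apply: eq_bigr => p _.
  have e1 q : v^† * rho (phi (rho (V p) * (w p * Rb (f p) * (w q * Rb (f q))^†)
      * rho (V q)^†)) * v = (Rb (f p))^† * f p (phi (w p * Rb (f p) *
      (w q * Rb (f q))^†)) * ((w p)^† * w q) * Rb (f q).
    rewrite phib !rmorphM !mulrA rhovS -mulrA rhov starM !mulrA.
    by rewrite (ctx (hwS p _)).
  rewrite phi_sum rmorph_sum mulr_sumr mulr_suml (bigD1 p) //= big1 => [|q qp].
    have e2 : w p * Rb (f p) * (w p * Rb (f p))^†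
        = w p * (Rb (f p) * (Rb (f p))^†) * (w p)^† by rewrite starM !mulrA.
    have e3 : (R_ (f p))^† * bar (f p) (Rb (f p) * (Rb (f p))^†) * R_ (f p) = 1.
      by rewrite rmorphM mulrA rs_zag mul1r rs_zagS.
    rewrite addr0 e1 wiso mulr1 e2 hg e3 mulr1.
    by rewrite endo_scl -sclC -mulrA rs_normb -rmorphM.
  by rewrite e1 decomposition_orthogonal 1?eq_sym // mulr0 mul0r.
have [y hy] := hc v^†.
have : (y * v)^† * (y * v) = scl (c - delta ^+ 2)%:C.
  rewrite starM -mulrA (mulrA _ y) -hy starK sclZ mulrBl mulrBr.
  rewrite -(mulrA (scl _)) sclCA (mulrA v^†) hv mulr1 -(mulrA v) vv mulrA vv.
  by rewrite -rmorphM -rmorphB -rmorphM -rmorphB.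
move/star_scl_ge0; rewrite ler0c subr_ge0 //.
Qed.

Let tr p : M := scl (Num.sqrt delta)^-1%:C * R_ (f p).
(** The standard left inverse: all the constants [g p] equal [delta^-1], so that the summand [p] has
    weight [d (f p) / delta]. As a sum of conjugations and endomorphisms it is visibly normal and
    positive. *)
Let mean x := \sum_p (tr p)^† * bar (f p) ((w p)^† * x * w p) * tr p.

Let sqrt_delta : (Num.sqrt delta)^-1 * (Num.sqrt delta)^-1 = delta^-1.
Proof. by rewrite -invfM -expr2 sqr_sqrtr // ltW. Qed.

Let tr_mul p x : (tr p)^† * x * tr p
  = scl delta^-1%:C * ((R_ (f p))^† * x * R_ (f p)).
Proof. by rewrite /tr starM star_sclr -sclC -(mulrA (scl _)) sclMM -rmorphM /= sqrt_delta. Qed.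

Let mean_np : normal_positive mean.
Proof.
apply: (np_sum hD) => p.
apply: (@np_comp _ _ (fun x => (tr p)^† * x * tr p)
  (fun x => bar (f p) ((w p)^† * x * w p))); first exact: np_conj.
apply: (@np_comp _ _ (bar (f p)) (fun x => (w p)^† * x * w p)); last exact: np_conj.
by apply: np_endo; [exact: rs_bar_star|exact/fus_normal].
Qed.

Let mean_star x : mean (x^† * x) = scl delta^-1%:C *
  \sum_p (bar (f p) (x * w p) * R_ (f p))^† * (bar (f p) (x * w p) * R_ (f p)).
Proof.
rewrite /mean mulr_sumr; apply: eq_bigr => p _; rewrite tr_mul; congr (_ * _).
by rewrite starM -rs_bar_star starM !mulrA -(mulrA _ (bar _ _) (bar _ _)) -rmorphM !mulrA.
Qed.

Let recon x p : x * w p = (Rb (f p))^† * f p (bar (f p) (x * w p) * R_ (f p)).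
Proof. by rewrite rmorphM mulrA rs_hombS -mulrA rs_zig mulr1. Qed.

Let expect x := rho (mean x).

Let expect_cond : cond_expectation (range rho) expect.
Proof.
have mean1 : mean 1 = 1.
  have := mean_star 1; rewrite star1 mul1r => ->.
  have -> : \sum_p (bar (f p) (1 * w p) * R_ (f p))^† * (bar (f p) (1 * w p) * R_ (f p))
      = scl delta%:C.
    rewrite /delta !rmorph_sum /=; apply: eq_bigr => p _.
    rewrite mul1r starM -rs_bar_star -mulrA (mulrA (bar _ _)) -rmorphM wiso.
    by rewrite rmorph1 mul1r rs_norm.
  by rewrite -!rmorphM /= mulVf ?gt_eqF // !rmorph1.
have npE : normal_positive expect.
  by apply: (np_comp _ mean_np); apply: np_endo; [exact: fus_star|exact: fus_normal].
have mean_bim a x b : mean (rho a * x * rho b) = a * mean x * b.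
  rewrite /mean mulr_sumr mulr_suml; apply: eq_bigr => p _.
  rewrite !tr_mul sclCA -(mulrA (scl _)); congr (_ * _).
  have -> : (w p)^† * (rho a * x * rho b) * w p
      = f p a * ((w p)^† * x * w p) * f p b.
    by rewrite !mulrA hwS -!mulrA hw.
  by rewrite !rmorphM !mulrA rs_homS -!mulrA -rs_hom.
split.
- split=> [a x y|x]; last by exists (mean x).
  rewrite /expect !sclZ -[in RHS](endo_scl rho) -rmorphM -rmorphD; congr (rho _).
  rewrite /mean mulr_sumr -big_split; apply: eq_bigr => p _ /=.
  rewrite mulrDr mulrDl rmorphD mulrDr mulrDl; congr (_ + _).
  by rewrite sclCA -(mulrA (scl a)) rmorphM /= endo_scl sclCA -(mulrA (scl a)).
- by rewrite /expect mean1 rmorph1.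
- by move=> _ x _ [a _ <-] [b _ <-]; rewrite /expect mean_bim !rmorphM.
- by move=> x; apply: (np_pos npE); exact: pos_elt_star.
split; last exact: np_normal npE.
move=> x; rewrite /expect => e0.
have := decomposition_inj (etrans e0 (esym (rmorph0 rho))).
rewrite mean_star => /scl_eq0 e1.
have dn : delta^-1%:C != 0 :> R[i] by rewrite fmorph_eq0 invr_eq0 gt_eqF.
have e2 := sum_star_eq0 (e1 dn).
rewrite -[x]mulr1 -wsum mulr_sumr big1 // => p _.
by rewrite mulrA recon e2 rmorph0 mulr0 mul0r.
Qed.

(* With [y p = bar(x w p) r] one has [x = b^† y] for a column [b] of square
   norm [delta], and [E (x^† x)] is [delta^-1 y^† y]. *)
Let expect_pp : pimsner_popa expect (delta ^+ 2).
Proof.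
split=> [|x]; first exact: sqr_ge0.
have [V hV] := orthogonal_isometries hD P.
pose y p := bar (f p) (x * w p) * R_ (f p).
pose Y := \sum_p V p * rho (y p).
pose B := \sum_p V p * (w p * Rb (f p)).
have BY : B^† * Y = x.
  rewrite column_mul // -[RHS]mulr1 -wsum mulr_sumr; apply: eq_bigr => p _.
  by rewrite [RHS]mulrA recon starM -!mulrA hwS.
have BB : B^† * B = scl delta%:C.
  rewrite column_mul // /delta !rmorph_sum /=; apply: eq_bigr => p _.
  by rewrite starM -mulrA (mulrA _ (w p)) wiso mul1r rs_normb.
have YY : Y^† * Y = scl delta%:C * expect (x^† * x).
  rewrite column_mul // /expect mean_star rmorphM /= endo_scl mulrA -!rmorphM /=.
  rewrite divff ?gt_eqF // !rmorph1 mul1r rmorph_sum; apply: eq_bigr => p _.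
  by rewrite -/(y p) [in RHS]rmorphM /= (fus_star Drho).
clearbody Y B.
(* Since [B B^† / delta] is a projection, [q] is a square root of [delta - B B^†], and the
   difference in the Pimsner-Popa inequality is [Y^† (delta - B B^†) Y]. *)
pose q : M := scl (Num.sqrt delta)%:C - scl (Num.sqrt delta)^-1%:C * (B * B^†).
exists (q * Y).
rewrite sclZ starM -mulrA (mulrA _ q).
have -> : q^† * q = scl delta%:C - B * B^†.
  have qs : q^† = q by rewrite /q starB starM !star_sclr starM starK -sclC.
  have sd : Num.sqrt delta != 0 by rewrite gt_eqF // sqrtr_gt0.
  have BBBB : B * B^† * (B * B^†) = scl delta%:C * (B * B^†).
    by rewrite -mulrA (mulrA B^†) BB sclCA.
  rewrite qs /q mulrBl !mulrBr sclMM BBBB -(mulrA (scl _)).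
  rewrite -(sclC _ (B * B^†)) !(mulrA (scl _)) -!rmorphM /= mulfV // mulVf //.
  rewrite sqrt_delta mulVf ?gt_eqF // -expr2 sqr_sqrtr ?ltW //.
  by rewrite !rmorph1 !mul1r subrr subr0.
have YB : Y^† * B = x^† by rewrite -BY starM starK.
rewrite mulrBl mulrBr sclCA YY -(mulrA B) BY (mulrA Y^†) YB (mulrA (scl _)).
by rewrite -!rmorphM.
Qed.

Lemma dimension_decomposition : dimension rho = delta.
Proof.
have delta0 := ltW delta_gt0.
rewrite /dimension; suff -> : minimal_index (range rho) = delta ^+ 2.
  by rewrite sqrtr_sqr ger0_norm.
have idx E : finite_index_expectation (range rho) E ->
    delta ^+ 2 <= expectation_index E.
  move=> [hE [c hc]]; apply: lb_le_inf; first by exists c.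
  by move=> c' /(pimsner_popa_bound hE).
apply/eqP; rewrite eq_le; apply/andP; split; last first.
  apply: lb_le_inf.
    by exists (expectation_index expect); exists expect => //; split=> //; exists (delta ^+ 2).
  by move=> _ [E hE <-]; exact: idx.
apply: (@le_trans _ _ (expectation_index expect)).
  apply: ge_inf; last by exists expect => //; split=> //; exists (delta ^+ 2).
  by exists (delta ^+ 2) => _ [E hE <-]; exact: idx.
apply: ge_inf => //; exists 0 => c [] //.
Qed.

End Decomposition.
End Dimension.

(** * Additivity of the dimension, complete systems of intertwiners, traces *)

Section FusionCategory.
Variables (R : realType) (M : vonNeumannAlgebra R) (hfactor : is_factor M).
Variables (D : set {lrmorphism M -> M}) (hD : unitary_fusion D).
Local Notation rigid := (rigid_simple M).
Local Notation Rb := (@rs_rb R M).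
Local Notation R_ := (@rs_r R M).
Local Notation d := (@rs_dim R M).
Local Notation bar := (@rs_bar R M).
Implicit Types (f : rigid) (x y t : M) (rho tau : {lrmorphism M -> M}).

Lemma rigid_decomposition rho : D rho ->
  exists (n : nat) (f : 'I_n -> rigid) (w : 'I_n -> M),
    [/\ forall p, D (f p) /\ D (bar (f p)),
        forall p, hom_space (f p) rho (w p),
        forall p, (w p)^† * w p = 1 & \sum_p w p * (w p)^† = 1].
Proof.
move=> /(fus_semisimple hD) [n [g [w [hg hw]]]].
have h p : exists f : rigid, rs_fun f = g p /\ D (bar f).
  by have [Dg sg _ _] := hg p; apply: (rigid_exists hfactor hD).
have [f hf] := choice h; exists n, f, w; split=> // p;
  have [e Db] := hf p; have [Dg _ hom iso] := hg p; rewrite ?e //.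
Qed.

Lemma dimension_rigid f : D f -> D (bar f) -> dimension f = d f.
Proof.
move=> h1 h2.
have e := @dimension_decomposition _ _ D hD f h1 'I_1 (fun=> f) (fun=> 1).
by rewrite e ?big_ord1 ?star1 ?mulr1 // => _; exact: hom1.
Qed.

Lemma dimension_ge1 rho : D rho -> 1 <= dimension rho.
Proof.
move=> h; have [n [f [w [hf hw wiso wsum]]]] := rigid_decomposition h.
rewrite (dimension_decomposition hD h (fun p => (hf p).2) hw wiso wsum).
case: n f w hf hw wiso wsum => [|n] f w hf hw wiso wsum.
  by move: wsum; rewrite big_ord0 => /eqP; rewrite eq_sym oner_eq0.
rewrite big_ord_recl; apply: le_trans (rs_dim_ge1 (f ord0)) _.
rewrite lerDl; apply: sumr_ge0 => p _; exact/ltW/rs_dim_gt0.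
Qed.

Lemma dimension_add rho (P : finType) (tau : P -> {lrmorphism M -> M}) (w : P -> M) :
  D rho -> (forall p, D (tau p)) -> (forall p, hom_space (tau p) rho (w p)) ->
  (forall p, (w p)^† * w p = 1) -> \sum_p w p * (w p)^† = 1 ->
  dimension rho = \sum_p dimension (tau p).
Proof.
move=> Drho Dtau hw wiso wsum.
have h p : exists s : {n : nat & (('I_n -> rigid) * ('I_n -> M))%type},
    let f := (tagged s).1 in let v := (tagged s).2 in
    [/\ forall q, D (f q) /\ D (bar (f q)), forall q, hom_space (f q) (tau p) (v q),
        forall q, (v q)^† * v q = 1 & \sum_q v q * (v q)^† = 1].
  have [n [f [v hv]]] := rigid_decomposition (Dtau p).
  by exists (existT _ n (f, v)).
have [s hs] := choice h.
pose n p := tag (s p); pose f p : 'I_(n p) -> rigid := (tagged (s p)).1.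
pose v p : 'I_(n p) -> M := (tagged (s p)).2.
have {}hs p : [/\ forall q, D (f p q) /\ D (bar (f p q)),
    forall q, hom_space (f p q) (tau p) (v p q),
    forall q, (v p q)^† * v p q = 1 & \sum_q v p q * (v p q)^† = 1] := hs p.
pose F (q : {p : P & 'I_(n p)}) := f (tag q) (tagged q).
pose V (q : {p : P & 'I_(n p)}) := w (tag q) * v (tag q) (tagged q).
rewrite (@dimension_decomposition _ _ D hD rho Drho _ F V).
- rewrite -(@sig_big_dep _ _ _ P (fun p => 'I_(n p)) xpredT (fun _ => predT) (fun p q => d (f p q))) /=.
  apply: eq_bigr => p _; have [h1 h2 h3 h4] := hs p.
  by rewrite (dimension_decomposition hD (Dtau p) (fun q => (h1 q).2) h2 h3 h4).
- by move=> [p q]; have [h1 _ _ _] := hs p; have [_] := h1 q.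
- by move=> [p q]; have [_ h2 _ _] := hs p; exact: homM (hw p) (h2 q).
- move=> [p q]; have [_ _ h3 _] := hs p.
  by rewrite /V /= starM -mulrA (mulrA _ (w p)) wiso mul1r h3.
- rewrite -(@sig_big_dep _ _ _ P (fun p => 'I_(n p)) xpredT (fun _ => predT)
    (fun p q => w p * v p q * (w p * v p q)^†)) /= -[RHS]wsum.
  apply: eq_bigr => p _; have [_ _ _ h4] := hs p.
  rewrite -[X in _ = X * _]mulr1 -h4 mulr_sumr mulr_suml.
  by apply: eq_bigr => q _; rewrite starM !mulrA.
Qed.

(** The sum fixes every [t j p], hence every embedding of a simple object, since such an embedding
    lies in their span up to a unitary. Norms [c j] other than 1 are allowed because bent bases are
    orthogonal but not normalised. *)
Lemma resolution_of_identity (J : finType) (g : J -> {lrmorphism M -> M}) rho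
    (n : J -> nat) (t : forall j, 'I_(n j) -> M) (c : J -> R[i]) :
  irr_representatives D g -> D rho -> (forall j, c j != 0) ->
  (forall j p, hom_space (g j) rho (t j p)) ->
  (forall j p q, (t j p)^† * t j q = (p == q)%:R * scl (c j)) ->
  (forall j x, hom_space (g j) rho x ->
     exists a : 'I_(n j) -> R[i], x = \sum_p scl (a p) * t j p) ->
  \sum_j \sum_p scl (c j)^-1 * (t j p * (t j p)^†) = 1.
Proof.
move=> [hg ginj gsurj] Drho c0 ht horth hspan.
have hs j : star_endo (g j) by have [Dg _] := hg j; exact: (fus_star hD).
set Q := LHS.
have Qt j p : Q * t j p = t j p.
  rewrite /Q mulr_suml (bigD1 j) //= [X in _ + X]big1 ?addr0 => [|k kj].
    rewrite mulr_suml (bigD1 p) //= [X in _ + X]big1 ?addr0 => [|q qp].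
      by rewrite -!mulrA horth eqxx mul1r -sclC sclK.
    by rewrite -!mulrA horth (negPf qp) mul0r !mulr0.
  rewrite mulr_suml big1 // => q _; rewrite -!mulrA.
  have -> : (t k q)^† * t j p = 0; last by rewrite !mulr0.
  apply: contrapT => h; move/eqP: kj; apply; apply: esym; apply: ginj.
  have [_ s1] := hg j; have [_ s2] := hg k.
  apply: (schur (hs j) (hs k) s1 s2 _ h).
  apply: homM (ht j p); apply: hom_star (ht k q) => //; exact: (fus_star hD).
have [m [f [w [hf hw]]]] := fus_semisimple hD Drho.
have Qw p : Q * w p = w p.
  have [Df sf hwp _] := hf p; have [j [u hu [uu _]]] := gsurj _ Df sf.
  have [a ha] : exists a : 'I_(n j) -> R[i], w p * u^† = \sum_q scl (a q) * t j q.
    by apply: hspan; apply: (homM hwp); apply: hom_star hu => //; exact: (fus_star hD).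
  have -> : w p = (\sum_q scl (a q) * t j q) * u by rewrite -ha -mulrA uu mulr1.
  rewrite mulrA; congr (_ * _); rewrite mulr_sumr; apply: eq_bigr => q _.
  by rewrite sclCA Qt.
rewrite -[LHS]mulr1 -hw mulr_sumr; apply: eq_bigr => p _.
by rewrite mulrA Qw.
Qed.

(* Traciality: the two sides are the categorical traces of [y^† y] on
   [lam bet] and of [y y^†] on [bet mu]. *)
Lemma trace_exchange (lam bet mu : rigid) y : D (lam \o bet) ->
  hom_space (lam \o bet) (bet \o mu) y ->
  scl (d lam)%:C * (lam (Rb bet)^† * y^† * y * lam (Rb bet))
  = scl (d mu)%:C * ((R_ bet)^† * bar bet (y * y^†) * R_ bet).
Proof.
move=> Dlb hy; have [n [f [w [hf hw wiso wsum]]]] := rigid_decomposition Dlb.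
have orth := decomposition_orthogonal wiso wsum.
have hslb : star_endo (lam \o bet) by apply: star_endo_comp; exact: rs_star.
have hsbm : star_endo (bet \o mu) by apply: star_endo_comp; exact: rs_star.
have hyS : hom_space (bet \o mu) (lam \o bet) y^† by exact: hom_star hy.
have hwS p : hom_space (lam \o bet) (f p) (w p)^†.
  by apply: hom_star (hw p) => //; exact: rs_star.
transitivity (\sum_p scl (d (f p))%:C * ((w p)^† * y^† * y * w p)).
  have yy : y^† * y = \sum_p \sum_q w q * ((w q)^† * y^† * y * w p) * (w p)^†.
    rewrite -[LHS]mulr1 -wsum mulr_sumr; apply: eq_bigr => p _.
    rewrite -[LHS]mul1r -{1}wsum mulr_suml; apply: eq_bigr => q _.
    by rewrite !mulrA.
  have hv q p : hom_space (f p) (lam \o bet) (w q * ((w q)^† * y^† * y * w p)).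
    by apply: homM (hw q) _; apply: homM (hw p); apply: homM hy; exact: homM hyS.
  rewrite -(mulrA _ y^†) yy mulr_sumr mulr_suml mulr_sumr; apply: eq_bigr => p _.
  rewrite mulr_sumr mulr_suml mulr_sumr (bigD1 p) //= big1 => [|q qp].
    rewrite addr0 (mulrA (lam _)) (frobeniusR (hv p p) (hw p)) (mulrA _ (w p)) wiso mul1r.
    rewrite mulrA -!rmorphM /=; congr (scl _%:C * _).
    by rewrite mulrC divfK // gt_eqF ?rs_dim_gt0.
  rewrite (mulrA (lam _)) (frobeniusR (hv q p) (hw p)) (mulrA _ (w q)) orth 1?eq_sym //.
  by rewrite mul0r !mulr0.
have hyw p : hom_space (f p) (bet \o mu) (y * w p) by exact: homM hy (hw p).
have -> : y * y^† = \sum_p (y * w p) * (y * w p)^†.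
  rewrite -[X in X * _]mulr1 -wsum mulr_sumr mulr_suml.
  by apply: eq_bigr => p _; rewrite starM !mulrA.
rewrite rmorph_sum mulr_sumr mulr_suml mulr_sumr; apply: eq_bigr => p _ /=.
rewrite rmorphM (mulrA (R_ bet)^†) (frobeniusL (hyw p) (hyw p)) [in RHS](mulrA (scl _)) -!rmorphM /=.
rewrite [d mu * _]mulrC divfK ?gt_eqF ?rs_dim_gt0 //.
by rewrite starM !mulrA.
Qed.

End FusionCategory.

(** * Averaging over half-braidings *)

Section HalfBraidings.
Variables (R : realType) (M : vonNeumannAlgebra R).
Variables (C : set {lrmorphism M -> M}) (hC : unitary_fusion C).
Variables (J : finType) (irrC : J -> {lrmorphism M -> M}).
Hypothesis hirrC : irr_representatives C irrC.
Variables (bar : J -> J) (Rc Rbc : J -> M) (dc : J -> R).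
Hypothesis hcs : forall b, conj_sol (irrC b) (irrC (bar b)) (Rc b) (Rbc b) (dc b).
Variables (o : J) (ho : irrC o = idfun).
Variables (N : J -> J -> J -> nat) (T : forall k m m', 'I_(N k m m') -> M).
Hypothesis hT : forall k m m',
  orthonormal_basis (hom_space (irrC k) (irrC m \o irrC m')) (@T k m m').
Implicit Types (b g k : J) (x y t : M) (sig : {lrmorphism M -> M}).

Lemma irrC_obj b : C (irrC b). Proof. by case: hirrC => h _ _; case: (h b). Qed.
Lemma irrC_simple b : simple_obj (irrC b).
Proof. by case: hirrC => h _ _; case: (h b). Qed.
Lemma irrC_star b : star_endo (irrC b).
Proof. exact: (fus_star hC (irrC_obj b)). Qed.
Lemma irrC_star2 b g : star_endo (irrC b \o irrC g).
Proof. by apply: star_endo_comp; exact: irrC_star. Qed.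

Definition rC b : rigid_simple M :=
  RigidSimple (irrC_star b) (irrC_star (bar b)) (hcs b) (@irrC_simple b).

Lemma rC_hom b x : Rc b * x = irrC (bar b) (irrC b x) * Rc b.
Proof. exact: (rs_hom (rC b)). Qed.
Lemma rC_homb b x : Rbc b * x = irrC b (irrC (bar b) x) * Rbc b.
Proof. exact: (rs_homb (rC b)). Qed.
Lemma rC_homS b x : (Rc b)^† * irrC (bar b) (irrC b x) = x * (Rc b)^†.
Proof. exact: (rs_homS (rC b)). Qed.
Lemma rC_hombS b x : (Rbc b)^† * irrC b (irrC (bar b) x) = x * (Rbc b)^†.
Proof. exact: (rs_hombS (rC b)). Qed.
Lemma rC_zag b : (Rc b)^† * irrC (bar b) (Rbc b) = 1.
Proof. exact: (rs_zag (rC b)). Qed.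
Lemma rC_zigS b : irrC b (Rc b)^† * Rbc b = 1.
Proof. exact: (rs_zigS (rC b)). Qed.
Lemma rC_zagS b : irrC (bar b) (Rbc b)^† * Rc b = 1.
Proof. exact: (rs_zagS (rC b)). Qed.
Lemma dc_gt0 b : 0 < dc b. Proof. exact: (rs_dim_gt0 (rC b)). Qed.
Lemma dc_neq0 b : (dc b)%:C != 0 :> R[i]. Proof. exact: (rs_dimC_neq0 (rC b)). Qed.

Lemma irrC_id x : irrC o x = x. Proof. by rewrite ho. Qed.

Lemma T_hom k m m' (i : 'I_(N k m m')) x :
  T i * irrC k x = irrC m (irrC m' x) * T i.
Proof. by case: (hT k m m') => h _ _; apply: h. Qed.

Lemma T_homS k m m' (i : 'I_(N k m m')) x :
  (T i)^† * irrC m (irrC m' x) = irrC k x * (T i)^†.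
Proof.
by apply: (hom_star _ (irrC_star2 m m') (@T_hom k m m' i)); exact: irrC_star.
Qed.

Lemma T_orth k m m' (i j : 'I_(N k m m')) : (T i)^† * T j = (i == j)%:R.
Proof. by case: (hT k m m') => _ h _; apply: h. Qed.

Lemma T_span k m m' x : hom_space (irrC k) (irrC m \o irrC m') x ->
  exists c : 'I_(N k m m') -> R[i], x = \sum_i scl (c i) * T i.
Proof.
case: (hT k m m') => _ _ h /h [c ->]; exists c; apply: eq_bigr => i _.
exact: sclZ.
Qed.

Lemma T_sum m m' : \sum_k \sum_(i < N k m m') T i * (T i)^† = 1.
Proof.
have Cmm : C (irrC m \o irrC m') by apply: (fus_comp hC); exact: irrC_obj.
rewrite -(@resolution_of_identity _ _ C hC J irrC _ (fun k => N k m m')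
  (fun k i => T i) (fun=> 1) hirrC Cmm).
- apply: eq_bigr => k _; apply: eq_bigr => i _.
  by rewrite invr1 rmorph1 mul1r.
- by move=> _; exact: oner_neq0.
- by move=> k i x; exact: T_hom.
- by move=> k i j; rewrite T_orth rmorph1 mulr1.
- by move=> k x; exact: T_span.
Qed.

(** If [b] and [b'] have the same conjugate, [t] intertwines them; bending [t] back returns
    [(Rc b)^†], so [t] is nonzero and Schur's lemma applies. *)
Lemma bar_inj : injective bar.
Proof.
move=> b b' e; have [_ inj _] := hirrC; apply: inj.
pose t := irrC b' (Rc b)^† * Rbc b'.
have ht : hom_space (irrC b) (irrC b') t.
  move=> x; rewrite /t -mulrA rC_homb mulrA -rmorphM -e rC_homS.
  by rewrite rmorphM !mulrA.
apply: (schur (irrC_star b) (irrC_star b') (@irrC_simple b) (@irrC_simple b') ht).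
move=> t0; have : (Rc b')^† * irrC (bar b') t = 0 by rewrite t0 rmorph0 mulr0.
rewrite /t rmorphM mulrA rC_homS -mulrA rC_zag mulr1 => R0.
have := rC_zag b; rewrite R0 mul0r => /esym/eqP; apply/negP; exact: oner_neq0.
Qed.

Lemma irrC_bar_representatives : irr_representatives C (irrC \o bar).
Proof.
have [h inj surj] := hirrC; split.
- by move=> b; exact: h.
- by move=> b b' /inj /bar_inj.
- move=> rho Crho srho; have [b hb] := surj _ Crho srho.
  by have [c _ cK] := injF_bij bar_inj; exists (c b); rewrite /= cK.
Qed.

Section Turns.
Variables (k g : J).

Definition ht b (i : 'I_(N k g b)) : M := half_turn (rC k) (rC g) (rC b) (T i).
Definition lt b (i : 'I_(N k g b)) : M := left_turn (rC g) (T i).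

Lemma htE b (i : 'I_(N k g b)) :
  irrC k (ht i) * Rbc k = (T i)^† * irrC g (Rbc b).
Proof.
by rewrite /ht /half_turn /= !rmorphM -!(ctx (rC_homb k _)) rC_zigS mul1r.
Qed.

Lemma ltE b (i : 'I_(N k g b)) : irrC g (lt i) * Rbc g = T i.
Proof.
by rewrite /lt /left_turn /= !rmorphM -(ctx (rC_homb g _)) rC_zigS mul1r.
Qed.

Let dratio b : ((dc k / dc b)%:C)^-1 = (dc b / dc k)%:C :> R[i].
Proof. by rewrite -fmorphV /= invf_div. Qed.

Let dratio0 b : (dc k / dc b)%:C != 0 :> R[i].
Proof. by rewrite fmorph_eq0 mulf_neq0 ?invr_eq0 // gt_eqF ?dc_gt0. Qed.

(** The adjoints of the [ht i] are orthogonal bases of Hom(bar b, bar k g) of square norm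
    [dc k / dc b]; the weights [dc b] are those of the resolution of the identity on [bar k g]. *)
Lemma ht_sum :
  \sum_b scl (dc b)%:C * (\sum_(i < N k g b) (ht i)^† * ht i) = scl (dc k)%:C.
Proof.
have Ckg : C (irrC (bar k) \o irrC g) by apply: (fus_comp hC); exact: irrC_obj.
have := @resolution_of_identity _ _ C hC J (irrC \o bar) _ (N k g)
  (fun b i => (ht i)^†) (fun b => (dc k / dc b)%:C) irrC_bar_representatives Ckg dratio0.
move=> res; rewrite -[RHS]mulr1 -res.
- rewrite mulr_sumr; apply: eq_bigr => b _; rewrite !mulr_sumr.
  apply: eq_bigr => i _; rewrite starK dratio [in RHS]mulrA -!rmorphM /=.
  by rewrite [dc k * _]mulrC divfK // gt_eqF ?dc_gt0.
- move=> b i; apply: (hom_star (irrC_star2 (bar k) g) (irrC_star (bar b))).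
  by apply: (half_turn_hom (kap := rC k) (gam := rC g) (bet := rC b)) => x; exact: T_hom.
- move=> b i j; rewrite starK.
  rewrite (half_turn_mulS (kap := rC k) (gam := rC g) (bet := rC b)); try exact: T_hom.
  by rewrite T_orth -!(rmorph_nat (@scl R M)) -!rmorphM mulrC.
- move=> b x hx.
  have hx' := hom_star (irrC_star (bar b)) (irrC_star2 (bar k) g) hx.
  have [t htt ex] := half_turn_surj (kap := rC k) (gam := rC g) (bet := rC b) hx'.
  have [a ea] := T_span htt; exists a.
  rewrite -[x]starK -ex ea /half_turn /= star_sum !rmorph_sum mulr_sumr mulr_suml.
  rewrite star_sum; apply: eq_bigr => i _ /=.
  rewrite /ht /half_turn /= (starM (scl _)) star_scl -sclC rmorphM /= endo_scl.
  by rewrite sclCA -mulrA starM star_scl conjCK -sclC.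
Qed.

Lemma lt_sum :
  \sum_b scl (dc b)%:C * (\sum_(i < N k g b) (lt i)^† * lt i) = scl (dc k)%:C.
Proof.
have Ckg : C (irrC (bar g) \o irrC k) by apply: (fus_comp hC); exact: irrC_obj.
have := @resolution_of_identity _ _ C hC J irrC _ (N k g)
  (fun b i => (lt i)^†) (fun b => (dc k / dc b)%:C) hirrC Ckg dratio0.
move=> res; rewrite -[RHS]mulr1 -res.
- rewrite mulr_sumr; apply: eq_bigr => b _; rewrite !mulr_sumr.
  apply: eq_bigr => i _; rewrite starK dratio [in RHS]mulrA -!rmorphM /=.
  by rewrite [dc k * _]mulrC divfK // gt_eqF ?dc_gt0.
- move=> b i; apply: (hom_star (irrC_star2 (bar g) k) (irrC_star b)).
  by apply: (left_turn_hom (kap := rC k) (gam := rC g) (bet := rC b)) => x; exact: T_hom.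
- move=> b i j; rewrite starK.
  rewrite (left_turn_mulS (kap := rC k) (gam := rC g) (bet := rC b)); try exact: T_hom.
  by rewrite T_orth -!(rmorph_nat (@scl R M)) -!rmorphM mulrC eq_sym.
- move=> b x hx.
  have hx' := hom_star (irrC_star b) (irrC_star2 (bar g) k) hx.
  have [t htt ex] := left_turn_surj (kap := rC k) (gam := rC g) (bet := rC b) hx'.
  have [a ea] := T_span htt; exists (fun i => Num.conj (a i)).
  rewrite -[x]starK -ex ea /left_turn /= !rmorph_sum mulr_sumr.
  rewrite star_sum; apply: eq_bigr => i _ /=.
  by rewrite /lt /left_turn /= rmorphM /= endo_scl sclCA starM star_scl -sclC.
Qed.

End Turns.

Section OneBraiding.
Variables (sig : {lrmorphism M -> M}) (E : J -> M).
Hypotheses (hsig : star_endo sig) (hE : half_braiding irrC sig E).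

Lemma hb_hom_eq b x : E b * sig (irrC b x) = irrC b (sig x) * E b.
Proof. by case: hE => h _; have [_ hb] := h b; apply: hb. Qed.

Lemma hb_unitary b : (E b)^† * E b = 1.
Proof. by case: hE => h _; have [[]] := h b. Qed.

Lemma hb_unitaryS b : E b * (E b)^† = 1.
Proof. by case: hE => h _; have [[]] := h b. Qed.

Lemma hb_nat b1 b2 b3 x : hom_space (irrC b3) (irrC b1 \o irrC b2) x ->
  x * E b3 = irrC b1 (E b2) * E b1 * sig x.
Proof. by case: hE => _; apply. Qed.

Lemma hb_natS b1 b2 b3 x : hom_space (irrC b3) (irrC b1 \o irrC b2) x ->
  x^† * irrC b1 (E b2) * E b1 = E b3 * sig x^†.
Proof.
move=> hx; have e := congr1 (fun y => y^†) (hb_nat hx).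
rewrite !starM -irrC_star -hsig in e.
have : E b3 * (E b3)^† * x^† * irrC b1 (E b2) * E b1 = E b3 * sig x^†.
  rewrite -(mulrA (E b3)) e !mulrA (ctxc1 (irrC b1) (hb_unitary b2)) rmorph1.
  by rewrite mulr1 -mulrA hb_unitary mulr1.
by rewrite hb_unitaryS mul1r.
Qed.

Lemma hb_natC b1 b2 b3 x : hom_space (irrC b3) (irrC b1 \o irrC b2) x ->
  irrC b1 (E b2)^† * x = E b1 * sig x * (E b3)^†.
Proof.
move=> hx; rewrite -[LHS]mulr1 -(hb_unitaryS b3) mulrA -(mulrA _ x) (hb_nat hx).
by rewrite !mulrA -rmorphM hb_unitary rmorph1 mul1r.
Qed.

Lemma hb_unit : E o = 1.
Proof.
have h : hom_space (irrC o) (irrC o \o irrC o) 1.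
  by move=> x /=; rewrite mul1r mulr1 !irrC_id.
have := hb_nat h; rewrite irrC_id mul1r rmorph1 mulr1 => e.
by rewrite -[LHS]mul1r -(hb_unitary o) -mulrA -e hb_unitary.
Qed.

(** Naturality for [Rc b], a map from the unit to [bar b . b], together with [E o = 1]. This is what
    later makes the involution send [e] to [e] with exchanged indices. *)
Lemma hb_bar b : E (bar b)
  = irrC (bar b) (sig (Rbc b)^† * (E b)^†) * Rc b.
Proof.
have h : hom_space (irrC o) (irrC (bar b) \o irrC b) (Rc b).
  by move=> x /=; rewrite irrC_id rC_hom.
have := hb_natC h; rewrite hb_unit star1 mulr1 => e.
rewrite rmorphM -mulrA e mulrA -hb_hom_eq -mulrA -rmorphM.
by rewrite rC_zagS rmorph1 mulr1.
Qed.

End OneBraiding.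

Section FusionSums.
Variables (sig sig' : {lrmorphism M -> M}).

(* Frobenius reciprocity turns a sum over intertwiners [T] into a resolution
   of the identity on [bar g . k]. *)
Lemma left_turn_fusion k g q :
  (forall x, q * sig (irrC g x) = sig' (irrC g x) * q) ->
  \sum_b scl (dc b)%:C * (\sum_(i < N k g b) sig' (T i)^† * q * sig (T i))
  = scl (dc k)%:C * (sig' (Rbc g)^† * q * sig (Rbc g)).
Proof.
move=> hq.
have e b (i : 'I_(N k g b)) : sig' (T i)^† * q * sig (T i) =
    sig' (Rbc g)^† * q * sig (irrC g ((lt i)^† * lt i)) * sig (Rbc g).
  rewrite -{1 2}(ltE i) starM -irrC_star !rmorphM /= !mulrA.
  by rewrite (ctx (esym (hq _))).
transitivity (sig' (Rbc g)^† * q *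
    sig (irrC g (\sum_b scl (dc b)%:C * (\sum_(i < N k g b) (lt i)^† * lt i)))
    * sig (Rbc g)); last by rewrite lt_sum !endo_scl -sclC !mulrA.
rewrite !rmorph_sum mulr_sumr mulr_suml; apply: eq_bigr => b _ /=.
rewrite (eq_bigr _ (fun i _ => e b i)) -mulr_suml -mulr_sumr -!rmorph_sum /=.
by rewrite !rmorphM /= !endo_scl sclCA !mulrA.
Qed.

(** By [htE] the bent vector [T^† g(Rbc b)] is [k(ht) Rbc k], so the sum over [b] contains the
    resolution [ht_sum] and its value no longer involves [g]. *)
Lemma half_turn_fusion k g q :
  (forall x, q * sig (irrC k x) = sig' (irrC k x) * q) ->
  \sum_b scl (dc b)%:C * (\sum_(i < N k g b)
    sig' ((T i)^† * irrC g (Rbc b))^† * q * sig ((T i)^† * irrC g (Rbc b)))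
  = scl (dc k)%:C * (sig' (Rbc k)^† * q * sig (Rbc k)).
Proof.
move=> hq.
have e b (i : 'I_(N k g b)) : sig' ((T i)^† * irrC g (Rbc b))^† * q *
    sig ((T i)^† * irrC g (Rbc b)) =
    sig' (Rbc k)^† * q * sig (irrC k ((ht i)^† * ht i)) * sig (Rbc k).
  rewrite -!(htE i) starM -irrC_star !rmorphM /= !mulrA.
  by rewrite (ctx (esym (hq _))).
transitivity (sig' (Rbc k)^† * q *
    sig (irrC k (\sum_b scl (dc b)%:C * (\sum_(i < N k g b) (ht i)^† * ht i)))
    * sig (Rbc k)); last by rewrite ht_sum !endo_scl -sclC !mulrA.
rewrite !rmorph_sum mulr_sumr mulr_suml; apply: eq_bigr => b _ /=.
rewrite (eq_bigr _ (fun i _ => e b i)) -mulr_suml -mulr_sumr -!rmorph_sum /=.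
by rewrite !rmorphM /= !endo_scl sclCA !mulrA.
Qed.

End FusionSums.

Section Averaging.
Variables (sig sig' : {lrmorphism M -> M}) (E E' : J -> M).
Hypotheses (hsig : star_endo sig) (hE : half_braiding irrC sig E).
Hypotheses (hsig' : star_endo sig') (hE' : half_braiding irrC sig' E').

(* Up to the factor [global_dim irrC], the conditional expectation of
   [Hom(sig, sig')] onto the morphisms of half-braidings. *)
Definition average (Q : M) : M :=
  \sum_b scl (dc b)%:C *
    (sig' (Rbc b)^† * ((E' b)^† * irrC b Q * E b) * sig (Rbc b)).

Lemma averageD x y : average (x + y) = average x + average y.
Proof.
rewrite /average -big_split; apply: eq_bigr => b _ /=.
by rewrite rmorphD mulrDr mulrDl mulrDr mulrDl mulrDr.
Qed.

Lemma average_scl (a : R[i]) x : average (scl a * x) = scl a * average x.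
Proof.
rewrite /average mulr_sumr; apply: eq_bigr => b _ /=.
by rewrite rmorphM /= endo_scl !((sclCA a), (esym (mulrA (scl a) _ _))).
Qed.

Variable Q : M.
Hypothesis hQ : hom_space sig sig' Q.

Let hE'S b x : (E' b)^† * irrC b (sig' x) = sig' (irrC b x) * (E' b)^†.
Proof.
apply: (@hom_star _ _ (sig' \o irrC b) (irrC b \o sig')).
- by apply: star_endo_comp => //; exact: irrC_star.
- by apply: star_endo_comp => //; exact: irrC_star.
- by move=> y /=; exact: hb_hom_eq.
Qed.

Lemma conj_hb_hom b x : (E' b)^† * irrC b Q * E b * sig (irrC b x)
  = sig' (irrC b x) * ((E' b)^† * irrC b Q * E b).
Proof.
rewrite -mulrA (hb_hom_eq hE) mulrA -(mulrA _ (irrC b Q)) -rmorphM hQ.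
by rewrite rmorphM !mulrA hE'S.
Qed.

Lemma average_hom : hom_space sig sig' (average Q).
Proof.
move=> x; rewrite /average mulr_suml mulr_sumr; apply: eq_bigr => b _.
rewrite sclCA -mulrA; congr (_ * _); have hq := @conj_hb_hom b.
move: (_ * E b) hq => q hq.
rewrite -mulrA -rmorphM rC_homb rmorphM mulrA -(mulrA _ q) hq.
by rewrite mulrA -rmorphM rC_hombS rmorphM !mulrA.
Qed.

(** Insert [T_sum g b] and slide each [T i] through both braidings: conjugating by [E b] and then by
    [E g] amounts to conjugating by [E k] in every channel [k] of [g b]. *)
Lemma conj_hb_comp g b : irrC g ((E' b)^† * irrC b Q * E b) * E g
  = E' g * \sum_k \sum_(i < N k g b)
      sig' (T i) * ((E' k)^† * irrC k Q * E k) * sig (T i)^†.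
Proof.
rewrite -[LHS]mulr1 -(rmorph1 sig) -(T_sum g b) !rmorph_sum !mulr_sumr /=.
apply: eq_bigr => k _; rewrite rmorph_sum !mulr_sumr /=; apply: eq_bigr => i _.
rewrite !rmorphM !mulrA /=.
have e1 : irrC g (E b) * E g * sig (T i) = T i * E k.
  by rewrite (hb_nat hE (@T_hom k g b i)).
have e2 := hb_natC hE' (@T_hom k g b i).
transitivity (irrC g (E' b)^† * irrC g (irrC b Q) * (irrC g (E b) * E g * sig (T i))
  * sig (T i)^†); first by rewrite !mulrA.
rewrite e1 !mulrA -(mulrA _ _ (T i)) -(T_hom i) mulrA e2.
by [].
Qed.

(** Moving [E g] through the average spreads the term of [b] over the channels [k] of [g b]. After
    exchanging the sums, [half_turn_fusion] collapses the sum over [b] and leaves the term of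
    [k]. *)
Lemma average_natural g : E' g * average Q = irrC g (average Q) * E g.
Proof.
have e b : irrC g (sig' (Rbc b)^† * ((E' b)^† * irrC b Q * E b) * sig (Rbc b)) * E g
    = E' g * \sum_k \sum_(i < N k g b)
        sig' ((T i)^† * irrC g (Rbc b))^† * ((E' k)^† * irrC k Q * E k)
        * sig ((T i)^† * irrC g (Rbc b)).
  transitivity (E' g * sig' (irrC g (Rbc b))^† * (\sum_k \sum_(i < N k g b)
      sig' (T i) * ((E' k)^† * irrC k Q * E k) * sig (T i)^†) * sig (irrC g (Rbc b))).
    rewrite -irrC_star (hb_hom_eq hE') -(mulrA _ (E' g)) -conj_hb_comp.
    move: (_ * E b) => W; rewrite 2!(rmorphM (irrC g)) /= -!mulrA.
    by rewrite (hb_hom_eq hE).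
  rewrite -!mulrA; congr (_ * _).
  rewrite !(mulr_sumr, mulr_suml); apply: eq_bigr => k _.
  rewrite !(mulr_sumr, mulr_suml); apply: eq_bigr => i _.
  by rewrite starM starK !rmorphM !mulrA.
transitivity (E' g * \sum_k scl (dc k)%:C *
    (sig' (Rbc k)^† * ((E' k)^† * irrC k Q * E k) * sig (Rbc k))); first by [].
transitivity (\sum_b scl (dc b)%:C * (irrC g (sig' (Rbc b)^† *
    ((E' b)^† * irrC b Q * E b) * sig (Rbc b)) * E g)); last first.
  rewrite /average rmorph_sum mulr_suml; apply: eq_bigr => b _.
  by rewrite [in RHS]rmorphM /= endo_scl mulrA.
rewrite (eq_bigr _ (fun b _ => congr1 (fun z => scl (dc b)%:C * z) (e b))).
have -> : \sum_b scl (dc b)%:C * (E' g * \sum_k \sum_(i < N k g b)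
      sig' ((T i)^† * irrC g (Rbc b))^† * ((E' k)^† * irrC k Q * E k)
      * sig ((T i)^† * irrC g (Rbc b)))
    = E' g * \sum_k \sum_b scl (dc b)%:C * \sum_(i < N k g b)
      (sig' ((T i)^† * irrC g (Rbc b))^† * ((E' k)^† * irrC k Q * E k)
      * sig ((T i)^† * irrC g (Rbc b))).
  rewrite exchange_big mulr_sumr; apply: eq_bigr => b _ /=.
  by rewrite -sclCA mulr_sumr.
congr (_ * _); apply: eq_bigr => k _; rewrite half_turn_fusion //.
exact: conj_hb_hom.
Qed.

End Averaging.

(** * Schur's lemma and the value of the average *)

Section RelativeCommutant.
Variables (hfactor : is_factor M).
Variables (D : set {lrmorphism M -> M}) (hD : unitary_fusion D) (hCD : C `<=` D).

Local Notation E := hb_br.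
Local Notation sg := hb_endo.
Implicit Types Z : hb_obj M J.

Lemma dc_dimension b : dimension (irrC b) = dc b.
Proof.
exact: (@dimension_rigid _ _ C hC (rC b) (irrC_obj b) (irrC_obj (bar b))).
Qed.

Lemma dc_bar b : dc (bar b) = dc b.
Proof.
rewrite -dc_dimension.
exact: (@dimension_rigid _ _ C hC (rs_sym (rC b)) (irrC_obj (bar b)) (irrC_obj b)).
Qed.

Lemma dcR_neq0 b : dc b != 0. Proof. by rewrite gt_eqF // dc_gt0. Qed.

Lemma dc_ge0 b : 0 <= dc b. Proof. exact/ltW/dc_gt0. Qed.

Lemma hb_hom_star Z Z' x : drinfeld_commutant D irrC Z ->
  drinfeld_commutant D irrC Z' -> hb_hom irrC Z Z' x -> hb_hom irrC Z' Z x^†.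
Proof.
move=> [DZ hZ] [DZ' hZ'] [hx hxb]; split.
  by apply: hom_star hx; exact: (fus_star hD).
move=> b; have e : x * (E Z b)^† = (E Z' b)^† * irrC b x.
  rewrite -[LHS]mul1r -(hb_unitary hZ' b) mulrA -(mulrA _ _ x) hxb mulrA.
  by rewrite -mulrA (hb_unitaryS hZ) mulr1.
by apply: star_inj; rewrite !starM -irrC_star !starK e.
Qed.

Lemma hb_homM Z1 Z2 Z3 x y : hb_hom irrC Z2 Z3 x -> hb_hom irrC Z1 Z2 y ->
  hb_hom irrC Z1 Z3 (x * y).
Proof.
move=> [hx hxb] [hy hyb]; split; first exact: homM hx hy.
by move=> b; rewrite mulrA hxb -mulrA hyb mulrA rmorphM.
Qed.

Lemma hb_schur Z Z' x : drinfeld_commutant D irrC Z ->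
  drinfeld_commutant D irrC Z' -> hb_simple irrC Z -> hb_simple irrC Z' ->
  hb_hom irrC Z Z' x -> x <> 0 -> hb_equivalent irrC Z Z'.
Proof.
move=> cZ cZ' sZ sZ' hx x0.
have hx' := hb_hom_star cZ cZ' hx.
have [a ha] := sZ _ (hb_homM hx' hx).
have [b hb] := sZ' _ (hb_homM hx hx').
rewrite sclE in ha; rewrite sclE in hb.
have [u [c [eu uu]]] := scaled_unitary ha hb x0.
exists u => //; rewrite eu; case: hx => hx hxb; split; first exact: homZ.
by move=> g; rewrite sclCA hxb rmorphM /= endo_scl mulrA.
Qed.

Lemma average_hb_hom Z Z' Q : drinfeld_commutant D irrC Z ->
  drinfeld_commutant D irrC Z' -> hom_space (sg Z) (sg Z') Q ->
  hb_hom irrC Z Z' (average (sg Z) (sg Z') (E Z) (E Z') Q).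
Proof.
move=> [DZ hZ] [DZ' hZ'] hQ.
have h1 := fus_star hD DZ; have h2 := fus_star hD DZ'.
by split=> [|b]; [exact: average_hom|exact: average_natural].
Qed.

(* By Schur the average is a scalar; its value is found by taking categorical
   traces over [Z] and exchanging them with [trace_exchange]. *)
Lemma average_simple Z (mu : rigid_simple M) v w :
  drinfeld_commutant D irrC Z -> hb_simple irrC Z -> D mu ->
  hom_space mu (sg Z) v -> hom_space mu (sg Z) w ->
  average (sg Z) (sg Z) (E Z) (E Z) (v * w^†)
  = scl (global_dim irrC * rs_dim mu / dimension (sg Z))%:C * (w^† * v).
Proof.
move=> cZ sZ Dmu; have [DZ hZ] := cZ; have hs := fus_star hD DZ.
have hom_vv x y : hom_space mu (sg Z) x -> hom_space mu (sg Z) y ->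
    hom_space (sg Z) (sg Z) (x * y^†).
  by move=> hx hy; apply: homM hx _; apply: hom_star hy => //; exact: rs_star.
apply: polarization => [x y|a x|{v w} w hw]; [exact: averageD|exact: average_scl|].
have [s hs'] := sZ _ (average_hb_hom cZ cZ (hom_vv _ _ hw hw)).
rewrite sclE in hs'; rewrite hs'.
have [c hc] : exists a : R[i], w^† * w = scl a.
  apply: (rs_simple (r := mu)) => x; rewrite -mulrA hw mulrA.
  by rewrite (hom_star (@rs_star _ _ mu) hs hw) mulrA.
have [n [f [V [hf hV Viso Vsum]]]] := rigid_decomposition hfactor hD DZ.
have dsum := dimension_decomposition hD DZ (fun p => (hf p).2) hV Viso Vsum.
have hVS p x : (V p)^† * sg Z x = f p x * (V p)^†.
  by apply: (hom_star (@rs_star _ _ (f p)) hs (hV p)).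
(* Compressions of [E b] to a simple summand [f p] on one side and to [mu] on the other. They are
   intertwiners between products of simple objects, as [trace_exchange] wants, and unitarity of
   [E b] gives [\sum_p Y Y^† = b(w^† w)]. *)
pose Y b p := irrC b w^† * E Z b * V p.
have hws x : w^† * sg Z x = mu x * w^†.
  exact: (hom_star (@rs_star _ _ mu) hs hw).
have hY b p : hom_space (f p \o rC b) (rC b \o mu) (Y b p).
  move=> x; rewrite /Y /= (ctx (hV p _)) (ctx (hb_hom_eq hZ b _)).
  by rewrite (whisk (irrC b) (hws x)) !mulrA.
have key : scl (s * (dimension (sg Z))%:C)
    = scl ((global_dim irrC * rs_dim mu)%:C * c) :> M.
  transitivity (\sum_p scl (rs_dim (f p))%:C * ((V p)^† *
      average (sg Z) (sg Z) (E Z) (E Z) (w * w^†) * V p)).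
    rewrite dsum hs' !(rmorph_sum, mulr_sumr) /=; apply: eq_bigr => p _.
    by rewrite -sclC -mulrA Viso mulr1 -rmorphM mulrC.
  transitivity (\sum_b scl (dc b)%:C * \sum_p scl (rs_dim (f p))%:C *
      (f p (Rbc b)^† * (Y b p)^† * Y b p * f p (Rbc b))).
    transitivity (\sum_p \sum_b scl (dc b)%:C * (scl (rs_dim (f p))%:C *
      (f p (Rbc b)^† * (Y b p)^† * Y b p * f p (Rbc b)))).
      apply: eq_bigr => p _; rewrite /average mulr_sumr mulr_suml mulr_sumr.
      apply: eq_bigr => b _; rewrite (sclCA _ (V p)^†) -(mulrA (scl _)) [LHS]sclCA.
      congr (_ * (_ * _)).
      rewrite /Y !starM -irrC_star starK rmorphM !mulrA.
      by rewrite -(hVS p) -!mulrA -(hV p) !mulrA.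
    by rewrite exchange_big; apply: eq_bigr => b _; rewrite mulr_sumr.
  have e b : \sum_p scl (rs_dim (f p))%:C *
      (f p (Rbc b)^† * (Y b p)^† * Y b p * f p (Rbc b))
      = scl (rs_dim mu)%:C * (scl (dc b)%:C * scl c).
    transitivity (\sum_p scl (rs_dim mu)%:C * ((Rc b)^† *
        irrC (bar b) (Y b p * (Y b p)^†) * Rc b)).
      apply: eq_bigr => p _.
      apply: (@trace_exchange _ _ hfactor D hD (f p) (rC b) mu (Y b p)) (hY b p).
      apply: (fus_comp hD); [exact: (hf p).1|exact/hCD/irrC_obj].
    rewrite -mulr_sumr -mulr_suml -mulr_sumr -rmorph_sum; congr (_ * _).
    have -> : \sum_p Y b p * (Y b p)^† = irrC b (scl c).
      transitivity (irrC b w^† * E Z b * (\sum_p V p * (V p)^†) * (E Z b)^† * irrC b w).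
        rewrite mulr_sumr !mulr_suml; apply: eq_bigr => p _.
        by rewrite /Y !starM -irrC_star starK !mulrA.
      rewrite Vsum mulr1 -(mulrA _ (E Z b)) (hb_unitaryS hZ) mulr1 -rmorphM.
      by rewrite hc.
    by rewrite /= !endo_scl sclAC -mulrA (rs_norm (rC b)) sclC.
  rewrite (eq_bigr _ (fun b _ => congr1 (fun z => scl (dc b)%:C * z) (e b))).
  have -> : global_dim irrC = \sum_b dc b ^+ 2.
    by apply: eq_bigr => b _; rewrite dc_dimension.
  rewrite !rmorphM !rmorph_sum /= !mulr_suml; apply: eq_bigr => b _ /=.
  by rewrite -!(rmorphM (@scl R M)) rmorphXn /=; congr scl; ring.
rewrite hc -rmorphM; congr scl.
have d0 : (dimension (sg Z))%:C != 0 :> R[i].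
  by rewrite fmorph_eq0 gt_eqF // (lt_le_trans ltr01) // (dimension_ge1 hfactor hD).
apply: (mulIf d0); rewrite (scl_inj key) mulrAC -rmorphM /= divfK //.
by move: d0; rewrite fmorph_eq0.
Qed.

(** * Semisimplicity of the relative commutant *)

(** As [p] is a morphism, [E b] carries the range of [p] onto that of [b(p)], so the compressed
    braiding stays unitary. *)
Lemma hb_subobject Z p : drinfeld_commutant D irrC Z -> hb_hom irrC Z Z p ->
  projection p -> p != 0 ->
  exists Z1 v, [/\ drinfeld_commutant D irrC Z1, hb_hom irrC Z1 Z v,
    v^† * v = 1 & v * v^† = p].
Proof.
move=> [DZ hZ] [hp hpb] pp p0.
have [tau [v [Dtau hv vv vp]]] := fus_subobject hD DZ hp pp p0.
rewrite /isometry_elt in vv.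
have h1 := fus_star hD DZ; have h2 := fus_star hD Dtau.
have hvS : hom_space (sg Z) tau v^† by exact: hom_star hv.
pose E1 b := irrC b v^† * E Z b * v.
have pv : p * v = v by rewrite -vp -mulrA vv mulr1.
have hv1 b : E Z b * v = irrC b v * E1 b.
  by rewrite /E1 !mulrA -rmorphM vp -hpb -mulrA pv.
have Epp b : (E Z b)^† * irrC b p * E Z b = p.
  by rewrite -mulrA -hpb mulrA (hb_unitary hZ) mul1r.
exists (HbObj tau E1), v; split; [|exact: (conj hv hv1)|exact: vv|exact: vp].
split=> //; split=> [b|b1 b2 b3 x hx] /=.
  split.
    split; rewrite /E1 !starM -irrC_star starK !mulrA.
      rewrite -(mulrA _ (irrC b v)) -rmorphM vp /= -!(mulrA v^†) Epp pv.
      exact: vv.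
    rewrite -(mulrA _ v) vp -(mulrA _ (E Z b)) hpb mulrA -(mulrA _ _ (E Z b)^†).
    rewrite (hb_unitaryS hZ) mulr1 -vp rmorphM !mulrA -rmorphM vv rmorph1 mul1r.
    by rewrite -rmorphM vv rmorph1.
  move=> x /=; rewrite /E1 -mulrA hv !mulrA -(mulrA _ (E Z b)) (hb_hom_eq hZ) mulrA.
  by rewrite (whisk (irrC b) (hvS x)).
transitivity (irrC b1 (irrC b2 v^†) * irrC b1 (E Z b2) * (E Z b1 * v) * tau x).
  rewrite /E1 !mulrA (hx _) /= -(mulrA _ x) (hb_nat hZ hx) !mulrA.
  by rewrite -(mulrA _ (sg Z x)) -hv !mulrA.
have e2 : irrC b1 (E1 b2) = irrC b1 (irrC b2 v^†) * irrC b1 (E Z b2) * irrC b1 v.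
  by rewrite /E1 !rmorphM.
by rewrite e2 hv1 !mulrA.
Qed.

Lemma simple_hom_line (f g : {lrmorphism M -> M}) : star_endo f -> star_endo g ->
  simple_obj g -> simple_obj f ->
  exists t, forall x, hom_space f g x -> exists a : R[i], x = scl a * t.
Proof.
move=> hf hg sg' sf.
have [[t [ht t0]]|h] := pselect (exists t, hom_space f g t /\ t <> 0); last first.
  exists 0 => x hx; exists 0; rewrite mulr0; apply: contrapT => x0.
  by apply: h; exists x.
exists t => x hx; have htS := hom_star hf hg ht.
have [a ha] := sg' _ (homM hx htS); have [c hc] := sf _ (homM htS ht).
rewrite sclE in ha; rewrite sclE in hc.
have c0 : c != 0.
  by apply/eqP => c0; apply: t0; apply: star_eq0; rewrite hc c0 rmorph0.
exists (c^-1 * a).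
by rewrite rmorphM /= -mulrA -ha -(mulrA x) hc -sclC sclK.
Qed.

Lemma end_finite_dim rho : D rho -> exists (Q : finType) (u : Q -> M),
  forall x, hom_space rho rho x -> exists a : Q -> R[i], x = \sum_q scl (a q) * u q.
Proof.
move=> Drho; have [n [f [w [hf hw wiso wsum]]]] := rigid_decomposition hfactor hD Drho.
have h1 := fus_star hD Drho.
have hwS p : hom_space rho (f p) (w p)^† by exact: (hom_star (@rs_star _ _ (f p)) h1 (hw p)).
have hline (pq : 'I_n * 'I_n) := @simple_hom_line (f pq.2) (f pq.1) (@rs_star _ _ _)
  (@rs_star _ _ _) (@rs_simple _ _ _) (@rs_simple _ _ _).
have [t ht] := choice hline.
exists ('I_n * 'I_n)%type, (fun pq => w pq.1 * t pq * (w pq.2)^†) => x hx.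
have [a ha] := choice (fun pq : 'I_n * 'I_n => ht pq _ (homM (hwS pq.1) (homM hx (hw pq.2)))).
exists a; rewrite -[LHS]mul1r -[LHS]mulr1 -{1}wsum -wsum.
transitivity (\sum_p \sum_q scl (a (p, q)) * (w p * t (p, q) * (w q)^†)); last first.
  by rewrite pair_bigA; apply: eq_bigr => -[p q].
rewrite !mulr_suml; apply: eq_bigr => p _; rewrite mulr_sumr; apply: eq_bigr => q _.
transitivity (w p * ((w p)^† * (x * w q)) * (w q)^†); first by rewrite !mulrA.
by rewrite (ha (p, q)) /= sclCA -mulrA.
Qed.

(** * Polynomials in one endomorphism *)

Section PolynomialCalculus.
Variable h : M.

Fact scl_comm_rmorph : commr_rmorph (@scl R M) h.
Proof. by move=> a; rewrite /GRing.comm sclC. Qed.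

Local Notation ev := (horner_morph scl_comm_rmorph).

Lemma ev_X : ev 'X = h. Proof. by rewrite /= horner_morphX. Qed.
(** Keeps polynomials in [h] inside the algebra [S], which will be the endomorphisms of a
    half-braiding. *)
Lemma ev_closed (S : M -> Prop) : S 1 -> (forall a x y, S x -> S y -> S (scl a * x + y)) ->
  (forall x y, S x -> S y -> S (x * y)) -> S h -> forall F, S (ev F).
Proof.
move=> S1 Slin SM Sh F; have S0 : S 0.
  by have := Slin (-1) 1 1 S1 S1; rewrite rmorphN1 mulN1r addNr.
elim/poly_ind: F => [|F c IH]; first by rewrite rmorph0.
rewrite rmorphD rmorphM /= horner_morphX horner_morphC /= addrC -[scl c]mulr1.
by apply: Slin => //; exact: SM.
Qed.

Lemma ev_annihilated y F : h * y = 0 -> ev F * y = scl F`_0 * y.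
Proof.
move=> hy; elim/poly_ind: F => [|F c IH]; first by rewrite rmorph0 coef0 rmorph0.
rewrite rmorphD rmorphM /= horner_morphX horner_morphC /= mulrDl -mulrA hy mulr0 add0r.
by rewrite coefD coefMX coefC /= add0r.
Qed.

Variables (Q : finType) (u : Q -> M) (S : M -> Prop).
Hypotheses (S1 : S 1) (Slin : forall a x y, S x -> S y -> S (scl a * x + y))
  (SM : forall x y, S x -> S y -> S (x * y)) (Sh : S h)
  (Su : forall x, S x -> exists a : Q -> R[i], x = \sum_q scl (a q) * u q).

Lemma annihilating_poly : exists F : {poly R[i]}, F != 0 /\ ev F = 0.
Proof.
pose n := #|Q|.
have hpow i : exists a : Q -> R[i], h ^+ i = \sum_q scl (a q) * u q.
  by apply: Su; have := ev_closed S1 Slin SM Sh 'X^i; rewrite rmorphXn /= horner_morphX.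
have [a ha] := choice hpow.
(* The powers of [h] up to [n] give [n + 1] coordinate rows of length [n]; a nonzero vector of the
   left kernel lists the coefficients of the polynomial. *)
pose A : 'M[R[i]]_(n.+1, n) := \matrix_(i, q) a i (enum_val q).
have : kermx A != 0.
  rewrite kermx_eq0 /row_free; apply/eqP => e.
  by have := rank_leq_col A; rewrite e ltnn.
case/rowV0Pn => v /sub_kermxP vA v0.
exists (\poly_(i < n.+1) v 0 (inord i)); split.
  apply: contra v0 => /eqP e; apply/eqP/rowP => i; rewrite mxE.
  have := congr1 (fun p : {poly R[i]} => p`_i) e.
  by rewrite coef_poly ltn_ord inord_val coef0.
rewrite poly_def rmorph_sum /=.
transitivity (\sum_(i < n.+1) \sum_q scl (v 0 i * a i q) * u q).
  apply: eq_bigr => i _; rewrite -mul_polyC rmorphM rmorphXn /= horner_morphX.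
  rewrite horner_morphC /= ha mulr_sumr inord_val.
  by apply: eq_bigr => q _; rewrite mulrA -rmorphM.
rewrite exchange_big big1 // => q _ /=; rewrite -mulr_suml -rmorph_sum /=.
have -> : \sum_(i < n.+1) v 0 i * a i q = (v *m A) 0 (enum_rank q).
  by rewrite mxE; apply: eq_bigr => i _; rewrite mxE enum_rankK.
by rewrite vA mxE rmorph0 mul0r.
Qed.

Lemma minimal_annihilating_poly : exists F : {poly R[i]},
  [/\ F != 0, ev F = 0 & forall G : {poly R[i]}, G != 0 -> (size G < size F)%N -> ev G <> 0].
Proof.
have [F0 [F00 eF0]] := annihilating_poly.
pose P n := `[< exists F : {poly R[i]}, [/\ F != 0, ev F = 0 & size F = n] >].
have ex : exists n, P n by exists (size F0); apply/asboolP; exists F0.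
case: (ex_minnP ex) => m /asboolP[F [Fn0 eF <-]] hmin; exists F; split=> // G G0 sG eG.
have : P (size G) by apply/asboolP; exists G.
by move/hmin; rewrite leqNgt sG.
Qed.

(** The field is algebraically closed, so the minimal polynomial is [G * (X - c)]; by minimality
    [G(h)] is nonzero, and [h - c] kills it. *)
Lemma eigenvector : exists c y, [/\ S y, y <> 0 & (h - scl c) * y = 0].
Proof.
have [F [F0 eF Fmin]] := minimal_annihilating_poly.
have sF : size F != 1%N.
  apply/negP => /size_poly1P[c c0 eFc]; move: eF; rewrite eFc horner_morphC.
  by move=> /eqP; rewrite fmorph_eq0 (negPf c0).
have /closed_rootP[c rc] := sF.
move: rc => /factor_theorem[G eG]; exists c, (ev G).
have G0 : G != 0 by apply: contra F0 => /eqP G0; rewrite eG G0 mul0r.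
split; first exact: ev_closed.
- apply: Fmin => //; rewrite eG size_Mmonic ?monicXsubC // size_XsubC addn2 /=.
  by [].
- move: eF; rewrite eG mulrC rmorphM rmorphB /= horner_morphX horner_morphC.
  by [].
Qed.

(* If [F] is the minimal polynomial of the self-adjoint [h] and [F = G X], then
   [G(h) / G(0)] is the projection onto the kernel of [h]. *)
Lemma null_projection y : h^† = h -> h * y = 0 -> y <> 0 -> h <> 0 ->
  exists e, [/\ S e, projection e, e <> 0 & e <> 1].
Proof.
move=> hs hy y0 h0.
have [F [F0 eF Fmin]] := minimal_annihilating_poly.
have F00 : F`_0 = 0.
  have := ev_annihilated F hy; rewrite eF mul0r => /esym e.
  by apply: contra_notP y0 => /eqP; exact: scl_eq0.
have [G eG] : exists G, F = G * ('X - 0%:P).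
  by apply/factor_theorem; rewrite /root horner_coef0 F00.
rewrite subr0 in eG.
have G0 : G != 0 by apply: contra F0 => /eqP G0; rewrite eG G0 mul0r.
have sGF : (size G < size F)%N by rewrite eG size_mulX // ltnSn.
have G1 := Fmin _ G0 sGF.
have hG : h * ev G = 0.
  by move: eF; rewrite eG mulrC rmorphM /= horner_morphX.
(* Self-adjointness excludes a double root at 0: if [G = G' X], then [G(h) = h G'(h)] has square
   [G'(h)^† h G(h) = 0]. *)
have g0 : G`_0 != 0.
  apply/eqP => g0; have [G' eG'] : exists G', G = G' * ('X - 0%:P).
    by apply/factor_theorem; rewrite /root horner_coef0 g0.
  rewrite subr0 in eG'; apply: G1.
  have eh : ev G = h * ev G' by rewrite eG' mulrC rmorphM /= horner_morphX.
  rewrite eh; apply: star_eq0; rewrite starM hs -mulrA -eh.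
  by rewrite hG mulr0.
pose e := scl (G`_0)^-1 * ev G.
have he : h * e = 0 by rewrite /e sclCA hG mulr0.
have ee w : h * w = 0 -> e * w = w.
  by move=> hw; rewrite /e -mulrA ev_annihilated // sclK.
have eh : e * h = 0.
  by rewrite /e -mulrA; have -> : ev G * h = h * ev G;
    [rewrite -{2}ev_X -{3}ev_X -!rmorphM mulrC|rewrite hG mulr0].
(* [e] fixes whatever [h] kills, in particular [e^†]; hence [e^† = e e^†] is self-adjoint. *)
have es : e = e^†.
  have hes : h * e^† = 0 by apply: star_inj; rewrite starM starK hs eh star0.
  have e1 := ee _ hes.
  by have := congr1 (@vna_star R M) e1; rewrite starM !starK e1.
exists e; split.
- rewrite /e -[X in S X]addr0; apply: Slin; first exact: ev_closed.
  by have := Slin (-1) S1 S1; rewrite rmorphN1 mulN1r addNr.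
- by split=> //; exact: ee.
- by move=> e0; apply: G1; apply: (scl_eq0 e0); rewrite invr_eq0.
- by move=> e1; apply: h0; rewrite -[h]mulr1 -e1.
Qed.

End PolynomialCalculus.

Lemma hb_hom_linear Z a x y : hb_hom irrC Z Z x -> hb_hom irrC Z Z y ->
  hb_hom irrC Z Z (scl a * x + y).
Proof.
move=> [hx hxb] [hy hyb]; split; first by apply: homD => //; exact: homZ.
move=> b; rewrite mulrDr sclCA hxb hyb rmorphD mulrDl rmorphM /= endo_scl.
by rewrite mulrA.
Qed.

Lemma hb_hom1 Z : hb_hom irrC Z Z 1.
Proof. by split=> [|b]; [exact: hom1|rewrite mulr1 rmorph1 mul1r]. Qed.

(** A non-scalar [x] has an eigenvalue [c]; then [z = x - c] is nonzero with nonzero kernel, and so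
    is the self-adjoint [z^† z], to which [null_projection] applies. *)
Lemma hb_nontrivial_projection Z : drinfeld_commutant D irrC Z ->
  ~ hb_simple irrC Z ->
  exists e, [/\ hb_hom irrC Z Z e, projection e, e <> 0 & e <> 1].
Proof.
move=> cZ; have [DZ hZ] := cZ.
case/existsNP => x /not_implyP[hx hns].
have [Q [u hu]] := end_finite_dim DZ.
pose S := hb_hom irrC Z Z.
have Su y : S y -> exists a : Q -> R[i], y = \sum_q scl (a q) * u q by case=> /hu.
have SM y z : S y -> S z -> S (y * z) by exact: hb_homM.
have S1 : S 1 := hb_hom1 Z.
have Slin a y z : S y -> S z -> S (scl a * y + z) by exact: hb_hom_linear.
have [c [y [Sy y0 xy]]] := eigenvector S1 Slin SM hx Su.
pose z := x - scl c.
have Sz : S z.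
  have -> : z = scl (- c) * 1 + x by rewrite /z mulr1 rmorphN addrC.
  exact: Slin.
have z0 : z <> 0.
  by move=> z0; apply: hns; exists c; apply/eqP; rewrite -subr_eq0; apply/eqP.
have Sh : S (z^† * z) by apply: SM => //; exact: hb_hom_star.
apply: (null_projection S1 Slin SM Sh Su (y := y)) => //.
- by rewrite starM starK.
- by rewrite -mulrA xy mulr0.
- by move/star_eq0.
Qed.

(** Induction on an integer bound for the dimension: a nontrivial projection cuts [Z] into two
    pieces of dimension at least 1 each, so the bound drops for both. *)
Lemma hb_decomposition Z : drinfeld_commutant D irrC Z ->
  exists (P : finType) (Y : P -> hb_obj M J) (v : P -> M),
    (forall p, [/\ drinfeld_commutant D irrC (Y p), hb_simple irrC (Y p),
       hb_hom irrC (Y p) Z (v p) & (v p)^† * v p = 1]) /\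
    \sum_p v p * (v p)^† = 1.
Proof.
have [m] : exists m : nat, dimension (sg Z) < m%:R.
  by exists (Num.Def.truncn (dimension (sg Z))).+1; exact: truncnS_gt.
elim: m Z => [|m IH] Z dZ cZ.
  by have := le_lt_trans (dimension_ge1 hfactor hD cZ.1) dZ; rewrite ltr10.
have [sZ|/(hb_nontrivial_projection cZ)] := pselect (hb_simple irrC Z).
  exists unit, (fun=> Z), (fun=> 1); split=> [_|].
    by split=> //; [exact: hb_hom1|rewrite star1 mulr1].
  by rewrite (big_pred1 tt) ?star1 ?mulr1 // => -[].
move=> [e [he pe e0 e1]].
have h1e : hb_hom irrC Z Z (1 - e).
  have -> : 1 - e = scl (-1) * e + 1 by rewrite rmorphN1 mulN1r addrC.
  by apply: hb_hom_linear => //; exact: hb_hom1.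
have p1e : projection (1 - e).
  have [es ee] := pe; split; first by rewrite starB star1 es.
  by rewrite mulrBl mul1r mulrBr mulr1 ee subrr subr0.
have [Z1 [v1 [c1 hv1 vv1 ve1]]] := hb_subobject cZ he pe (introN eqP e0).
have ne1 : 1 - e != 0 by rewrite subr_eq0 eq_sym; apply/eqP.
have [Z2 [v2 [c2 hv2 vv2 ve2]]] := hb_subobject cZ h1e p1e ne1.
have dd : dimension (sg Z) = dimension (sg Z1) + dimension (sg Z2).
  rewrite (@dimension_add _ _ hfactor D hD (sg Z) bool
    (fun i : bool => if i then sg Z1 else sg Z2) (fun i : bool => if i then v1 else v2)).
  - by rewrite big_bool.
  - exact: cZ.1.
  - by case; [exact: c1.1|exact: c2.1].
  - by case; [exact: hv1.1|exact: hv2.1].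
  - by case.
  - by rewrite big_bool /= ve1 ve2 addrC subrK.
have d1 := dimension_ge1 hfactor hD c1.1; have d2 := dimension_ge1 hfactor hD c2.1.
have mS : m.+1%:R = m%:R + 1 :> R by rewrite -natr1.
have [|P1 [Y1 [w1 [h1 s1]]]] := IH Z1 _ c1; first by lra.
have [|P2 [Y2 [w2 [h2 s2]]]] := IH Z2 _ c2; first by lra.
exists (P1 + P2)%type, (fun p => match p with inl q => Y1 q | inr q => Y2 q end),
  (fun p => match p with inl q => v1 * w1 q | inr q => v2 * w2 q end).
split=> [[q|q]|].
- have [a1 a2 a3 a4] := h1 q; split=> //; first exact: hb_homM a3.
  by rewrite starM -mulrA (mulrA _ v1) vv1 mul1r.
- have [a1 a2 a3 a4] := h2 q; split=> //; first exact: hb_homM a3.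
  by rewrite starM -mulrA (mulrA _ v2) vv2 mul1r.
rewrite big_sumType /= -[RHS](subrK e) -ve2 -ve1 addrC; congr (_ + _).
  rewrite -[X in _ = _ * X]mul1r -s2 mulr_suml mulr_sumr.
  by apply: eq_bigr => q _; rewrite starM !mulrA.
rewrite -[X in _ = _ * X]mul1r -s1 mulr_suml mulr_sumr.
by apply: eq_bigr => q _; rewrite starM !mulrA.
Qed.

(** * Induced half-braidings *)

Lemma hom_irrC_eq0 k k' x : k != k' -> hom_space (irrC k) (irrC k') x -> x = 0.
Proof.
move=> kk' hx; apply: contrapT => x0; move/eqP: kk'; apply.
have [_ inj _] := hirrC; apply: inj.
exact: (schur (irrC_star k) (irrC_star k') (@irrC_simple k) (@irrC_simple k') hx x0).
Qed.

Lemma sum_unitary (O : finType) (L L' : O -> M) :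
  (forall p q, (L p)^† * L q = (p == q)%:R) ->
  (forall p q, L' p * (L' q)^† = (p == q)%:R) ->
  \sum_p L p * (L p)^† = 1 -> \sum_p (L' p)^† * L' p = 1 ->
  unitary_elt (\sum_p L p * L' p).
Proof.
move=> h1 h2 s1 s2; split; rewrite star_sum mulr_suml.
  rewrite -[RHS]s2; apply: eq_bigr => p _; rewrite mulr_sumr (bigD1 p) //=.
  rewrite big1 ?addr0 => [|q qp]; rewrite starM -mulrA (mulrA _ (L _)) h1.
    by rewrite eqxx mul1r.
  by rewrite eq_sym (negPf qp) mul0r mulr0.
rewrite -[RHS]s1; apply: eq_bigr => p _; rewrite mulr_sumr (bigD1 p) //=.
rewrite big1 ?addr0 => [|q qp]; rewrite starM -mulrA (mulrA (L' _)) h2.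
  by rewrite eqxx mul1r.
by rewrite eq_sym (negPf qp) mul0r mulr0.
Qed.

(** There is no zero object to start from, so the induction runs over nonempty lists; [o] shows that
    [J] is nonempty. *)
Lemma fus_direct_sum (tau : J -> {lrmorphism M -> M}) : (forall b, D (tau b)) ->
  exists (iota : {lrmorphism M -> M}) (S : J -> M),
    [/\ D iota, forall b, hom_space (tau b) iota (S b),
        forall b, (S b)^† * S b = 1 & \sum_b S b * (S b)^† = 1].
Proof.
move=> Dtau; suff h : forall (b : J) s, uniq (b :: s) ->
  exists (iota : {lrmorphism M -> M}) (S : J -> M),
    [/\ D iota, forall c, c \in b :: s -> hom_space (tau c) iota (S c),
        forall c, c \in b :: s -> (S c)^† * S c = 1
      & \sum_(c <- b :: s) S c * (S c)^† = 1].
  have oJ : o \in enum J by rewrite mem_enum.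
  case eJ : (enum J) oJ => [//|b s] _.
  have ub : uniq (b :: s) by rewrite -eJ enum_uniq.
  have [iota [S [h1 h2 h3 h4]]] := h b s ub; rewrite -eJ in h2 h3 h4.
  exists iota, S; split=> // [c|c|].
  - by apply: h2; rewrite mem_enum.
  - by apply: h3; rewrite mem_enum.
  - by rewrite -[RHS]h4 big_enum.
move=> b s; elim: s b => [|b' s IH] b ub.
  exists (tau b), (fun=> 1); split=> // [c|c _|].
  - by rewrite inE => /eqP ->; exact: hom1.
  - by rewrite star1 mulr1.
  - by rewrite big_seq1 star1 mulr1.
move: ub; rewrite cons_uniq => /andP[bs us].
have [iota [S [Di h2 h3 h4]]] := IH b' us.
have [iota' [v [w [Di' [hv vv] [hw ww] vw]]]] := fus_sum hD (Dtau b) Di.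
exists iota', (fun c => if c == b then v else w * S c); split=> // [c|c|].
- rewrite in_cons; case: eqP => [-> _|_ /= cs]; first exact: hv.
  exact: homM hw (h2 c cs).
- rewrite in_cons; case: eqP => [_ _|_ /= cs]; first exact: vv.
  by rewrite starM -mulrA (mulrA _ w) ww mul1r h3.
rewrite big_cons eqxx -[RHS]vw; congr (_ + _).
rewrite -[X in _ = X * _]mulr1 -h4 mulr_sumr mulr_suml.
rewrite big_seq [RHS]big_seq; apply: eq_bigr => c cs.
have -> : (c == b) = false by apply/negP => /eqP cb; rewrite -cb cs in bs.
by rewrite starM !mulrA.
Qed.

Section Induced.
Variables (nu : {lrmorphism M -> M}) (Dnu : D nu).

(* Half-turns rescaled to coisometries from [bar k . g] to [bar b]. *)
Definition tt k g b (i : 'I_(N k g b)) : M :=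
  scl (Num.sqrt (dc b / dc k))%:C * ht i.

Let tcoef k b : (Num.sqrt (dc b / dc k))%:C * (Num.sqrt (dc b / dc k))%:C
  = (dc b / dc k)%:C :> R[i].
Proof.
by rewrite -rmorphM -expr2 sqr_sqrtr // divr_ge0 // dc_ge0.
Qed.

Lemma tt_hom k g b (i : 'I_(N k g b)) x :
  tt i * irrC (bar k) (irrC g x) = irrC (bar b) x * tt i.
Proof.
have h := half_turn_hom (kap := rC k) (gam := rC g) (bet := rC b) (@T_hom _ _ _ i) x.
by rewrite /tt -mulrA [_ * irrC _ _]h sclCA.
Qed.

Lemma tt_homS k g b (i : 'I_(N k g b)) x :
  (tt i)^† * irrC (bar b) x = irrC (bar k) (irrC g x) * (tt i)^†.
Proof.
apply: (@hom_star _ _ (irrC (bar k) \o irrC g) (irrC (bar b))).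
- exact: irrC_star2.
- exact: irrC_star.
- exact: tt_hom.
Qed.

Lemma tt_mulS k g b (i j : 'I_(N k g b)) : tt i * (tt j)^† = (i == j)%:R.
Proof.
rewrite /tt starM star_sclr -sclC sclMM tcoef.
rewrite (half_turn_mulS (kap := rC k) (gam := rC g) (bet := rC b)); try exact: T_hom.
rewrite T_orth mulrA -!rmorphM /= mulrA divfK ?dcR_neq0 //.
by rewrite divff ?dcR_neq0 // !rmorph1 mul1r.
Qed.

Lemma tt_mulS_neq k g b b' (i : 'I_(N k g b)) (j : 'I_(N k g b')) : b != b' ->
  tt i * (tt j)^† = 0.
Proof.
move=> bb'; apply: (@hom_irrC_eq0 (bar b') (bar b)).
  by rewrite eq_sym (inj_eq bar_inj).
by move=> x; rewrite -mulrA tt_homS mulrA tt_hom mulrA.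
Qed.

Lemma T_orth_neq k k' m m' (i : 'I_(N k m m')) (j : 'I_(N k' m m')) : k != k' ->
  (T i)^† * T j = 0.
Proof.
move=> kk'; apply: (@hom_irrC_eq0 k' k); first by rewrite eq_sym.
by move=> x; rewrite -mulrA T_hom mulrA T_homS mulrA.
Qed.

Lemma tt_sum k g : \sum_b \sum_(i < N k g b) (tt i)^† * tt i = 1.
Proof.
apply: (@scl_cancel _ M (dc k)%:C); last exact: dc_neq0.
rewrite mulr1 -[RHS](ht_sum k g) mulr_sumr; apply: eq_bigr => b _.
rewrite !mulr_sumr; apply: eq_bigr => i _.
rewrite /tt starM star_sclr -sclC sclMM tcoef [LHS]mulrA -rmorphM -rmorphM /=.
by rewrite mulrCA divff ?dcR_neq0 // mulr1.
Qed.

Variables (iota : {lrmorphism M -> M}) (S : J -> M).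
Hypotheses (Di : D iota)
  (hS : forall b, hom_space (irrC b \o nu \o irrC (bar b)) iota (S b))
  (Siso : forall b, (S b)^† * S b = 1) (Ssum : \sum_b S b * (S b)^† = 1).

Let hi : star_endo iota := fus_star hD Di.
Let hn : star_endo nu := fus_star hD Dnu.

Let hSS b x : (S b)^† * iota x = irrC b (nu (irrC (bar b) x)) * (S b)^†.
Proof.
apply: (hom_star _ hi (hS b)).
by apply: star_endo_comp; [apply: star_endo_comp|]; do ?exact: irrC_star.
Qed.

Let Sorth b b' : (S b)^† * S b' = (b == b')%:R.
Proof.
have [->|bb'] := eqVneq b b'; first exact: Siso.
exact: (decomposition_orthogonal Siso Ssum bb').
Qed.

(* The half-braiding of the direct sum [iota] of the [b . nu . bar b] obtained by
   fusing [g] with [b] on the outside and with its conjugate on the inside. *)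
Definition induced_br g : M :=
  \sum_k \sum_b \sum_(i < N k g b)
    irrC g (S b) * T i * irrC k (nu (tt i)) * (S k)^†.

Lemma induced_hom g : hom_space (iota \o irrC g) (irrC g \o iota) (induced_br g).
Proof.
move=> x /=; rewrite /induced_br mulr_suml mulr_sumr; apply: eq_bigr => k _.
rewrite mulr_suml mulr_sumr; apply: eq_bigr => b _.
rewrite mulr_suml mulr_sumr; apply: eq_bigr => i _.
rewrite (ctx (hSS k _)) (ctx1 (irrC k) (whisk nu (tt_hom i x))).
by rewrite (ctx (T_hom i _)) (whisk (irrC g) (hS b x)) !mulrA.
Qed.

(** Over the triples [(k, b, i)] the factors [g(S b) T i] form a complete orthogonal system of
    isometries, and the factors [k(nu (tt i)) (S k)^†] one of coisometries. *)
Lemma induced_unitary g : unitary_elt (induced_br g).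
Proof.
pose O := {x : J * J & 'I_(N x.1 g x.2)}.
pose L (p : O) : M := irrC g (S (tag p).2) * T (tagged p).
pose L' (p : O) : M := irrC (tag p).1 (nu (tt (tagged p))) * (S (tag p).1)^†.
have flat (F : forall k b, 'I_(N k g b) -> M) :
    \sum_(p : O) F (tag p).1 (tag p).2 (tagged p)
    = \sum_k \sum_b \sum_(i < N k g b) F k b i.
  rewrite pair_bigA /= (@sig_big_dep _ _ _ _ (fun x : J * J => 'I_(N x.1 g x.2)) xpredT
    (fun _ => predT) (fun (x : J * J) i => F x.1 x.2 i)) /=.
  by apply: eq_bigr => -[x i].
have -> : induced_br g = \sum_p L p * L' p.
  rewrite /L /L' (flat (fun k b i => irrC g (S b) * T i * (irrC k (nu (tt i)) * (S k)^†))).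
  by do 3?[apply: eq_bigr => ? _]; rewrite !mulrA.
apply: sum_unitary.
- move=> [[k b] /= i] [[k' b'] /= j]; rewrite /L /= starM -irrC_star -mulrA.
  rewrite (mulrA (irrC g _) (irrC g _)) -rmorphM Sorth.
  have [e|bb'] := eqVneq b b'; [subst b'|]; last first.
    rewrite /= rmorph0 mul0r mulr0 -tag_eqE /tag_eq /= xpair_eqE (negPf bb') andbF.
    by [].
  rewrite rmorph1 mul1r; have [e|kk'] := eqVneq k k'; [subst k'|]; last first.
    by rewrite T_orth_neq // -tag_eqE /tag_eq /= xpair_eqE (negPf kk').
  by rewrite T_orth -tag_eqE /tag_eq /= eqxx tagged_asE.
- move=> [[k b] /= i] [[k' b'] /= j]; rewrite /L' /= starM starK -mulrA.
  rewrite (mulrA _ (S _)) Sorth.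
  have [e|kk'] := eqVneq k k'; [subst k'|]; last first.
    by rewrite mul0r mulr0 -tag_eqE /tag_eq /= xpair_eqE (negPf kk').
  rewrite mul1r -irrC_star -hn -!rmorphM /=; have [e|bb'] := eqVneq b b'; [subst b'|]; last first.
    by rewrite tt_mulS_neq // !rmorph0 -tag_eqE /tag_eq /= xpair_eqE (negPf bb') andbF.
  by rewrite tt_mulS !rmorph_nat -tag_eqE /tag_eq /= eqxx tagged_asE.
- rewrite /L (flat (fun k b i => irrC g (S b) * T i * (irrC g (S b) * T i)^†)).
  rewrite exchange_big /= -[RHS](rmorph1 (irrC g)) -Ssum rmorph_sum.
  apply: eq_bigr => b _ /=; rewrite rmorphM /= -[X in _ = X * _]mulr1 -(T_sum g b).
  rewrite mulr_sumr mulr_suml; apply: eq_bigr => k _.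
  rewrite mulr_sumr mulr_suml; apply: eq_bigr => i _.
  by rewrite starM -irrC_star !mulrA.
- rewrite /L' (flat (fun k b i => (irrC k (nu (tt i)) * (S k)^†)^† *
    (irrC k (nu (tt i)) * (S k)^†))).
  rewrite -[RHS]Ssum; apply: eq_bigr => k _.
  rewrite -[X in _ = X * _]mulr1 -(rmorph1 (irrC k)) -(rmorph1 nu) -(tt_sum k g).
  rewrite !rmorph_sum /= mulr_sumr mulr_suml; apply: eq_bigr => b _.
  rewrite !rmorph_sum /= mulr_sumr mulr_suml; apply: eq_bigr => i _.
  by rewrite starM starK -irrC_star -hn !rmorphM !mulrA.
Qed.

Lemma half_turn_expand k g b y : hom_space (irrC k) (irrC g \o irrC b) y ->
  half_turn (rC k) (rC g) (rC b) y = \sum_i (y^† * @T k g b i) * ht i.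
Proof.
move=> /T_span[a ea].
have yT i : y^† * T i = scl (Num.conj (a i)).
  rewrite ea star_sum mulr_suml (bigD1 i) //= big1 ?addr0 => [|j ji].
    by rewrite starM star_scl -sclC -mulrA T_orth eqxx mulr1.
  by rewrite starM star_scl -sclC -mulrA T_orth (negPf ji) mulr0.
rewrite {1}ea /half_turn /= star_sum rmorph_sum mulr_sumr mulr_suml.
apply: eq_bigr => i _ /=; rewrite yT starM star_scl -sclC rmorphM /= endo_scl.
by rewrite sclCA -mulrA.
Qed.

(** Bending respects composition: the two bends along [m] cancel by the conjugate equation, which
    leaves one half-turn of the composite. *)
Lemma turn_comp k m b g1 g2 g3 (j : 'I_(N m g2 b)) (l : 'I_(N k g1 m)) x :
  hom_space (irrC g3) (irrC g1 \o irrC g2) x ->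
  ht j * ht l * irrC (bar k) x
  = half_turn (rC k) (rC g3) (rC b) (x^† * irrC g1 (T j) * T l).
Proof.
move=> hx; have hl y : ht l * irrC (bar k) (irrC g1 y) = irrC (bar m) y * ht l.
  exact: (half_turn_hom (kap := rC k) (gam := rC g1) (bet := rC m) (@T_hom _ _ _ l) y).
have e1 : (Rc m)^† * ht l = (Rc k)^† * irrC (bar k) (T l)^†.
  rewrite /ht /half_turn /= !mulrA -rC_homS -!(mulrA (Rc k)^†) -!rmorphM /=.
  congr (_ * irrC _ _); rewrite -T_homS -mulrA -rmorphM.
  by rewrite rC_zigS rmorph1 mulr1.
have -> : ht j = (Rc m)^† * irrC (bar m) (T j)^† * irrC (bar m) (irrC g2 (Rbc b)) by [].
rewrite -(mulrA _ _ (ht l)) -hl mulrA -(mulrA _ _ (ht l)) -hl mulrA e1.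
rewrite /half_turn /= !starM starK -irrC_star !rmorphM !mulrA.
by rewrite -(ctx1 (irrC (bar k)) (hx _)).
Qed.

(** The square roots telescope through [m]. The coefficients are those that recouple the outer [T],
    so that inner and outer fusion match. *)
Lemma tt_comp k m b g1 g2 g3 (j : 'I_(N m g2 b)) (l : 'I_(N k g1 m)) x :
  hom_space (irrC g3) (irrC g1 \o irrC g2) x ->
  tt j * tt l * irrC (bar k) x
  = \sum_(i < N k g3 b) ((T l)^† * irrC g1 (T j)^† * x * T i) * tt i.
Proof.
move=> hx; have e : Num.sqrt (dc b / dc m) * Num.sqrt (dc m / dc k) = Num.sqrt (dc b / dc k).
  rewrite -sqrtrM; last by rewrite divr_ge0 // dc_ge0.
  by rewrite mulrA divfK // dcR_neq0.
rewrite /tt sclMM -(mulrA (scl _)) (turn_comp j l hx) half_turn_expand.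
  rewrite mulr_sumr; apply: eq_bigr => i _.
  by rewrite -rmorphM e !starM starK -irrC_star sclCA !mulrA.
have hxS y : x^† * irrC g1 (irrC g2 y) = irrC g3 y * x^†.
  by apply: (hom_star (irrC_star g3) (irrC_star2 g1 g2) hx).
move=> y /=; rewrite (ctx (T_hom l _)) (ctx1 (irrC g1) (T_hom j _)) hxS.
by rewrite !mulrA.
Qed.

Lemma induced_brS g m : induced_br g * S m
  = \sum_b \sum_(i < N m g b) irrC g (S b) * T i * irrC m (nu (tt i)).
Proof.
rewrite /induced_br mulr_suml (bigD1 m) //= [X in _ + X]big1 ?addr0 => [|k km].
  rewrite mulr_suml; apply: eq_bigr => b _; rewrite mulr_suml; apply: eq_bigr => i _.
  by rewrite -mulrA Sorth eqxx mulr1.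
rewrite mulr_suml big1 // => b _; rewrite mulr_suml big1 // => i _.
by rewrite -mulrA Sorth (negPf km) mulr0.
Qed.

(** Inserting [T_sum] for [g2 b] and for [g1 m] recouples the outer factor [x T i]. Schur's lemma
    kills the channels other than [k] and makes the recoupling coefficients scalars, which pass to
    the inner leg, where [tt_comp] sums them up. *)
Lemma induced_half_braiding : half_braiding irrC iota induced_br.
Proof.
split=> [g|g1 g2 g3 x hx]; first by split; [exact: induced_unitary|exact: induced_hom].
transitivity (\sum_k \sum_b irrC g1 (irrC g2 (S b)) *
    (\sum_(i < N k g3 b) x * T i * irrC k (nu (tt i))) * (S k)^†).
  rewrite /induced_br mulr_sumr; apply: eq_bigr => k _.
  rewrite mulr_sumr; apply: eq_bigr => b _.
  rewrite !mulr_sumr mulr_suml; apply: eq_bigr => i _.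
  by rewrite !mulrA (hx _).
transitivity (\sum_k \sum_b irrC g1 (irrC g2 (S b)) *
    (\sum_m \sum_(j < N m g2 b) \sum_(l < N k g1 m) irrC g1 (T j) * T l *
       irrC k (nu (tt j * tt l * irrC (bar k) x))) * (S k)^†).
  apply: eq_bigr => k _; apply: eq_bigr => b _; congr (_ * _ * _).
  transitivity (\sum_(i < N k g3 b) \sum_m \sum_(j < N m g2 b) \sum_(l < N k g1 m)
      irrC g1 (T j) * T l * ((T l)^† * irrC g1 (T j)^† * x * T i) * irrC k (nu (tt i))).
    apply: eq_bigr => i _.
    rewrite -[x * T i]mul1r -(rmorph1 (irrC g1)) -(T_sum g2 b) rmorph_sum !mulr_suml.
    apply: eq_bigr => m _; rewrite rmorph_sum !mulr_suml; apply: eq_bigr => j _ /=.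
    rewrite rmorphM /= -[irrC g1 (T j) in LHS]mulr1 -(T_sum g1 m).
    rewrite mulr_sumr !mulr_suml (bigD1 k) //= [X in _ + X]big1 ?addr0.
      rewrite mulr_sumr !mulr_suml; apply: eq_bigr => l _.
      by rewrite !mulrA.
    move=> k' kk'; rewrite mulr_sumr !mulr_suml big1 // => l _.
    have -> : irrC g1 (T j) * (T l * (T l)^†) * irrC g1 (T j)^† * (x * T i)
        = irrC g1 (T j) * T l * ((T l)^† * irrC g1 (T j)^† * x * T i) by rewrite !mulrA.
    have -> : (T l)^† * irrC g1 (T j)^† * x * T i = 0; last by rewrite mulr0 mul0r.
    apply: (@hom_irrC_eq0 k k'); first by rewrite eq_sym.
    move=> y; rewrite (ctx (T_hom i _)) (ctx (hx _)) /=.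
    by rewrite (ctx1 (irrC g1) (T_homS j _)) T_homS !mulrA.
  rewrite exchange_big; apply: eq_bigr => m _.
  rewrite exchange_big; apply: eq_bigr => j _.
  rewrite exchange_big; apply: eq_bigr => l _ /=.
  rewrite (tt_comp j l hx) !rmorph_sum mulr_sumr; apply: eq_bigr => i _ /=.
  have [a ->] : exists a : R[i], (T l)^† * irrC g1 (T j)^† * x * T i = scl a.
    apply: (@irrC_simple k) => y; rewrite (ctx (T_hom i _)) (ctx (hx _)) /=.
    by rewrite (ctx1 (irrC g1) (T_homS j _)) T_homS !mulrA.
  by rewrite !rmorphM /= !endo_scl !mulrA.
rewrite {2}/induced_br mulr_sumr mulr_suml; apply: eq_bigr => k _.
transitivity (\sum_m \sum_(l < N k g1 m) irrC g1 (induced_br g2 * S m) * T l *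
    irrC k (nu (tt l * irrC (bar k) x)) * (S k)^†); last first.
  rewrite mulr_sumr mulr_suml; apply: eq_bigr => m _.
  rewrite mulr_sumr mulr_suml; apply: eq_bigr => l _.
  rewrite !rmorphM !mulrA /= -!mulrA.
  by rewrite hSS.
transitivity (\sum_b \sum_m \sum_(j < N m g2 b) \sum_(l < N k g1 m)
    irrC g1 (irrC g2 (S b) * T j * irrC m (nu (tt j))) * T l *
    irrC k (nu (tt l * irrC (bar k) x)) * (S k)^†).
  apply: eq_bigr => b _; rewrite mulr_sumr mulr_suml; apply: eq_bigr => m _.
  rewrite mulr_sumr mulr_suml; apply: eq_bigr => j _.
  rewrite mulr_sumr mulr_suml; apply: eq_bigr => l _.
  move: (tt j) (tt l) => t1 t2; rewrite !rmorphM /= !mulrA.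
  by rewrite -(ctx (T_hom l _)).
rewrite exchange_big; apply: eq_bigr => m _ /=.
under eq_bigr do rewrite exchange_big.
rewrite exchange_big; apply: eq_bigr => l _ /=.
rewrite induced_brS rmorph_sum !mulr_suml; apply: eq_bigr => b _ /=.
by rewrite rmorph_sum !mulr_suml; apply: eq_bigr.
Qed.

Lemma induced_obj : drinfeld_commutant D irrC (HbObj iota induced_br).
Proof. by split=> //; exact: induced_half_braiding. Qed.

(** [Rbc o] embeds [nu] into the summand [b = o] without any identification of [bar o] with [o]. *)
Definition unit_leg : M := S o * nu (Rbc o).

Lemma unit_leg_hom : hom_space nu iota unit_leg.
Proof.
move=> y; rewrite /unit_leg -mulrA -rmorphM rC_homb irrC_id rmorphM mulrA.
by have /= h := hS o y; rewrite irrC_id in h; rewrite h mulrA.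
Qed.

Lemma induced_leg_hom (lam : {lrmorphism M -> M}) g x :
  hom_space (lam \o irrC g) (irrC g \o nu) x ->
  hom_space lam iota (S g * x * lam (Rbc g)).
Proof.
move=> hx y; rewrite (ctx1 lam (rC_homb g y)) (ctx (hx _)) /=.
by rewrite (hS g y) !mulrA.
Qed.

(* Compressing the induced half-braiding to the summand [nu] on one side and to
   [x] on the other one isolates [x] in the tube algebra. *)
Lemma induced_isolate (lam : {lrmorphism M -> M}) g0 x :
  hom_space (lam \o irrC g0) (irrC g0 \o nu) x ->
  exists2 c : R[i], c != 0 & forall g,
    irrC g unit_leg^† * induced_br g * (S g0 * x * lam (Rbc g0))
    = if g == g0 then scl c * x else 0.
Proof.
(* [c0] collects the rescaling in [tt] and the norm of [Rbc o]. Every basis vector of Hom(g0, g0 o)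
   contributes the same amount, whence the factor [N g0 g0 o], nonzero because 1 lies in that
   space. *)
move=> hx; pose c0 := Num.sqrt (dc o / dc g0) * dc o.
have h1 : hom_space (irrC g0) (irrC g0 \o irrC o) 1.
  by move=> y /=; rewrite irrC_id mul1r mulr1.
have c00 : 0 < c0 by rewrite mulr_gt0 ?dc_gt0 // sqrtr_gt0 divr_gt0 // dc_gt0.
have N0 : N g0 g0 o != 0%N.
  apply/eqP => N0; have [a] := T_span h1; rewrite big1; last first.
    by move=> [i ilt]; exfalso; move: ilt; rewrite N0 ltn0.
  by move/eqP; rewrite oner_eq0.
exists ((N g0 g0 o)%:R * c0%:C).
  by rewrite mulf_neq0 ?pnatr_eq0 // fmorph_eq0 gt_eqF.
move=> g.
have -> : irrC g unit_leg^† * induced_br g * (S g0 * x * lam (Rbc g0))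
    = \sum_(i < N g0 g o) irrC g (nu (Rbc o)^†) * T i * irrC g0 (nu (tt i))
        * (x * lam (Rbc g0)).
  transitivity (irrC g unit_leg^† * (induced_br g * S g0) * (x * lam (Rbc g0))).
    by rewrite !mulrA.
  rewrite induced_brS mulr_sumr mulr_suml (bigD1 o) //= [X in _ + X]big1 ?addr0.
    rewrite mulr_sumr mulr_suml; apply: eq_bigr => i _.
    rewrite /unit_leg starM -hn rmorphM !mulrA -(mulrA _ _ (irrC g (S o))).
    by rewrite -rmorphM Siso rmorph1 mulr1.
  move=> b bo; rewrite mulr_sumr mulr_suml big1 // => i _.
  rewrite /unit_leg starM -hn rmorphM !mulrA -(mulrA _ _ (irrC g (S b))).
  by rewrite -rmorphM Sorth eq_sym (negPf bo) rmorph0 mulr0 !mul0r.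
have [e|gg0] := eqVneq g g0; last first.
  rewrite big1 // => i _; have -> : T i = 0; last by rewrite mulr0 !mul0r.
  apply: (@hom_irrC_eq0 g0 g); first by rewrite eq_sym.
  by move=> y; rewrite T_hom irrC_id.
subst g; rewrite rmorphM rmorph_nat -mulrA mulr_natl -[N g0 g0 o in RHS]card_ord -sumr_const.
apply: eq_bigr => i _; have [t et] : exists t : R[i], T i = scl t.
  by apply: (@irrC_simple g0) => y; rewrite T_hom irrC_id.
have tt1 : scl (t * Num.conj t) = 1 :> M.
  by have := T_orth i i; rewrite eqxx et star_scl -rmorphM mulrC.
have -> : tt i = scl (Num.sqrt (dc o / dc g0))%:C * (scl (Num.conj t) * (Rbc o * (Rc g0)^†)).
  rewrite /tt /ht /half_turn /= et star_scl endo_scl -sclC -!mulrA.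
  by rewrite rC_homS.
rewrite et !rmorphM /= !endo_scl.
transitivity (scl (Num.sqrt (dc o / dc g0))%:C * scl (t * Num.conj t) *
   (irrC g0 (nu ((Rbc o)^† * Rbc o)) * (irrC g0 (nu (Rc g0)^†) * x * lam (Rbc g0)))).
  have e (c t1 t2 : R[i]) (y1 y2 z : M) : y1 * scl t1 * (scl c * (scl t2 * y2)) * z
      = scl c * scl (t1 * t2) * (y1 * y2 * z).
    rewrite -(sclC t1 y1) (mulrA (scl c)) -(rmorphM (@scl R M)) sclMM.
    by rewrite -(rmorphM (@scl R M)) !mulrA; congr (scl _ * _ * _ * _); ring.
  by rewrite e !rmorphM /= !mulrA.
rewrite tt1 mulr1 (rs_normb (rC o)) !endo_scl -(hx _) /= -mulrA -rmorphM rC_zigS.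
by rewrite rmorph1 mulr1 mulrA -!rmorphM.
Qed.

End Induced.

(** * The relative tube algebra *)

Lemma average_irr Z (rho : {lrmorphism M -> M}) v w :
  drinfeld_commutant D irrC Z -> hb_simple irrC Z -> D rho -> simple_obj rho ->
  hom_space rho (sg Z) v -> hom_space rho (sg Z) w ->
  average (sg Z) (sg Z) (E Z) (E Z) (v * w^†)
  = scl (global_dim irrC * dimension rho / dimension (sg Z))%:C * (w^† * v).
Proof.
move=> cZ sZ Drho srho hv hw; have [f [ef Dfb]] := rigid_exists hfactor hD Drho srho.
have Df : D f by rewrite ef.
rewrite -{1}ef (dimension_rigid hD Df Dfb).
by apply: average_simple => //; rewrite ef.
Qed.

Section Tube.
Variables (I : finType) (irr : I -> {lrmorphism M -> M}).
Hypothesis hirr : irr_representatives D irr.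
Implicit Types (X Y : {ffun I * J * I -> M}) (l m n : I).

Lemma irr_obj l : D (irr l). Proof. by case: hirr => h _ _; case: (h l). Qed.
Lemma irr_simple l : simple_obj (irr l).
Proof. by case: hirr => h _ _; case: (h l). Qed.
Lemma irr_star l : star_endo (irr l).
Proof. exact: (fus_star hD (irr_obj l)). Qed.

Lemma tube_sum_eval (P : Type) (s : seq P) (F : P -> tube_family M I J) (t : I * J * I) :
  (\sum_(p <- s) F p : {ffun I * J * I -> M}) t
  = \sum_(p <- s) (F p : {ffun I * J * I -> M}) t.
Proof. exact: sum_ffunE. Qed.

Lemma tube_scale_eval (a : R[i]) (X : tube_family M I J) (t : I * J * I) :
  (a *: X : {ffun I * J * I -> M}) t = scl a * (X : {ffun I * J * I -> M}) t.
Proof. by rewrite ffunE sclZ. Qed.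

Lemma tube_elt_eval l b n x (t : I * J * I) :
  (tube_elt l b n x : {ffun I * J * I -> M}) t = if t == (l, b, n) then x else 0.
Proof. by rewrite ffunE. Qed.

Lemma tube_mul_eval (X Y : tube_family M I J) l k n :
  (tube_mul irr irrC T X Y : {ffun I * J * I -> M}) (l, k, n) =
  \sum_b \sum_m \sum_b' \sum_(i < N k b b')
    (T i)^† * irrC b ((Y : {ffun I * J * I -> M}) (m, b', n))
    * (X : {ffun I * J * I -> M}) (l, b, m) * irr l (T i).
Proof.
rewrite /tube_mul tube_sum_eval (bigD1 l) //= [X in _ + X]big1 ?addr0 => [|l' ll'].
  rewrite tube_sum_eval; apply: eq_bigr => b _.
  rewrite tube_sum_eval; apply: eq_bigr => m _.
  rewrite tube_sum_eval; apply: eq_bigr => b' _.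
  rewrite tube_sum_eval (bigD1 n) //= [X in _ + X]big1 ?addr0 => [|n' nn'].
    rewrite tube_sum_eval (bigD1 k) //= [X in _ + X]big1 ?addr0 => [|k' kk'].
      by rewrite tube_elt_eval eqxx.
    by rewrite tube_elt_eval !xpair_eqE [k == _]eq_sym (negPf kk') andbF.
  rewrite tube_sum_eval big1 // => k' _.
  by rewrite tube_elt_eval !xpair_eqE [n == _]eq_sym (negPf nn') andbF.
do 5?[rewrite tube_sum_eval big1 // => ? _].
by rewrite tube_elt_eval !xpair_eqE [l == _]eq_sym (negPf ll').
Qed.

Section Elements.
Variables (Z : hb_obj M J) (n : I -> nat) (W : forall l, 'I_(n l) -> M).
Hypothesis hW : forall l, orthonormal_basis (hom_space (irr l) (sg Z)) (@W l).
Local Notation P := {l : I & 'I_(n l)}.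

Definition tube_coef (a b : P) : R :=
  dimension (sg Z) / (global_dim irrC * Num.sqrt (dimension (irr (tag a)))
    * Num.sqrt (dimension (irr (tag b)))).

Lemma tube_e_eval (a b : P) l k m :
  (tube_e irr irrC Z W a b : {ffun I * J * I -> M}) (l, k, m) =
  if (l == tag a) && (m == tag b) then
    scl (tube_coef a b * dc k)%:C * (irrC k (W (tagged b))^† * E Z k * W (tagged a))
  else 0.
Proof.
rewrite /tube_e tube_scale_eval tube_sum_eval (bigD1 k) //= [X in _ + X]big1.
  rewrite addr0 tube_scale_eval tube_elt_eval !xpair_eqE eqxx andbT dc_dimension.
  case: ifP => _; last by rewrite !mulr0.
  by rewrite mulrA -!rmorphM.
move=> k' kk'; rewrite tube_scale_eval tube_elt_eval !xpair_eqE [k == _]eq_sym.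
by rewrite (negPf kk') andbF /= mulr0.
Qed.

Lemma W_hom l (i : 'I_(n l)) : hom_space (irr l) (sg Z) (W i).
Proof. by case: (hW l). Qed.

Lemma W_orth l (i j : 'I_(n l)) : (W i)^† * W j = (i == j)%:R.
Proof. by case: (hW l). Qed.

Lemma W_span l x : hom_space (irr l) (sg Z) x ->
  exists c : 'I_(n l) -> R[i], x = \sum_i scl (c i) * W i.
Proof.
case: (hW l) => _ _ h /h [c ->]; exists c; apply: eq_bigr => i _.
exact: sclZ.
Qed.

End Elements.

Lemma tube_e_mul Z Z' (n n' : I -> nat) (W : forall l, 'I_(n l) -> M)
    (W' : forall l, 'I_(n' l) -> M) (p q : {l : I & 'I_(n l)})
    (p' q' : {l : I & 'I_(n' l)}) l k m :
  drinfeld_commutant D irrC Z -> drinfeld_commutant D irrC Z' ->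
  (forall l, orthonormal_basis (hom_space (irr l) (sg Z)) (@W l)) ->
  (forall l, orthonormal_basis (hom_space (irr l) (sg Z')) (@W' l)) ->
  (tube_mul irr irrC T (tube_e irr irrC Z W p q) (tube_e irr irrC Z' W' p' q')
    : {ffun I * J * I -> M}) (l, k, m) =
  if [&& l == tag p, tag q == tag p' & m == tag q'] then
    scl (tube_coef Z p q * tube_coef Z' p' q' * dc k)%:C *
      (irrC k (W' _ (tagged q'))^† * E Z' k *
       average (sg Z) (sg Z') (E Z) (E Z') (W' _ (tagged p') * (W _ (tagged q))^†)
       * W _ (tagged p))
  else 0.
Proof.
move=> cZ cZ' hW hW'; rewrite tube_mul_eval.
have [lp|lp] := eqVneq l (tag p); last first.
  do 4?[rewrite big1 // => ? _].
  by rewrite !tube_e_eval (negPf lp) mulr0 mul0r.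
have [qp|qp] := eqVneq (tag q) (tag p'); last first.
  do 4?[rewrite big1 // => ? _]; rewrite !tube_e_eval.
  case: eqP => [->|_]; last by rewrite /= rmorph0 mulr0 !mul0r.
  by rewrite [tag p' == _]eq_sym (negPf qp) andbF mulr0 mul0r.
have [mq|mq] := eqVneq m (tag q'); last first.
  do 4?[rewrite big1 // => ? _].
  by rewrite !tube_e_eval (negPf mq) andbF rmorph0 mulr0 !mul0r.
have [DZ hZ] := cZ; have [DZ' hZ'] := cZ'.
have h1 := fus_star hD DZ; have h2 := fus_star hD DZ'.
have hWp x : W _ (tagged p) * irr l x = sg Z x * W _ (tagged p).
  by rewrite lp; exact: W_hom hW _ _ x.
set wp := W _ (tagged p) in hWp *; set wq := W _ (tagged q).
have hQ : hom_space (sg Z) (sg Z') (W' _ (tagged p') * wq^†).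
  apply: homM (W_hom hW' _) _; rewrite -qp.
  by apply: hom_star (W_hom hW _) => //; exact: irr_star.
have hWq' x : (W' _ (tagged q'))^† * sg Z' x = irr m x * (W' _ (tagged q'))^†.
  rewrite mq; apply: (hom_star _ h2 (W_hom hW' _)); exact: irr_star.
set wp' := W' _ (tagged p') in hQ *; set wq' := W' _ (tagged q') in hWq' *.
set Q := wp' * wq^† in hQ *.
set cc := tube_coef Z p q; set cc' := tube_coef Z' p' q'.
transitivity (\sum_b \sum_b' \sum_(i < N k b b')
    scl (cc * cc')%:C * (scl (dc b)%:C * (scl (dc b')%:C *
    (irrC k wq'^† * E Z' k * (sg Z' (T i)^† *
      ((E Z' b)^† * irrC b Q * E Z b) * sg Z (T i)) * wp)))).
  apply: eq_bigr => b _; rewrite (bigD1 (tag q)) //= [X in _ + X]big1 ?addr0.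
    apply: eq_bigr => b' _; apply: eq_bigr => i _.
    rewrite !tube_e_eval (introT eqP lp) (introT eqP qp) (introT eqP mq) !eqxx /=.
    rewrite -/wp -/wq -/wp' -/wq' -/cc -/cc' (rmorphM (irrC b)) /= endo_scl.
    rewrite (sclCA _ (T i)^†) sclMM -(mulrA (scl _)) !(mulrA (scl _) (scl _), =^~ rmorphM (@scl R M)).
    congr (scl _ * _); first by rewrite -!rmorphM; congr _%:C; ring.
    rewrite /Q !rmorphM /= !mulrA (T_homS i) -(ctx (esym (hWp _))).
    have e := hb_natS h2 hZ' (@T_hom k b b' i).
    have {}e : (T i)^† * irrC b (E Z' b') = E Z' k * sg Z' (T i)^† * (E Z' b)^†.
      by rewrite -e -mulrA (hb_unitaryS hZ') mulr1.
    by rewrite (ctxc e) !mulrA.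
  move=> m' m'q; do 2?[rewrite big1 // => ? _].
  by rewrite !tube_e_eval (negPf m'q) andbF mulr0 mul0r.
transitivity (scl (cc * cc')%:C * (irrC k wq'^† * E Z' k *
  (\sum_b scl (dc b)%:C * \sum_b' scl (dc b')%:C * \sum_(i < N k b b')
    (sg Z' (T i)^† * ((E Z' b)^† * irrC b Q * E Z b) * sg Z (T i))) * wp)).
  rewrite mulr_sumr mulr_suml mulr_sumr; apply: eq_bigr => b _.
  rewrite sclCA -(mulrA (scl _)) !mulr_sumr !mulr_suml !mulr_sumr.
  apply: eq_bigr => b' _; rewrite !mulr_sumr !mulr_suml !mulr_sumr.
  apply: eq_bigr => i _; congr (_ * (_ * _)).
  by rewrite sclCA -(mulrA (scl _)).
(* For fixed [b], summing over [b'] and [T] is [left_turn_fusion]; it also yields the weight [dc k]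
   of the component [k] of an [e]. *)
have -> : \sum_b scl (dc b)%:C * \sum_b' scl (dc b')%:C * \sum_(i < N k b b')
    (sg Z' (T i)^† * ((E Z' b)^† * irrC b Q * E Z b) * sg Z (T i))
    = scl (dc k)%:C * average (sg Z) (sg Z') (E Z) (E Z') Q.
  rewrite /average mulr_sumr; apply: eq_bigr => b _.
  by rewrite left_turn_fusion => [|x]; [exact: sclCA|exact: conj_hb_hom].
rewrite [_ * (scl _ * _)]sclCA -(mulrA (scl _)) [scl _ * (scl _ * _)]mulrA.
by rewrite -rmorphM -rmorphM.
Qed.

Lemma tube_star_eval (r rb : J -> M) (X : tube_family M I J) l k n :
  (tube_star irr irrC bar r rb X : {ffun I * J * I -> M}) (n, bar k, l) =
  scl (dc k)%:C * (irrC (bar k) (irr l (rb k)^† *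
    ((X : {ffun I * J * I -> M}) (l, k, n))^†) * r k).
Proof.
rewrite /tube_star tube_sum_eval (bigD1 l) //= [X in _ + X]big1 ?addr0 => [|l' ll'].
  rewrite tube_sum_eval (bigD1 k) //= [X in _ + X]big1 ?addr0 => [|k' kk'].
    rewrite tube_sum_eval (bigD1 n) //= [X in _ + X]big1 ?addr0 => [|n' nn'].
      by rewrite tube_elt_eval eqxx sclZ dc_dimension.
    by rewrite tube_elt_eval !xpair_eqE [n == _]eq_sym (negPf nn').
  rewrite tube_sum_eval big1 // => n' _.
  by rewrite tube_elt_eval !xpair_eqE (inj_eq bar_inj) [k == _]eq_sym (negPf kk') andbF.
do 2?[rewrite tube_sum_eval big1 // => ? _].
by rewrite tube_elt_eval !xpair_eqE [l == _]eq_sym (negPf ll') andbF.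
Qed.

Lemma tube_coef_sym Z (n : I -> nat) (p q : {l : I & 'I_(n l)}) :
  tube_coef Z p q = tube_coef Z q p.
Proof. by rewrite /tube_coef mulrAC. Qed.

(** The factor [d(mu)] of the involution turns the two isometries into [Rc] and [Rbc]; then [hb_bar]
    reads the result as an entry of [E (bar k)], and [dc_bar] matches the weights. *)
Lemma tube_e_star (r rb : J -> M) Z (n : I -> nat) (W : forall l, 'I_(n l) -> M) p q :
  (forall b, Rc b = scl (Num.sqrt (dc b))%:C * r b) ->
  (forall b, Rbc b = scl (Num.sqrt (dc b))%:C * rb b) ->
  drinfeld_commutant D irrC Z ->
  (forall l, orthonormal_basis (hom_space (irr l) (sg Z)) (@W l)) ->
  tube_star irr irrC bar r rb (tube_e irr irrC Z W p q) = tube_e irr irrC Z W q p.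
Proof.
move=> hr hrb cZ hW; apply/ffunP => -[[m k'] l].
have [c cK Kc] := injF_bij bar_inj; rewrite -(Kc k'); move: (c k') => k {k' c cK Kc}.
rewrite tube_star_eval !tube_e_eval andbC; case: ifP => [/andP[/eqP mq /eqP lp]|_]; last first.
  by rewrite star0 mulr0 rmorph0 mul0r mulr0.
have [DZ hZ] := cZ; have h1 := fus_star hD DZ.
have hwpS x : (W _ (tagged p))^† * sg Z x = irr l x * (W _ (tagged p))^†.
  rewrite lp; apply: (hom_star _ h1 (W_hom hW _)); exact: irr_star.
set wp := W _ (tagged p) in hwpS *; set wq := W _ (tagged q).
have norm y : scl (dc k)%:C * (irrC (bar k) (irr l (rb k)^† * y) * r k)
    = irrC (bar k) (irr l (Rbc k)^† * y) * Rc k.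
  rewrite hrb [in RHS]hr starM star_sclr -sclC (rmorphM (irr l)) /= endo_scl.
  rewrite -mulrA (rmorphM (irrC (bar k)) (scl _)) /= endo_scl sclMM.
  by rewrite -rmorphM -expr2 sqr_sqrtr ?dc_ge0.
rewrite norm (hb_bar hZ) dc_bar tube_coef_sym.
rewrite starM star_sclr -sclC !starM -irrC_star starK sclCA.
rewrite (rmorphM (irrC (bar k)) (scl _)) /= endo_scl -mulrA; congr (_ * _).
rewrite !rmorphM !mulrA -(ctx (rC_hom k _)).
by rewrite -[irrC (bar k) (irr l _) * _]rmorphM -hwpS rmorphM.
Qed.

Lemma tube_e_mem Z (n : I -> nat) (W : forall l, 'I_(n l) -> M) p q :
  drinfeld_commutant D irrC Z ->
  (forall l, orthonormal_basis (hom_space (irr l) (sg Z)) (@W l)) ->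
  tube irr irrC (tube_e irr irrC Z W p q).
Proof.
move=> [DZ hZ] hW l k m; rewrite tube_e_eval; case: ifP => [|_]; last exact: hom0.
move=> /andP[/eqP lp /eqP mq]; apply: homZ; have h1 := fus_star hD DZ.
rewrite lp mq => x /=; rewrite (ctx (W_hom hW _ _)) (ctx (hb_hom_eq hZ _ _)).
have h := hom_star (@irr_star _) h1 (W_hom hW (tagged q)).
by rewrite (whisk (irrC k) (h x)) !mulrA.
Qed.

Lemma average_hb_eq0 Z Z' Q : drinfeld_commutant D irrC Z ->
  drinfeld_commutant D irrC Z' -> hb_simple irrC Z -> hb_simple irrC Z' ->
  ~ hb_equivalent irrC Z Z' -> hom_space (sg Z) (sg Z') Q ->
  average (sg Z) (sg Z') (E Z) (E Z') Q = 0.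
Proof.
move=> cZ cZ' sZ sZ' hne hQ; apply: contrapT => h; apply: hne.
exact: (hb_schur cZ cZ' sZ sZ' (average_hb_hom cZ cZ' hQ) h).
Qed.

Lemma tube_e_orthogonal Z Z' (n n' : I -> nat) (W : forall l, 'I_(n l) -> M)
    (W' : forall l, 'I_(n' l) -> M) (p q : {l : I & 'I_(n l)})
    (p' q' : {l : I & 'I_(n' l)}) :
  drinfeld_commutant D irrC Z -> drinfeld_commutant D irrC Z' ->
  hb_simple irrC Z -> hb_simple irrC Z' -> ~ hb_equivalent irrC Z Z' ->
  (forall l, orthonormal_basis (hom_space (irr l) (sg Z)) (@W l)) ->
  (forall l, orthonormal_basis (hom_space (irr l) (sg Z')) (@W' l)) ->
  tube_mul irr irrC T (tube_e irr irrC Z W p q) (tube_e irr irrC Z' W' p' q') = 0.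
Proof.
move=> cZ cZ' sZ sZ' hne hW hW'; apply/ffunP => -[[l k] m].
rewrite tube_e_mul // [RHS]ffunE; case: ifP => // /and3P[_ /eqP qp _].
rewrite average_hb_eq0 ?mulr0 ?mul0r ?mulr0 //.
apply: homM (W_hom hW' _) _; rewrite -qp.
by apply: hom_star (W_hom hW _); [exact: irr_star|exact: (fus_star hD cZ.1)].
Qed.

Lemma global_dim_gt0 : 0 < global_dim irrC.
Proof.
rewrite /global_dim (bigD1 o) //= ltr_wpDr //.
  by apply: sumr_ge0 => b _; exact: sqr_ge0.
by rewrite exprn_gt0 // dc_dimension dc_gt0.
Qed.

Lemma dimension_gt0 rho : D rho -> 0 < dimension rho.
Proof. by move=> h; apply: lt_le_trans ltr01 _; exact: (dimension_ge1 hfactor hD h). Qed.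

(** This fixes the prefactor of [e]: two coefficients times the Schur scalar of the average must be
    one coefficient. *)
Lemma tube_coef_mul Z (n : I -> nat) (p q q' : {l : I & 'I_(n l)}) : D (sg Z) ->
  tube_coef Z p q * tube_coef Z q q' *
    (global_dim irrC * dimension (irr (tag q)) / dimension (sg Z))
  = tube_coef Z p q'.
Proof.
move=> DZ; rewrite /tube_coef.
have hg := global_dim_gt0; have hs := dimension_gt0 DZ.
have hd l : 0 < Num.sqrt (dimension (irr l)) by rewrite sqrtr_gt0 dimension_gt0 //; exact: irr_obj.
have e : dimension (irr (tag q)) = Num.sqrt (dimension (irr (tag q))) ^+ 2.
  by rewrite sqr_sqrtr // ltW // dimension_gt0 //; exact: irr_obj.
rewrite [X in _ * (_ * X / _)]e.
have h1 := hd (tag p); have h2 := hd (tag q); have h3 := hd (tag q').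
move: (Num.sqrt _) (Num.sqrt _) (Num.sqrt _) h1 h2 h3 => x y z h1 h2 h3.
by field; rewrite !gt_eqF.
Qed.

Lemma tube_e_matrix_mul Z (n : I -> nat) (W : forall l, 'I_(n l) -> M)
    (p q p' q' : {l : I & 'I_(n l)}) :
  drinfeld_commutant D irrC Z -> hb_simple irrC Z ->
  (forall l, orthonormal_basis (hom_space (irr l) (sg Z)) (@W l)) ->
  tube_mul irr irrC T (tube_e irr irrC Z W p q) (tube_e irr irrC Z W p' q')
  = if q == p' then tube_e irr irrC Z W p q' else 0.
Proof.
move=> cZ sZ hW; apply/ffunP => -[[l k] m]; rewrite tube_e_mul //.
case: q => lq iq; case: p' => lp ip /=; have [e|ne] := eqVneq lq lp; last first.
  rewrite andbF; case: eqP => [[e _]|_]; last by rewrite ffunE.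
  by case/eqP: ne.
subst lp; rewrite andTb -tag_eqE /tag_eq eqxx /= tagged_asE.
rewrite (average_irr cZ sZ (irr_obj lq) (@irr_simple lq) (W_hom hW ip) (W_hom hW iq)).
rewrite (W_orth hW).
have [e|ne] := eqVneq iq ip; last first.
  by rewrite mulr0n !(mulr0, mul0r) if_same ffunE.
rewrite tube_e_eval; case: ifP => // _; subst ip.
rewrite mulr1 -[in RHS](tube_coef_mul p (Tagged _ iq) q' cZ.1).
rewrite sclAC -(mulrA (scl _)) sclCA.
rewrite [LHS]mulrA -(rmorphM (@scl R M)) -rmorphM; congr (scl _%:C * _) => /=.
by ring.
Qed.

(** * The elements [e] span the tube algebra *)

Section Spanning.
Variables (K : finType) (Z : K -> hb_obj M J) (hZ : hb_representatives D irrC Z).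
Variables (n : K -> I -> nat) (W : forall (k : K) l, 'I_(n k l) -> M).
Hypothesis hW : forall (k : K) l,
  orthonormal_basis (hom_space (irr l) (sg (Z k))) (@W k l).
Local Notation P := (fun k : K => {l : I & 'I_(n k l)}).
Local Notation e k := (tube_e irr irrC (Z k) (@W k)).

Definition in_span (X : tube_family M I J) : Prop :=
  exists c : forall k : K, P k -> P k -> R[i], X = \sum_(k : K) \sum_a \sum_(b : P k) c k a b *: e k a b.

Lemma in_span_sum (O : finType) (F : O -> tube_family M I J) :
  (forall p, in_span (F p)) -> in_span (\sum_p F p).
Proof.
move=> /choice[c hc]; exists (fun (k : K) (a b : P k) => \sum_p c p k a b).
rewrite (eq_bigr _ (fun p _ => hc p)) exchange_big; apply: eq_bigr => k _ /=.
rewrite exchange_big; apply: eq_bigr => a _ /=.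
rewrite exchange_big; apply: eq_bigr => b _ /=.
by rewrite scaler_suml.
Qed.

Lemma in_spanZ (x : R[i]) X : in_span X -> in_span (x *: X).
Proof.
case=> c ->; exists (fun (k : K) (a b : P k) => x * c k a b).
rewrite scaler_sumr; apply: eq_bigr => k _.
rewrite scaler_sumr; apply: eq_bigr => a _.
rewrite scaler_sumr; apply: eq_bigr => b _.
by rewrite scalerA.
Qed.

Lemma in_span_e (k : K) (a b : P k) : in_span (e k a b).
Proof.
(* For different [k] and [k'] the indices have different types, so the Kronecker delta compares
   tagged pairs. *)
pose c (k' : K) (a' b' : P k') : R[i] :=
  ((Tagged P a' == Tagged P a) && (Tagged P b' == Tagged P b))%:R.
exists c; rewrite (bigD1 k) //= [X in _ + X]big1 ?addr0 => [|k' kk'].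
  rewrite (bigD1 a) //= [X in _ + X]big1 ?addr0 => [|a' aa'].
    rewrite (bigD1 b) //= [X in _ + X]big1 ?addr0 => [|b' bb'].
      by rewrite /c !eqxx scale1r.
    by rewrite /c !eq_Tagged /= (negPf bb') andbF scale0r.
  rewrite big1 // => b' _; rewrite /c !eq_Tagged /= (negPf aa').
  by rewrite scale0r.
rewrite big1 // => a' _; rewrite big1 // => b' _.
by rewrite /c -tag_eqE /tag_eq /= (negPf kk') scale0r.
Qed.

Lemma tube_coef_neq0 Z0 (n0 : I -> nat) (p q : {l : I & 'I_(n0 l)}) : D (sg Z0) ->
  (tube_coef Z0 p q)%:C != 0 :> R[i].
Proof.
move=> DZ; rewrite fmorph_eq0 /tube_coef gt_eqF // divr_gt0 //.
  exact: dimension_gt0.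
have hd l : 0 < Num.sqrt (dimension (irr l)).
  by rewrite sqrtr_gt0; apply: dimension_gt0; exact: irr_obj.
by apply: mulr_gt0 => //; apply: mulr_gt0 => //; exact: global_dim_gt0.
Qed.

(* Expand the compression of [induced_isolate] along the decomposition of the
   induced object into simple objects of the commutant. *)
Lemma tube_elt_in_span l g0 m x :
  hom_space (irr l \o irrC g0) (irrC g0 \o irr m) x ->
  in_span (tube_elt l g0 m x).
Proof.
move=> hx; pose nu := irr m.
have [hrep _ hsurj] := hZ.
have cZ (k : K) : drinfeld_commutant D irrC (Z k) := (hrep k).1.
have Dtau b : D (irrC b \o nu \o irrC (bar b)).
  do 2?[apply: (fus_comp hD)]; [exact/hCD/irrC_obj|exact: irr_obj|exact/hCD/irrC_obj].
have [iota [S [Di hS Siso Ssum]]] := fus_direct_sum Dtau.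
have cI := induced_obj (irr_obj m) Di hS Siso Ssum.
have [Q [Y [v [hY hv]]]] := hb_decomposition cI.
have hk s : exists k : K, hb_equivalent irrC (Y s) (Z k).
  by have [cY sY _ _] := hY s; exact: hsurj.
have [k hk'] := choice hk.
have hus s : exists us, hb_hom irrC (Y s) (Z (k s)) us /\ unitary_elt us.
  by have [us h1 h2] := hk' s; exists us.
have [u hu] := choice hus.
pose U s := v s * (u s)^†.
have hU s : hb_hom irrC (Z (k s)) (HbObj iota (induced_br nu S)) (U s).
  have [cY _ h3 _] := hY s; apply: hb_homM h3 _; apply: hb_hom_star (hu s).1 => //.
have Usum : \sum_s U s * (U s)^† = 1.
  rewrite -hv; apply: eq_bigr => s _; have [_ [uu _]] := hu s.
  by rewrite /U starM starK -mulrA (mulrA (u s)^†) uu mul1r.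
clearbody U.
have hi := fus_star hD Di.
pose A := S g0 * x * irr l (Rbc g0); pose B := unit_leg nu S.
have hA : hom_space (irr l) iota A := induced_leg_hom hS hx.
have hB : hom_space (irr m) iota B := unit_leg_hom hS.
have hUS s : hom_space iota (sg (Z (k s))) (U s)^†.
  by apply: (hom_star _ hi (hU s).1); exact: (fus_star hD (cZ _).1).
have [al hal] : exists al : forall s, 'I_(n (k s) l) -> R[i], forall s,
    (U s)^† * A = \sum_i scl (al s i) * W i.
  have h s : exists al : 'I_(n (k s) l) -> R[i], (U s)^† * A = \sum_i scl (al i) * W i.
    by apply: (W_span (hW (k s))); exact: homM (hUS s) hA.
  exists (fun s => projT1 (cid (h s))) => s; exact: (projT2 (cid (h s))).
have [be hbe] : exists be : forall s, 'I_(n (k s) m) -> R[i], forall s,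
    (U s)^† * B = \sum_i scl (be s i) * W i.
  have h s : exists be : 'I_(n (k s) m) -> R[i], (U s)^† * B = \sum_i scl (be i) * W i.
    by apply: (W_span (hW (k s))); exact: homM (hUS s) hB.
  exists (fun s => projT1 (cid (h s))) => s; exact: (projT2 (cid (h s))).
have [c c0 hc] := induced_isolate (irr_obj m) Siso Ssum hx.
(* Insert [\sum_s U U^† = 1]. As [U s] is a morphism of half-braidings, the compression of the
   induced braiding becomes a combination of entries of the braidings of the [Z (k s)], with
   coefficients independent of [g]. *)
have key g : (if g == g0 then scl c * x else 0) = \sum_s \sum_i \sum_j
    scl (Num.conj (be s j) * al s i) * (irrC g (@W _ m j)^† * E (Z (k s)) g * @W _ l i).
  rewrite -hc -/A -/B -[A]mul1r -Usum mulr_suml mulr_sumr; apply: eq_bigr => s _.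
  have -> : irrC g B^† * induced_br nu S g * (U s * (U s)^† * A)
      = irrC g ((U s)^† * B)^† * E (Z (k s)) g * ((U s)^† * A).
    have hUg := (hU s).2 g; rewrite /= in hUg.
    rewrite -!mulrA (mulrA (induced_br nu S g)) hUg.
    by rewrite starM starK rmorphM !mulrA.
  rewrite hal mulr_sumr; apply: eq_bigr => i _.
  rewrite hbe star_sum rmorph_sum !mulr_suml; apply: eq_bigr => j _ /=.
  rewrite starM star_scl -sclC (rmorphM (irrC g)) /= endo_scl -(mulrA (scl _)).
  by rewrite sclMM.
(* Dividing by [tube_coef] undoes the prefactor of [e]; the weight [dc g] survives only at [g0],
   where [c * dc g0] is divided out. *)
have -> : tube_elt l g0 m x = (c * (dc g0)%:C)^-1 *: \sum_s \sum_i \sum_j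
   (Num.conj (be s j) * al s i / (tube_coef (Z (k s)) (Tagged (fun l => 'I_(n (k s) l)) i)
      (Tagged (fun l => 'I_(n (k s) l)) j))%:C) *:
   e (k s) (Tagged (fun l => 'I_(n (k s) l)) i) (Tagged (fun l => 'I_(n (k s) l)) j).
  apply/ffunP => -[[l' g] m']; rewrite tube_elt_eval tube_scale_eval.
  transitivity (scl (c * (dc g0)%:C)^-1 * (scl (dc g)%:C *
      (if (l' == l) && (m' == m) then (if g == g0 then scl c * x else 0) else 0))).
    rewrite !xpair_eqE; case: (l' == l); last by rewrite !mulr0.
    case: (m' == m); last by rewrite !andbF !mulr0.
    rewrite andbT; case: eqP => [->|_]; last by rewrite !mulr0.
    by rewrite invfM (rmorphM (@scl R M)) -mulrA sclK ?dc_neq0 // sclK.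
  congr (_ * _); rewrite tube_sum_eval key.
  case: ifP => hlm; last first.
    rewrite mulr0 big1 // => s _; rewrite tube_sum_eval big1 // => i _.
    rewrite tube_sum_eval big1 // => j _.
    by rewrite tube_scale_eval tube_e_eval /= hlm mulr0.
  rewrite mulr_sumr; apply: eq_bigr => s _; rewrite tube_sum_eval mulr_sumr.
  apply: eq_bigr => i _; rewrite tube_sum_eval mulr_sumr; apply: eq_bigr => j _.
  rewrite tube_scale_eval tube_e_eval /= hlm (mulrA (scl _)) [RHS](mulrA (scl _)).
  rewrite -!(rmorphM (@scl R M)); congr (scl _ * _); rewrite [X in _ = _ * X]rmorphM /= [RHS]mulrA divfK.
    by rewrite mulrC.
  by apply: tube_coef_neq0; exact: (cZ _).1.
apply: in_spanZ; apply: in_span_sum => s; apply: in_span_sum => i.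
by apply: in_span_sum => j; apply: in_spanZ; exact: in_span_e.
Qed.

Lemma tube_in_span (X : tube_family M I J) : tube irr irrC X -> in_span X.
Proof.
move=> hX; pose X' : {ffun I * J * I -> M} := X.
have -> : X = \sum_(t : I * J * I) tube_elt t.1.1 t.1.2 t.2 (X' t).
  apply/ffunP => t; rewrite tube_sum_eval (bigD1 t) //= big1 ?addr0 => [|t' tt'].
    by rewrite tube_elt_eval; case: t => [[l g] m]; rewrite eqxx.
  by rewrite tube_elt_eval; case: t' tt' => [[l g] m]; rewrite eq_sym => /negPf ->.
apply: in_span_sum => -[[l g] m]; apply: tube_elt_in_span; exact: hX.
Qed.

End Spanning.

Lemma tube_mul_linearl a (X Y V : tube_family M I J) :
  tube_mul irr irrC T (a *: X + Y) V
  = a *: tube_mul irr irrC T X V + tube_mul irr irrC T Y V.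
Proof.
apply/ffunP => -[[l k] m]; rewrite tube_mul_eval [RHS]ffunE tube_scale_eval.
rewrite !tube_mul_eval.
do 3!(rewrite mulr_sumr -big_split /=; apply: eq_bigr => ? _).
rewrite mulr_sumr -big_split /=; apply: eq_bigr => i _.
by rewrite ffunE tube_scale_eval mulrDr mulrDl sclCA -(mulrA (scl a)).
Qed.

Lemma tube_mul_linearr a (X Y V : tube_family M I J) :
  tube_mul irr irrC T V (a *: X + Y)
  = a *: tube_mul irr irrC T V X + tube_mul irr irrC T V Y.
Proof.
apply/ffunP => -[[l k] m]; rewrite tube_mul_eval [RHS]ffunE tube_scale_eval.
rewrite !tube_mul_eval.
do 3!(rewrite mulr_sumr -big_split /=; apply: eq_bigr => ? _).
rewrite mulr_sumr -big_split /=; apply: eq_bigr => i _.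
rewrite ffunE tube_scale_eval rmorphD mulrDr !mulrDl (rmorphM (irrC _)) /= endo_scl.
by rewrite sclCA -!(mulrA (scl a)).
Qed.

Lemma tube_starD (r rb : J -> M) (X Y : tube_family M I J) :
  tube_star irr irrC bar r rb (X + Y)
  = tube_star irr irrC bar r rb X + tube_star irr irrC bar r rb Y.
Proof.
apply/ffunP => -[[m k'] l]; rewrite [RHS]ffunE.
have [c cK Kc] := injF_bij bar_inj; rewrite -(Kc k').
by rewrite !tube_star_eval ffunE starD mulrDr rmorphD mulrDl mulrDr.
Qed.

(** If it vanished, so would its product with the opposite unit, namely [e p p], whose component at
    [o] is the nonzero scalar [tube_coef * dc o]. *)
Lemma tube_e_neq0 Z (n : I -> nat) (W : forall l, 'I_(n l) -> M)
    (p q : {l : I & 'I_(n l)}) :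
  drinfeld_commutant D irrC Z -> hb_simple irrC Z ->
  (forall l, orthonormal_basis (hom_space (irr l) (sg Z)) (@W l)) ->
  tube_e irr irrC Z W p q <> 0.
Proof.
move=> cZ sZ hW e0; have := tube_e_matrix_mul p q q p cZ sZ hW.
rewrite eqxx e0 -[0]addr0 -[X in tube_mul _ _ _ (X + 0)](scale0r (0 : tube_family M I J)).
rewrite tube_mul_linearl scale0r add0r => epp.
have : tube_mul irr irrC T 0 (tube_e irr irrC Z W q p) = 0.
  have := tube_mul_linearl (-1) 0 0 (tube_e irr irrC Z W q p).
  by rewrite scaler0 addr0 scaleN1r addNr.
rewrite epp => /ffunP/(_ (tag p, o, tag p)).
rewrite tube_e_eval !eqxx [RHS]ffunE (hb_unit cZ.2) irrC_id mulr1 (W_orth hW) eqxx.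
rewrite mulr1 => /eqP; rewrite -(rmorph0 (@scl R M)) => /eqP/scl_inj/eqP.
rewrite rmorphM mulf_eq0 (negPf (dc_neq0 o)) orbF.
by rewrite (negPf (tube_coef_neq0 p p cZ.1)).
Qed.

Lemma tube_e_inhabited Z (n : I -> nat) (W : forall l, 'I_(n l) -> M) :
  D (sg Z) -> (forall l, orthonormal_basis (hom_space (irr l) (sg Z)) (@W l)) ->
  exists p : {l : I & 'I_(n l)}, True.
Proof.
move=> DZ hW; have [[|q] [f [w [hw wsum]]]] := fus_semisimple hD DZ.
  by move/eqP: wsum; rewrite big_ord0 eq_sym oner_eq0.
have [Df sf hf hiso] := hw ord0; have [_ _ surj] := hirr.
have [l [u hu [uu uu']]] := surj _ Df sf.
have h : hom_space (irr l) (sg Z) (w ord0 * u^†).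
  by apply: homM hf _; apply: hom_star hu; [exact: (fus_star hD Df)|exact: irr_star].
have [c hc] := W_span hW h.
case nl : (n l) => [|s]; last first.
  by exists (Tagged (fun l => 'I_(n l)) (cast_ord (esym nl) ord0)).
have w0 : w ord0 * u^† = 0.
  by rewrite hc; apply: big1 => i _; have := ltn_ord i; rewrite [X in (_ < X)%N]nl.
have := congr1 (fun x => (w ord0)^† * (x * u)) w0.
rewrite mul0r mulr0 -mulrA uu mulr1 hiso => /eqP.
by rewrite oner_eq0.
Qed.

End Tube.
End RelativeCommutant.
End HalfBraidings.

(** * Algebras spanned by matrix units *)

Section MatrixUnitDecomposition.
Variables (F : fieldType) (V : lmodType F) (mul : V -> V -> V) (star : V -> V).
Variables (A : set V) (K : finType) (P : K -> finType).
Variable e : forall k, P k -> P k -> V.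
Hypothesis mul_linearl : forall a x y v, mul (a *: x + y) v = a *: mul x v + mul y v.
Hypothesis mul_linearr : forall a x y v, mul v (a *: x + y) = a *: mul v x + mul v y.
Hypothesis starD : forall x y, star (x + y) = star x + star y.
Hypothesis A_subspace : is_subspace A.
Hypothesis A_e : forall k a b, A (@e k a b).
Hypothesis e_neq0 : forall k a b, @e k a b <> 0.
Hypothesis e_mul : forall k a b c d,
  mul (@e k a b) (@e k c d) = if b == c then e a d else 0.
Hypothesis e_orthogonal : forall k k' a b c d, k != k' ->
  mul (@e k a b) (@e k' c d) = 0.
Hypothesis e_star : forall k a b, star (@e k a b) = e b a.
Hypothesis e_span : forall x, A x ->
  exists c : forall k, P k -> P k -> F, x = \sum_k \sum_a \sum_b c k a b *: e a b.
Hypothesis e_inhabited : forall k, exists a : P k, True.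

Let z k := \sum_a @e k a a.

Let mul0l v : mul 0 v = 0.
Proof. by have := mul_linearl (-1) 0 0 v; rewrite scaler0 addr0 scaleN1r addNr. Qed.
Let mul0r v : mul v 0 = 0.
Proof. by have := mul_linearr (-1) 0 0 v; rewrite scaler0 addr0 scaleN1r addNr. Qed.
Let mulDl x y v : mul (x + y) v = mul x v + mul y v.
Proof. by have := mul_linearl 1 x y v; rewrite !scale1r. Qed.
Let mulDr x y v : mul v (x + y) = mul v x + mul v y.
Proof. by have := mul_linearr 1 x y v; rewrite !scale1r. Qed.
Let mulZl a x v : mul (a *: x) v = a *: mul x v.
Proof. by have := mul_linearl a x 0 v; rewrite mul0l !addr0. Qed.
Let mulZr a x v : mul v (a *: x) = a *: mul v x.
Proof. by have := mul_linearr a x 0 v; rewrite mul0r !addr0. Qed.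
Let mul_suml (Q : finType) (G : Q -> V) v :
  mul (\sum_q G q) v = \sum_q mul (G q) v.
Proof. exact: (big_morph (mul^~ v) (fun x y => mulDl x y v) (mul0l v)). Qed.
Let mul_sumr (Q : finType) (G : Q -> V) v :
  mul v (\sum_q G q) = \sum_q mul v (G q).
Proof. exact: (big_morph (mul v) (fun x y => mulDr x y v) (mul0r v)). Qed.

Let subspaceZ (B : set V) a x : is_subspace B -> B x -> B (a *: x).
Proof. by move=> [B0 h] Bx; rewrite -[_ *: _]addr0; exact: h. Qed.
Let subspaceD (B : set V) x y : is_subspace B -> B x -> B y -> B (x + y).
Proof. by move=> [B0 h] Bx By; rewrite -[x]scale1r; exact: h. Qed.
Let subspace_sum (B : set V) (Q : finType) (G : Q -> V) :
  is_subspace B -> (forall q, B (G q)) -> B (\sum_q G q).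
Proof.
move=> hB h; apply: (big_ind B) => // [|x y]; last exact: subspaceD.
by case: hB.
Qed.

Let A_ind (Q : V -> Prop) : is_subspace Q -> (forall k a b, Q (@e k a b)) ->
  forall x, A x -> Q x.
Proof.
move=> hQ he x /e_span[c ->]; do 3![apply: subspace_sum => // ?].
exact: subspaceZ.
Qed.

Let A_mul x y : A x -> A y -> A (mul x y).
Proof.
move=> Ax Ay; move: x Ax; apply: A_ind.
  split=> [|a x x' h h']; first by rewrite /= mul0l; case: A_subspace.
  by rewrite /= mul_linearl; case: A_subspace => _; apply.
move=> k a b; move: y Ay; apply: A_ind.
  split=> [|c x x' h h']; first by rewrite /= mul0r; case: A_subspace.
  by rewrite /= mul_linearr; case: A_subspace => _; apply.
move=> k' c d; have [kk'|kk'] := eqVneq k k'.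
  by subst k'; rewrite e_mul; case: ifP => // _; case: A_subspace.
by rewrite e_orthogonal //; case: A_subspace.
Qed.

(** Associativity is not assumed: by linearity in each factor it reduces to matrix units, where the
    product rules decide it. *)
Let A_mulA x y v : A x -> A y -> A v -> mul (mul x y) v = mul x (mul y v).
Proof.
move=> Ax Ay Av; move: x Ax; apply: A_ind.
  split=> [|a x x' h h']; first by rewrite /= !mul0l.
  by rewrite /= !mul_linearl h h'.
move=> k a b; move: y Ay; apply: A_ind.
  split=> [|c x x' h h']; first by rewrite /= !(mul0r, mul0l).
  by rewrite /= !(mul_linearr, mul_linearl) h h'.
move=> k' a' b'; move: v Av; apply: A_ind.
  split=> [|c x x' h h']; first by rewrite /= !mul0r.
  by rewrite /= !mul_linearr h h'.
move=> k'' a'' b''; have [kk'|kk'] := eqVneq k k'.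
  subst k'; have [kk''|kk''] := eqVneq k k''.
    subst k''; rewrite !e_mul.
    by case: (b =P a') => h1; case: (b' =P a'') => h2; subst;
      rewrite ?(mul0l, mul0r, e_mul, eqxx) //; case: eqP.
  rewrite [mul (e a' b') _]e_orthogonal // mul0r e_mul.
  by case: eqP => _; rewrite ?mul0l ?e_orthogonal.
rewrite e_orthogonal // mul0l; have [kk''|kk''] := eqVneq k' k''.
  by subst k''; rewrite e_mul; case: eqP => _; rewrite ?mul0r ?e_orthogonal.
by rewrite [mul (e a' b') _]e_orthogonal // mul0r.
Qed.

Let A_z k : A (z k).
Proof. exact: subspace_sum. Qed.

Let z_mul_e k a b : mul (z k) (@e k a b) = e a b.
Proof.
rewrite mul_suml (bigD1 a) //= e_mul eqxx big1 ?addr0 // => c ca.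
by rewrite e_mul (negPf ca).
Qed.

Let e_mul_z k a b : mul (@e k a b) (z k) = e a b.
Proof.
rewrite mul_sumr (bigD1 b) //= e_mul eqxx big1 ?addr0 // => c ca.
by rewrite e_mul eq_sym (negPf ca).
Qed.

Let z_mul_e0 k k' a b : k != k' -> mul (z k) (@e k' a b) = 0.
Proof. by move=> kk'; rewrite mul_suml big1 // => c _; exact: e_orthogonal. Qed.

Let e_mul_z0 k k' a b : k != k' -> mul (@e k' a b) (z k) = 0.
Proof.
by move=> kk'; rewrite mul_sumr big1 // => c _; apply: e_orthogonal; rewrite eq_sym.
Qed.

Let z_central k x : A x -> mul (z k) x = mul x (z k).
Proof.
move: x; apply: A_ind.
  split=> [|a x x' h h']; first by rewrite /= mul0r mul0l.
  by rewrite /= mul_linearr mul_linearl h h'.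
move=> k' a b; have [kk'|kk'] := eqVneq k k'.
  by subst k'; rewrite z_mul_e e_mul_z.
by rewrite z_mul_e0 // e_mul_z0.
Qed.

Let z_idem k : mul (z k) (z k) = z k.
Proof. by rewrite mul_sumr; apply: eq_bigr => a _; exact: z_mul_e. Qed.

Let z_star k : star (z k) = z k.
Proof.
have star0 : star 0 = 0 by apply: (addrI (star 0)); rewrite -starD !addr0.
by rewrite (big_morph star starD star0); apply: eq_bigr => a _; exact: e_star.
Qed.

Let z_neq0 k : z k <> 0.
Proof.
by move=> z0; have [a _] := e_inhabited k; have := z_mul_e a a; rewrite z0 mul0l
  => /esym; exact: e_neq0.
Qed.

Let corner k (a b : P k) x : A x ->
  exists c : F, mul (mul (e a a) x) (e b b) = c *: e a b.
Proof.
move: x; apply: A_ind.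
  split=> [|c x x' [d h] [d' h']] /=.
    by exists 0; rewrite mul0r mul0l scale0r.
  by exists (c * d + d'); rewrite mul_linearr mul_linearl h h' scalerDl scalerA.
move=> k' a' b'; have [kk'|kk'] := eqVneq k k'; last first.
  by exists 0; rewrite e_orthogonal // mul0l scale0r.
subst k'; rewrite e_mul; case: eqP => _; last by exists 0; rewrite mul0l scale0r.
rewrite e_mul; case: eqP => _; last by exists 0; rewrite scale0r.
by exists 1; rewrite scale1r.
Qed.

Let corners k x : A x -> mul (z k) x = x ->
  x = \sum_(a : P k) \sum_(b : P k) mul (mul (e a a) x) (e b b).
Proof.
move=> Ax zx; rewrite -{1}zx -{1}zx (z_central k Ax) -A_mulA //.
rewrite {1}/z !mul_suml; apply: eq_bigr => a _.
by rewrite /z mul_sumr.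
Qed.

Let block k : set V := [set x | A x /\ mul (z k) x = x].

Let block_e k (a b : P k) : block k (e a b).
Proof. by split; [exact: A_e|exact: z_mul_e]. Qed.

Let block_ideal k : two_sided_ideal mul A (block k).
Proof.
split=> [x []//| |x y Ax [Ay zy]].
  split=> [|a x y [Ax zx] [Ay zy]]; split; first by case: A_subspace.
  - exact: mul0r.
  - by case: A_subspace => _; apply.
  - by rewrite mul_linearr zx zy.
split; split; try exact: A_mul; last by rewrite -A_mulA // zy.
by rewrite -A_mulA // (z_central k Ax) A_mulA // zy.
Qed.

Let coblock_ideal k : two_sided_ideal mul A [set x | A x /\ mul (z k) x = 0].
Proof.
split=> [x []//| |x y Ax [Ay zy]].
  split=> [|a x y [Ax zx] [Ay zy]]; split; first by case: A_subspace.
  - exact: mul0r.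
  - by case: A_subspace => _; apply.
  - by rewrite mul_linearr zx zy scaler0 addr0.
split; split; try exact: A_mul; last by rewrite -A_mulA // zy mul0l.
by rewrite -A_mulA // (z_central k Ax) A_mulA // zy mul0r.
Qed.

(** A nonzero ideal has an element with a nonzero corner, a multiple of some [e a b]; hence it
    contains every [e d d], and their sum is the unit of the block. *)
Let block_simple k : simple_algebra mul (block k).
Proof.
split.
  have [a _] := e_inhabited k; exists (e a a), (e a a); split=> //.
  by rewrite e_mul eqxx; exact: e_neq0.
move=> L [LB hL Lmul]; have [h|h] := pselect (forall x, L x -> x = 0).
  by left; apply/seteqP; split=> x /= => [/h|->] //; case: hL.
right; apply/seteqP; split=> // y [Ay zy].
have [x [Lx x0]] : exists x, L x /\ x <> 0.
  by move/existsNP: h => [x /not_implyP]; exists x.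
have [Ax zx] := LB _ Lx.
have [a [b hab]] : exists (a b : P k), mul (mul (e a a) x) (e b b) <> 0.
  apply: contrapT => /forallNP h'; apply: x0; rewrite (corners Ax zx) big1 // => a _.
  by rewrite big1 // => b _; move/forallNP: (h' a) => /(_ b)/contrapT.
have [c hc] := corner a b Ax.
have c0 : c != 0 by apply/eqP => c0; apply: hab; rewrite hc c0 scale0r.
have Leab : L (e a b).
  rewrite -[e a b](scalerK c0) -hc; apply: subspaceZ => //.
  apply: (Lmul (e b b) _ (block_e b b) _).2.
  exact: (Lmul (e a a) _ (block_e a a) Lx).1.
have Le d : L (@e k d d).
  have -> : @e k d d = mul (mul (e d a) (e a b)) (e b d) by rewrite !(e_mul, eqxx).
  apply: (Lmul (e b d) _ (block_e b d) _).2.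
  exact: (Lmul (e d a) _ (block_e d a) Leab).1.
rewrite -zy mul_suml; apply: subspace_sum => // d.
exact: (Lmul y _ (conj Ay zy) (Le d)).2.
Qed.

(** The corner at one index [a] gives [c]; centrality transports it to every [b] through [e b a] and
    [e a b]. *)
Let central_multiple k p : A p -> mul (z k) p = p ->
  (forall x, A x -> mul p x = mul x p) ->
  exists c, p = c *: z k.
Proof.
move=> Ap zp pc; have [a _] := e_inhabited k; have [c hc] := corner a a Ap.
have {}hc : mul (e a a) p = c *: e a a.
  by rewrite -hc A_mulA // pc // -A_mulA // e_mul eqxx.
exists c; rewrite -zp mul_suml scaler_sumr; apply: eq_bigr => b _.
have -> : e b b = mul (e b a) (mul (e a a) (e a b)) by rewrite !(e_mul, eqxx).
rewrite A_mulA //; last exact: A_mul.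
rewrite A_mulA // -(pc (e a b)) // -(A_mulA (A_e a a)) // hc.
by rewrite mulZl mulZr.
Qed.

Lemma matrix_units_decomposition :
  (forall k, exists2 B, simple_component mul A B & matrix_units mul star B (@e k)) /\
  [/\ forall k, minimal_central_projection mul star A (z k),
      forall k k', k != k' -> mul (z k) (z k') = 0 &
      algebra_one mul A (\sum_k z k)].
Proof.
split=> [k|].
  exists (block k); split=> //.
  (* The complementary ideal is the annihilator of [z k], through the splitting of [x] into [z k x]
     and [x - z k x]. *)
  - exists [set x | A x /\ mul (z k) x = 0]; split=> //.
      apply/seteqP; split=> [x [[_ zx] [_ zx0]]|x ->]; first by rewrite -zx zx0.
      by split; split; rewrite ?mul0r //; case: A_subspace.
    move=> x Ax; have hz : A (mul (z k) x) by exact: A_mul.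
    exists (mul (z k) x), (x - mul (z k) x); split; last by rewrite addrC subrK.
      by split; rewrite // -A_mulA // z_idem.
    split; first by rewrite -scaleN1r addrC; case: A_subspace => _; apply.
    by rewrite -scaleN1r mulDr mulZr -A_mulA // z_idem scaleN1r subrr.
  - move=> x [Ax zx].
    have /choice[c hc] : forall ab : P k * P k, exists c : F,
        mul (mul (e ab.1 ab.1) x) (e ab.2 ab.2) = c *: e ab.1 ab.2.
      by move=> [a b]; exact: corner.
    exists (fun a b => c (a, b)); rewrite {1}(corners Ax zx).
    by apply: eq_bigr => a _; apply: eq_bigr => b _; exact: hc (a, b).
split=> [k|k k' kk'|].
- split=> // [|p [Ap sp pp pc] pz]; first by split=> // x; exact: z_central.
  have [c pcz] : exists c, p = c *: z k by apply: central_multiple => //; rewrite z_central.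
  move: pp; rewrite pcz mulZl mulZr z_idem scalerA => /eqP.
  rewrite -subr_eq0 -scalerBl scaler_eq0 (introF eqP (@z_neq0 k)) orbF.
  rewrite -[X in _ - X]mulr1 -mulrBr mulf_eq0 subr_eq0.
  by case/orP => /eqP ->; [left; rewrite scale0r|right; rewrite scale1r].
- by rewrite mul_sumr big1 // => a _; exact: z_mul_e0.
- split; first exact: subspace_sum.
  apply: A_ind.
    split=> [|a x y [h1 h2] [h3 h4]] /=; first by rewrite mul0l mul0r.
    by rewrite mul_linearl mul_linearr h1 h2 h3 h4.
  move=> k a b; rewrite mul_suml mul_sumr (bigD1 k) //= [in X in _ /\ X](bigD1 k) //=.
  rewrite z_mul_e e_mul_z !big1 ?addr0 // => k' kk'; [exact: e_mul_z0|exact: z_mul_e0].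
Qed.
End MatrixUnitDecomposition.

Lemma normalized_conj_sol (R : realType) (M : vonNeumannAlgebra R)
    (rho rhob : {lrmorphism M -> M}) (r rb : M) :
  0 < dimension rho -> normalized_conjugate rho rhob r rb ->
  conj_sol rho rhob (scl (Num.sqrt (dimension rho))%:C * r)
    (scl (Num.sqrt (dimension rho))%:C * rb) (dimension rho).
Proof.
move=> d0 [hr hrb [ir irb] zig zag]; set d := dimension rho in d0 zig zag *.
have e : (Num.sqrt d)%:C * (Num.sqrt d)%:C = d%:C :> R[i].
  by rewrite -rmorphM -expr2 sqr_sqrtr // ltW.
have ed : scl d%:C * scl (d^-1)%:C = 1 :> M.
  by rewrite -!rmorphM /= divff ?gt_eqF // !rmorph1.
split=> [x|x||||].
- by rewrite -mulrA hr [RHS]sclCA.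
- by rewrite -mulrA hrb [RHS]sclCA.
- by rewrite starM star_sclr -sclC rmorphM /= endo_scl sclMM e zig sclE.
- by rewrite starM star_sclr -sclC rmorphM /= endo_scl sclMM e zag sclE.
- by rewrite starM star_sclr -sclC sclMM e ir mulr1.
- by rewrite starM star_sclr -sclC sclMM e irb mulr1.
Qed.

Lemma tube_subspace (R : realType) (M : vonNeumannAlgebra R) (I J : finType)
    (irr : I -> {lrmorphism M -> M}) (irrC : J -> {lrmorphism M -> M}) :
  is_subspace (tube irr irrC).
Proof.
split=> [l m n|a X Y hX hY l m n]; rewrite ffunE; first exact: hom0.
by rewrite tube_scale_eval; apply: homD; [apply: homZ; exact: hX|exact: hY].
Qed.

Theorem theorem2p6 (R : realType) (M : vonNeumannAlgebra R)
    (hfactor : is_factor M) (hIII : type_III M)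
    (D C : set {lrmorphism M -> M})
    (hD : unitary_fusion D) (hC : unitary_fusion C) (hCD : C `<=` D)
    (I : finType) (irr : I -> {lrmorphism M -> M})
    (hirr : irr_representatives D irr)
    (irrC := fun b : sub_irr C irr => irr (val b))
    (hirrC : irr_representatives C irrC)
    (hid : exists b, irrC b = idfun)
    (bar : sub_irr C irr -> sub_irr C irr) (r rb : sub_irr C irr -> M)
    (hbar : forall m, normalized_conjugate (irrC m) (irrC (bar m)) (r m) (rb m))
    (N : sub_irr C irr -> sub_irr C irr -> sub_irr C irr -> nat)
    (T : forall k m m', 'I_(N k m m') -> M)
    (hT : forall k m m',
       orthonormal_basis (hom_space (irrC k) (irrC m \o irrC m')) (@T k m m'))
    (K : finType) (Z : K -> hb_obj M (sub_irr C irr))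
    (hZ : hb_representatives D irrC Z)
    (n : K -> I -> nat) (W : forall k l, 'I_(n k l) -> M)
    (hW : forall k l,
       orthonormal_basis (hom_space (irr l) (hb_endo (Z k))) (@W k l)) :
  let A := tube irr irrC in
  let mul := tube_mul irr irrC T in
  let star := tube_star irr irrC bar r rb in
  let e k := tube_e irr irrC (Z k) (@W k) in
  let z k := tube_z irr irrC (Z k) (@W k) in
  (forall k, exists2 B, simple_component mul A B & matrix_units mul star B (e k)) /\
  [/\ forall k, minimal_central_projection mul star A (z k),
      forall k k', k != k' -> mul (z k) (z k') = 0 &
      algebra_one mul A (\sum_k z k)].
Proof.
move=> A mul star e z; have [b0 ho] := hid; have [hrep hinj _] := hZ.
have d0 b : 0 < dimension (irrC b).
  case: hirrC => h _ _; apply: lt_le_trans ltr01 _.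
  exact: (dimension_ge1 hfactor hC (h b).1).
have hcs := fun b => normalized_conj_sol (d0 b) (hbar b).
have cZ k : drinfeld_commutant D irrC (Z k) := (hrep k).1.
have sZ k : hb_simple irrC (Z k) := (hrep k).2.
apply: matrix_units_decomposition.
- exact: tube_mul_linearl.
- exact: tube_mul_linearr.
- exact: (tube_starD hC hirrC hcs).
- exact: tube_subspace.
- by move=> k a b; apply: (tube_e_mem hC hirrC hcs hD hirr).
- by move=> k a b; apply: (tube_e_neq0 hC hirrC hcs ho hT hfactor hD hCD hirr).
- move=> k a b c d.
  by apply: (tube_e_matrix_mul hC hirrC hcs b0 hT hfactor hD hCD hirr).
- move=> k k' a b c d kk'; apply: (tube_e_orthogonal hC hirrC hcs hT hD hirr) => //.
  by move/hinj => e'; rewrite e' eqxx in kk'.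
- by move=> k a b; apply: (tube_e_star hC hirrC hcs ho hD hirr).
- exact: (tube_in_span hC hirrC hcs ho hT hfactor hD hCD hirr hZ hW).
- by move=> k; exact: (tube_e_inhabited hD hirr (cZ k).1 (hW k)).
Qed.
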